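(* Let $-1/h_\tau<\kappa<1/h_\tau$ and $n\ge1$, and let $K_n(x):=\sum_{m=0}^n\frac{(-n)_m}{(1-N-n)_m}H_m(x)$ with $H_m(x)=\sum_{\alpha\in\boldsymbol{Z}_{N,m}}A_\alpha x^\alpha$. Then: (1) $K_n(x)$ is a positive semidefinite matrix for each $x\in\mathbb{T}^N$; (2) $K_n(xw)=\tau(w)^{-1}K_n(x)\tau(w)$ for all $x\in\mathbb{T}^N$, $w\in\mathcal{S}_N$; (3) $K_n(x_0)\tau(w_0)=\tau(w_0)K_n(x_0)$, where $x_0=(1,\omega,\ldots,\omega^{N-1})$, $\omega=e^{2\pi\mathrm{i}/N}$, $w_0=(1,2,\ldots,N)$; (4) $\lim_{n\to\infty}\int_{\mathbb{T}^N}f(x)^*K_n(x)g(x)\,\mathrm{d}m(x)=\langle f,g\rangle_{\mathbb{T}}$ for all $f,g\in\mathcal{P}_\tau$; moreover this limit exists for all continuous $f,g:\mathbb{T}^N\to V_\tau$ and defines a positive semidefinite Hermitian form bounded by a constant times $\|f\|_\infty\|g\|_\infty$.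
   Context: Fix $N\ge2$ and a partition $\tau$ of $N$ that is neither $(N)$ nor $(1,\ldots,1)$; $\ell(\tau)$ is its number of nonzero parts, $h_\tau:=\tau_1+\ell(\tau)-1$. A reverse standard Young tableau (RSYT) of shape $\tau$ is a filling of the Ferrers diagram $\{(i,j):1\le i\le\ell(\tau),1\le j\le\tau_i\}$ with $1,\ldots,N$, each once, entries decreasing along each row and down each column; $\mathcal{Y}(\tau)$ is the set of them. For $T\in\mathcal{Y}(\tau)$ the entry $i$ sits in row $\mathrm{rw}(i,T)$, column $\mathrm{cm}(i,T)$, and its content is $c(i,T)=\mathrm{cm}(i,T)-\mathrm{rw}(i,T)$. $V_\tau$ is the vector space with basis $\mathcal{Y}(\tau)$, with Hermitian inner product $\langle T,T'\rangle_0=\delta_{T,T'}\prod_{1\le i<j\le N,\ c(i,T)\le c(j,T)-2}\big(1-(c(i,T)-c(j,T))^{-2}\big)$. The representation $\tau$ of the symmetric group $\mathcal{S}_N$ on $V_\tau$ is defined on simple transpositions $s_i=(i,i+1)$ by: if $i,i+1$ are in the same row of $T$, $\tau(s_i)T=T$; if in the same column, $\tau(s_i)T=-T$; otherwise, with $T^{(i)}$ the RSYT obtained by interchanging $i,i+1$ and $b=1/(c(i,T)-c(i+1,T))$, $\tau(s_i)T=T^{(i)}+bT$ if $\mathrm{rw}(i,T)<\mathrm{rw}(i+1,T)$ and $\tau(s_i)T=(1-b^2)T^{(i)}+bT$ if $\mathrm{rw}(i,T)>\mathrm{rw}(i+1,T)$. Each $\tau(w)$ is orthogonal for $\langle\cdot,\cdot\rangle_0$;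 write $\tau(i,j)$ for $\tau$ of the transposition $(i,j)$. $\kappa$ is a real parameter. $\mathcal{P}_\tau$ is the space of polynomials in $x=(x_1,\ldots,x_N)$ with coefficients in $V_\tau$; $\mathcal{S}_N$ acts by $(wp)(x)=\tau(w)p(xw)$ where $(xw)_i=x_{w(i)}$, and on multi-indices by $(w\alpha)_i=\alpha_{w^{-1}(i)}$. Dunkl operators: $\mathcal{D}_ip(x)=\partial_ip(x)+\kappa\sum_{j\ne i}\tau(i,j)\frac{p(x)-p(x(i,j))}{x_i-x_j}$; Cherednik–Dunkl operators: $\mathcal{U}_ip(x)=\mathcal{D}_i(x_ip(x))-\kappa\sum_{j<i}\tau(i,j)p(x(i,j))$. For $\alpha\in\mathbb{N}_0^N$, $\alpha^+$ is its nonincreasing rearrangement; $\alpha\prec\beta$ means $\sum_{j\le i}\alpha_j\le\sum_{j\le i}\beta_j$ for all $i$ and $\alpha\ne\beta$; $\alpha\vartriangleleft\beta$ means $|\alpha|=|\beta|$ and ($\alpha^+\prec\beta^+$, or $\alpha^+=\beta^+$ and $\alpha\prec\beta$). The rank function $r_\alpha(i)=\#\{j:\alpha_j>\alpha_i\}+\#\{j\le i:\alpha_j=\alpha_i\}$ is a permutation. The nonsymmetric Jack polynomial $\zeta_{\alpha,T}$ ($\alpha\in\mathbb{N}_0^N$, $T\in\mathcal{Y}(\tau)$) is the unique element of $\mathcal{P}_\tau$ of the form $x^\alpha\otimes\tau(r_\alpha^{-1})T+\sum_{\beta\vartriangleleft\alpha}x^\beta\otimes t_{\alpha\beta}$ with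 $\mathcal{U}_i\zeta_{\alpha,T}=\xi_{\alpha,T}(i)\zeta_{\alpha,T}$, $\xi_{\alpha,T}(i)=\alpha_i+1+\kappa c(r_\alpha(i),T)$, $1\le i\le N$. $\kappa$ is generic if $(\alpha,T)\ne(\beta,T')$ implies $\xi_{\alpha,T}\ne\xi_{\beta,T'}$; then $\{\zeta_{\alpha,T}\}$ is a basis of $\mathcal{P}_\tau$. For $\varepsilon=\pm1$, $\mathcal{E}_\varepsilon(\alpha,T)=\prod_{1\le i<j\le N,\ \alpha_i<\alpha_j}\big(1+\frac{\varepsilon\kappa}{\alpha_j-\alpha_i+\kappa(c(r_\alpha(j),T)-c(r_\alpha(i),T))}\big)$. The Hermitian form $\langle\cdot,\cdot\rangle_{\mathbb{T}}$ on $\mathcal{P}_\tau$ (conjugate-linear in the first argument) is defined by $\langle\zeta_{\alpha,T},\zeta_{\beta,T'}\rangle_{\mathbb{T}}=0$ if $(\alpha,T)\ne(\beta,T')$, $\langle\zeta_{\lambda,T},\zeta_{\lambda,T}\rangle_{\mathbb{T}}=\langle T,T\rangle_0\prod_{1\le i<j\le N}\prod_{\ell=1}^{\lambda_i-\lambda_j}\big(1-\big(\frac{\kappa}{\ell+\kappa(c(i,T)-c(j,T))}\big)^2\big)$ for partitions $\lambda$, and $\langle\zeta_{\alpha,T},\zeta_{\alpha,T}\rangle_{\mathbb{T}}=(\mathcal{E}_1(\alpha,T)\mathcal{E}_{-1}(\alpha,T))^{-1}\langle\zeta_{\alpha^+,T},\zeta_{\alpha^+,T}\rangle_{\mathbb{T}}$.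 For $-1/h_\tau<\kappa<1/h_\tau$ these objects are well defined. Coefficient matrices: $\boldsymbol{Z}_N=\{\gamma\in\mathbb{Z}^N:\sum_i\gamma_i=0\}$, $\boldsymbol{Z}_{N,n}=\{\gamma\in\boldsymbol{Z}_N:\sum_i|\gamma_i|=2n\}$. For $\gamma\in\boldsymbol{Z}_N$ let $\gamma^\pi_i=\max(\gamma_i,0)$, $\gamma^\nu_i=\max(-\gamma_i,0)$; $(A_\gamma)_{T,T'}=(\langle T,T\rangle_0\langle T',T'\rangle_0)^{-1/2}\langle x^{\gamma^\pi}\otimes T,x^{\gamma^\nu}\otimes T'\rangle_{\mathbb{T}}$ for $\gamma\in\boldsymbol{Z}_N$, $A_\gamma=0$ otherwise. Vectors in $V_\tau$ and matrices $\tau(w)$ are written in the orthonormal basis $\{\langle T,T\rangle_0^{-1/2}T\}$ (so $\tau(w)$ is real orthogonal), $f(x)^*$ is the conjugate transpose of the coordinate column. $\mathbb{T}^N=\{x\in\mathbb{C}^N:|x_j|=1\}$ with normalized Haar measure $\mathrm{d}m$; $(t)_m=\prod_{i=1}^m(t+i-1)$. *)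

(* Defs.v *)
From Stdlib Require Import Reals ClassicalEpsilon.
From Coquelicot Require Import Coquelicot.
From mathcomp Require Import all_boot all_algebra all_fingroup.
From mathcomp Require Import Rstruct complex mpoly.

Set Implicit Arguments.
Unset Strict Implicit.
Unset Printing Implicit Defensive.

Import GRing.Theory Num.Theory.
Local Open Scope ring_scope.

Notation Cx := (complex R).
Definition toC (x : R) : Cx := Complex x 0.
Definition cRe (z : Cx) : R := complex.Re z.
Definition cIm (z : Cx) : R := complex.Im z.
Definition cabs (z : Cx) : R := Num.sqrt (cRe z ^+ 2 + cIm z ^+ 2).
Definition expi (t : R) : Cx := Complex (cos t) (sin t).

Definition is_partition (N : nat) (tau : seq nat) : bool :=
  [&& sorted geq tau, all (fun k => 0 < k)%N tau & sumn tau == N].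
Definition h_tau (tau : seq nat) : nat := (head 0%N tau + size tau - 1)%N.

Section Defs.
Variables (N : nat) (tau : seq nat) (kappa : R).

(* cells (row, column), 0-indexed *)
Definition in_diagram (c : 'I_N * 'I_N) : bool :=
  (c.1 < size tau)%N && (c.2 < nth 0%N tau c.1)%N.

(* A tableau T is given by the cell T k of the entry k+1 (k : 'I_N).
   Reverse standard Young tableau: bijection of {1..N} onto the Ferrers
   diagram (injective into the diagram, which has N cells), entries
   decreasing along rows and down columns. *)
Definition is_rsyt (T : {ffun 'I_N -> 'I_N * 'I_N}) : bool :=
  [&& injectiveb T, [forall k, in_diagram (T k)],
      [forall a, forall b,
          (((T a).1 == (T b).1) && ((T a).2 < (T b).2)%N) ==> (b < a)%N] &
      [forall a, forall b,
          (((T a).2 == (T b).2) && ((T a).1 < (T b).1)%N) ==> (b < a)%N]].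

Definition rsyt : finType := {T : {ffun 'I_N -> 'I_N * 'I_N} | is_rsyt T}.

(* dim V_tau; coordinates of V_tau are indexed by 'I_dimV ~ rsyt *)
Definition dimV : nat := #|{: rsyt}|.
Definition tabi (i : 'I_dimV) : rsyt := enum_val i.

Definition cont (T : rsyt) (k : 'I_N) : int :=
  ((val T k).2%:Z - (val T k).1%:Z)%R.

Definition norm0 (T : rsyt) : R :=
  \prod_(a < N) \prod_(b < N | (a < b)%N && (cont T a <= cont T b - 2))
     (1 - ((cont T a - cont T b)%:~R) ^- 2).

Definition ev (T : rsyt) : 'cV[Cx]_dimV := \col_i ((tabi i == T)%:R).

(* matrix of tau(s_{k+1}), s_{k+1} = (k+1, k+2), in the basis Y(tau):
   entry (i,j) = coefficient of tabi i in tau(s_{k+1}) (tabi j) *)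
Definition gen (k : 'I_N) : 'M[Cx]_dimV :=
  let k' : 'I_N := insubd k k.+1 in
  \matrix_(i, j)
    let T := tabi j in let T' := tabi i in
    let Tk := [ffun a => val T (tperm k k' a)] in
    if (val T k).1 == (val T k').1 then (T' == T)%:R
    else if (val T k).2 == (val T k').2 then - (T' == T)%:R
    else let b : Cx := ((cont T k - cont T k')%:~R)^-1 in
      if ((val T k).1 < (val T k').1)%N
      then (val T' == Tk)%:R + b * (T' == T)%:R
      else (1 - b ^+ 2) * (val T' == Tk)%:R + b * (T' == T)%:R.

(* tau is the representation of S_N (standard composition of maps:
   tau(t o s) = tau(t) tau(s); note (s * t)%g = t o s in mathcomp)
   determined by its values on the simple transpositions. *)
Definition is_tau_hom (rho : {perm 'I_N} -> 'M[Cx]_dimV) : Prop :=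
  [/\ rho 1%g = 1%:M,
      (forall s t : {perm 'I_N}, rho (s * t)%g = rho t *m rho s) &
      (forall k : 'I_N, (k.+1 < N)%N -> rho (tperm k (insubd k k.+1)) = gen k)].

Definition tauM : {perm 'I_N} -> 'M[Cx]_dimV :=
  epsilon (inhabits (fun _ => 1%:M)) is_tau_hom.

(* tau(w) in the orthonormal basis {<T,T>_0^{-1/2} T} *)
Definition tauO (w : {perm 'I_N}) : 'M[Cx]_dimV :=
  \matrix_(i, j) (toC (Num.sqrt (norm0 (tabi i))) * tauM w i j
                  / toC (Num.sqrt (norm0 (tabi j)))).

(* polynomials with coefficients in V_tau (coordinates in basis Y(tau)) *)
Definition PV := 'cV[{mpoly Cx[N]}]_dimV.

Definition polyM (M : 'M[Cx]_dimV) : 'M[{mpoly Cx[N]}]_dimV :=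
  map_mx (fun c => c%:MP) M.

(* p |-> p(xw), (xw)_i = x_{w(i)} (without the tau(w) factor) *)
Definition pw (w : {perm 'I_N}) (p : PV) : PV :=
  map_mx (fun q => q \mPo [tuple ('X_(w i) : {mpoly Cx[N]}) | i < N]) p.

Definition ddiff (i j : 'I_N) (p : PV) : PV :=
  epsilon (inhabits 0)
    (fun q => map_mx (fun r => ('X_i - 'X_j) * r) q = p - pw (tperm i j) p).

Definition kC : Cx := toC kappa.

Definition dunkl (i : 'I_N) (p : PV) : PV :=
  map_mx (mderiv i) p +
  (kC%:MP) *: \sum_(j < N | j != i) (polyM (tauM (tperm i j)) *m ddiff i j p).

Definition cherU (i : 'I_N) (p : PV) : PV :=
  dunkl i (map_mx (fun r => 'X_i * r) p) -
  (kC%:MP) *: \sum_(j < N | (j < i)%N) (polyM (tauM (tperm i j)) *m pw (tperm i j) p).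

Definition mseq (a : 'X_{1..N}) : seq nat := [seq a i | i <- enum 'I_N].
Definition mplus (a : 'X_{1..N}) : seq nat := sort geq (mseq a).
Definition psum (s : seq nat) (k : nat) : nat := sumn (take k s).
Definition dom_lt (s t : seq nat) : bool :=
  [forall k : 'I_N, (psum s k.+1 <= psum t k.+1)%N] && (s != t).
Definition jack_lt (b a : 'X_{1..N}) : bool :=
  (mdeg b == mdeg a) &&
  (dom_lt (mplus b) (mplus a) || ((mplus b == mplus a) && dom_lt (mseq b) (mseq a))).

(* rank function r_a(i) (values 1..N) and the permutation it defines
   (0-indexed: (rperm a i).+1 = r_a(i)) *)
Definition rank (a : 'X_{1..N}) (i : 'I_N) : nat :=
  (#|[pred j : 'I_N | (a i < a j)%N]| +
   #|[pred j : 'I_N | (j <= i)%N && (a j == a i)]|)%N.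
Definition rperm (a : 'X_{1..N}) : {perm 'I_N} :=
  odflt 1%g [pick s : {perm 'I_N} | [forall i, (s i).+1 == rank a i]].

Definition xi (a : 'X_{1..N}) (T : rsyt) (i : 'I_N) : Cx :=
  (a i).+1%:R + kC * (cont T (rperm a i))%:~R.

Definition coefv (b : 'X_{1..N}) (p : PV) : 'cV[Cx]_dimV := map_mx (fun r => r@_b) p.

Definition is_zeta (a : 'X_{1..N}) (T : rsyt) (p : PV) : Prop :=
  [/\ coefv a p = tauM (rperm a)^-1 *m ev T,
      (forall b, coefv b p != 0 -> b = a \/ jack_lt b a) &
      (forall i, cherU i p = (xi a T i)%:MP *: p)].
Definition zeta (a : 'X_{1..N}) (T : rsyt) : PV :=
  epsilon (inhabits 0) (is_zeta a T).

Definition Eps (e : Cx) (a : 'X_{1..N}) (T : rsyt) : Cx :=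
  \prod_(i < N) \prod_(j < N | (i < j)%N && (a i < a j)%N)
    (1 + e * kC / ((a j)%:R - (a i)%:R
                   + kC * (cont T (rperm a j) - cont T (rperm a i))%:~R)).

(* <zeta_{lam,T}, zeta_{lam,T}>_T for a partition lam *)
Definition pnorm (lam : seq nat) (T : rsyt) : Cx :=
  toC (norm0 T) *
  \prod_(i < N) \prod_(j < N | (i < j)%N)
    \prod_(l < (nth 0%N lam i - nth 0%N lam j)%N)
      (1 - (kC / (l.+1%:R + kC * (cont T i - cont T j)%:~R)) ^+ 2).

Definition znorm (a : 'X_{1..N}) (T : rsyt) : Cx :=
  (Eps 1 a T * Eps (-1) a T)^-1 * pnorm (mplus a) T.

Definition pdeg (p : PV) : nat := \max_(i < dimV) msize (p i ord0).

Definition zcoord (D : nat) (p : PV) : 'X_{1..N < D} -> rsyt -> Cx :=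
  epsilon (inhabits (fun _ _ => 0))
    (fun c => p = \sum_(a : 'X_{1..N < D}) \sum_(T : rsyt) (c a T)%:MP *: zeta a T).

Definition formT (f g : PV) : Cx :=
  let D := maxn (pdeg f) (pdeg g) in
  \sum_(a : 'X_{1..N < D}) \sum_(T : rsyt)
     (@zcoord D f a T)^* * @zcoord D g a T * znorm a T.

Definition posm (g : 'I_N -> int) : 'X_{1..N} :=
  [multinom `|Num.max (g i) 0|%N | i < N].
Definition negm (g : 'I_N -> int) : 'X_{1..N} :=
  [multinom `|Num.max (- g i) 0|%N | i < N].

Definition monv (m : 'X_{1..N}) (T : rsyt) : PV :=
  ('X_[m] : {mpoly Cx[N]}) *: map_mx (fun c => c%:MP) (ev T).

Definition Amat (g : 'I_N -> int) : 'M[Cx]_dimV :=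
  \matrix_(i, j) ((toC (Num.sqrt (norm0 (tabi i) * norm0 (tabi j))))^-1 *
                  formT (monv (posm g) (tabi i)) (monv (negm g) (tabi j))).

(* Z_{N,m}: gamma with sum 0 and sum |gamma_i| = 2m; enumerated through
   gamma_i = k_i - 2m, 0 <= k_i <= 4m *)
Definition shiftg (m : nat) (k : {ffun 'I_N -> 'I_(4 * m).+1}) : 'I_N -> int :=
  fun i => (k i)%:Z - (2 * m)%:Z.
Definition inZNm (m : nat) (g : 'I_N -> int) : bool :=
  (\sum_(i < N) g i == 0) && ((\sum_(i < N) `|g i|%N)%N == (2 * m)%N).

Definition xmon (x : 'I_N -> Cx) (g : 'I_N -> int) : Cx := \prod_(i < N) x i ^ g i.

Definition Hm (m : nat) (x : 'I_N -> Cx) : 'M[Cx]_dimV :=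
  \sum_(k : {ffun 'I_N -> 'I_(4 * m).+1} | inZNm m (shiftg k))
     xmon x (shiftg k) *: Amat (shiftg k).

Definition poch (t : Cx) (m : nat) : Cx := \prod_(i < m) (t + i%:R).

Definition Kn (n : nat) (x : 'I_N -> Cx) : 'M[Cx]_dimV :=
  \sum_(m < n.+1) (poch (- n%:R) m / poch (1 - N%:R - n%:R) m) *: Hm m x.

Definition ctr (m p : nat) (M : 'M[Cx]_(m, p)) : 'M[Cx]_(p, m) :=
  (map_mx Num.conj M)^T.

Definition psd (M : 'M[Cx]_dimV) : Prop :=
  ctr M = M /\ forall v : 'cV[Cx]_dimV, 0 <= (ctr v *m M *m v) 0 0.

Definition onTorus (x : 'I_N -> Cx) : Prop := forall i, cabs (x i) = 1.

(* value of a polynomial in the orthonormal coordinates *)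
Definition evalO (p : PV) (x : 'I_N -> Cx) : 'cV[Cx]_dimV :=
  \col_i (toC (Num.sqrt (norm0 (tabi i))) * (p i 0).@[x]).

Definition omega : Cx := expi (2 * PI / N%:R)%R.
Definition x0 : 'I_N -> Cx := fun i => omega ^+ i.
Definition w0 : {perm 'I_N} :=
  odflt 1%g [pick s : {perm 'I_N} | [forall i : 'I_N, val (s i) == (i.+1 %% N)%N]].

Fixpoint iter_int (k : nat) (G : (nat -> R) -> R) : R :=
  match k with
  | 0%N => G (fun _ => 0)
  | k'.+1 => (RInt (fun t => iter_int k' (fun th => G (fun j => if j == k' then t else th j)))
                  0 (2 * PI) / (2 * PI))%R
  end.

(* integral over T^N w.r.t. normalized Haar measure (of a continuous F),
   via x_j = e^{i theta_j} *)
Definition torus_int (F : ('I_N -> Cx) -> Cx) : Cx :=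
  Complex (iter_int N (fun th => cRe (F (fun i => expi (th (val i))))))
          (iter_int N (fun th => cIm (F (fun i => expi (th (val i)))))).

Definition cvgC (u : nat -> Cx) (l : Cx) : Prop :=
  is_lim_seq (fun n => cRe (u n)) (cRe l) /\ is_lim_seq (fun n => cIm (u n)) (cIm l).

Definition contT (f : ('I_N -> Cx) -> 'cV[Cx]_dimV) : Prop :=
  forall x, onTorus x -> forall e : R, 0 < e ->
    exists2 del : R, 0 < del &
      forall y, onTorus y -> (forall i, cabs (y i - x i) < del) ->
        forall k, cabs (f y k 0 - f x k 0) < e.

(* Euclidean norm on V_tau in orthonormal coordinates *)
Definition vnorm (v : 'cV[Cx]_dimV) : R := Num.sqrt (\sum_i cabs (v i 0) ^+ 2).

Definition Kint (n : nat) (f g : ('I_N -> Cx) -> 'cV[Cx]_dimV) : Cx :=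
  torus_int (fun x => (ctr (f x) *m Kn n x *m g x) 0 0).

End Defs.

(* Main.v *)
(* The form <.,.>_T is invariant under S_N and under multiplication by every
   x_i.  Indeed zeta_{a,T} is built from zeta_{0,T} = T by simple transpositions
   and by the affine step p(x) |-> x_N p(xw), and the norms are exactly those for
   which the affine step is isometric and the s_i are self-adjoint; the bound on
   kappa makes the spectra separate the indices (a, T) and the norms positive.

   Consequently A_{a-b} is the Gram matrix of x^a (x) V and x^b (x) V for all
   exponents a, b of equal degree.  Each g in Z_{N,m} equals a - b for exactly
   C(n-m+N-1, n-m) pairs of exponents of degree n, and dividing by C(n+N-1, n)
   gives the coefficient (-n)_m / (1-N-n)_m.  Hence v* K_n(x) v is, up to the
   factor 1 / C(n+N-1, n), the square norm of the polynomial
   sum_{|a| = n} x^{-a} y^a (x) v in the variable y: this gives positivity and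
   equivariance, and (3) follows from (2) because K_n is homogeneous of degree 0
   and x_0 w_0 = omega x_0.

   For (4), positivity bounds the entries of K_n by its trace, whose integral is
   the constant tr A_0; the entries are thus bounded functionals, converging on
   monomials because the coefficients tend to 1, hence on all continuous
   functions by density of Laurent polynomials. *)

Require Import Defs.
From Stdlib Require Import Reals ClassicalEpsilon FunctionalExtensionality.
From Coquelicot Require Import Coquelicot.
From mathcomp Require Import all_boot all_order all_algebra all_fingroup.
From mathcomp Require Import Rstruct complex mpoly.
From mathcomp Require Import zify ring lra.
Import Order.TTheory GRing.Theory Num.Theory.
Local Open Scope ring_scope.
Set Implicit Arguments.
Unset Strict Implicit.
Unset Printing Implicit Defensive.

(** * The Coxeter presentation of the symmetric group *)

(** The objects [tauM], [ddiff], [zeta] and [zcoord] are selected by [epsilon], so nothing is known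
    of them until existence is proved, and for the polynomials and coordinates uniqueness is needed
    as well. Hence the representation is constructed from the Coxeter relations, and the polynomials
    are rebuilt as [jack] and only then identified with [zeta]. Two obstacles shape the middle. The
    parameter is not assumed generic: the bound on kappa only says that equal spectral values have
    equal integer parts. A spectrum therefore determines the exponent, and the tableau is read off
    from the coefficient of x^a. Moreover the order [jack_lt] is not stable under the affine step,
    so triangularity is carried by a finer relation [below], generated by elementary moves of the
    exponent. The norm, defined through sorted exponents and the factors [Eps], is replaced by a
    single product over all ordered pairs of positions ([nz]), in which the effect of each step is
    visible pair by pair. *)

Definition succo (N : nat) (k : 'I_N) : 'I_N := insubd k k.+1.
(** Written with the same [insubd] default as [gen] and [is_tau_hom], so that it is literally the
    simple transposition used there. At the last index [succo k] is [k], whence the hypothesis k+1 <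
    N throughout. *)
Definition adjt (N : nat) (k : 'I_N) : {perm 'I_N} := tperm k (succo k).

Section CoxeterPresentation.
Variables (N : nat).

Lemma val_succo (k : 'I_N) : (k.+1 < N)%N -> val (succo k) = k.+1.
Proof. by move=> lt; rewrite /succo val_insubd lt. Qed.

Lemma succo_inj (k : 'I_N) : (k.+1 < N)%N -> k != succo k.
Proof. by move=> lt; rewrite -val_eqE val_succo //= neq_ltn ltnSn. Qed.

Lemma adjtK (k : 'I_N) : (adjt k * adjt k)%g = 1%g.
Proof. by rewrite /adjt tperm2. Qed.

Lemma adjtE (k i : 'I_N) : (k.+1 < N)%N ->
  adjt k i = (if i == k :> nat then k.+1 else if i == k.+1 :> nat then k : nat else i) :> nat.
Proof.
move=> lt; rewrite /adjt permE /=.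
rewrite -[i == k]val_eqE -[i == succo k]val_eqE val_succo //=.
by case: eqP => // _; [exact: val_succo | case: eqP].
Qed.

Lemma adjtL (k : 'I_N) : adjt k k = succo k. Proof. by rewrite /adjt tpermL. Qed.
Lemma adjtR (k : 'I_N) : adjt k (succo k) = k. Proof. by rewrite /adjt tpermR. Qed.

Lemma adjt_comm (k l : 'I_N) : (k.+1 < N)%N -> (l.+1 < N)%N -> (k.+1 < l)%N ->
  (adjt k * adjt l)%g = (adjt l * adjt k)%g.
Proof.
move=> hk hl kl; apply/permP=> i; apply: val_inj => /=.
rewrite !permM !adjtE //.
by repeat case: eqP => //; lia.
Qed.

Lemma adjt_braid (k : 'I_N) : (k.+2 < N)%N ->
  (adjt k * (adjt (succo k) * adjt k))%g = (adjt (succo k) * (adjt k * adjt (succo k)))%g.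
Proof.
move=> hk; have hk1 : (k.+1 < N)%N by lia.
apply/permP=> i; apply: val_inj => /=.
rewrite !permM !adjtE //=; do ?rewrite [nat_of_ord (succo k)]val_succo //=.
by repeat case: eqP => //; lia.
Qed.

Definition descent (w : {perm 'I_N}) (k : 'I_N) : bool :=
  (k.+1 < N)%N && (w (succo k) < w k)%N.

(* Sorting a descent decreases this quantity, so it plays the role of the length. *)
Definition pmeas (w : {perm 'I_N}) : nat := \sum_(a < N) a * (N - w a).

Lemma pmeas_descent (w : {perm 'I_N}) (k : 'I_N) :
  descent w k -> (pmeas (adjt k * w)%g < pmeas w)%N.
Proof.
case/andP=> hk hd; rewrite /pmeas.
have ne := succo_inj hk.
rewrite [X in (_ < X)%N](bigD1 k) //= [X in (_ < _ + X)%N](bigD1 (succo k)) ?(eq_sym _ k) //=.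
rewrite [X in (X < _)%N](bigD1 k) //= [X in (_ + X < _)%N](bigD1 (succo k)) ?(eq_sym _ k) //=.
rewrite !permM adjtL adjtR !addnA.
have -> : (\sum_(i < N | (i != k) && (i != succo k)) i * (N - (adjt k * w)%g i) =
  \sum_(i < N | (i != k) && (i != succo k)) i * (N - w i))%N.
  apply: eq_bigr => i /andP[i1 i2]; rewrite permM /adjt tpermD 1?eq_sym //.
rewrite ltn_add2r val_succo //.
have := ltn_ord (w k); have := ltn_ord (w (succo k)).
move: hd; set x := nat_of_ord (w k); set y := nat_of_ord (w _) => hd h1 h2.
rewrite !mulSn; nia.
Qed.

(** Without descents the values increase strictly, so i <= w i for every i; both sides have the same
    sum over i, which forces equality. *)
Lemma nodescent_eq1 (w : {perm 'I_N}) : (forall k, ~~ descent w k) -> w = 1%g.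
Proof.
move=> nd.
have mono (i : 'I_N) : (i <= w i)%N.
  case: i => m; elim: m => [|m IH] hm; first by [].
  have hm' : (m < N)%N by lia.
  have := nd (Ordinal hm'); rewrite /descent /= hm /= -leqNgt.
  have -> : succo (Ordinal hm') = Ordinal hm by apply: val_inj; rewrite val_succo.
  rewrite leq_eqVlt => /orP[/eqP/val_inj/perm_inj/(congr1 val)/=|]; first lia.
  by have /= := IH hm' => h1 h2; lia.
have sumeq : (\sum_(i < N) w i = \sum_(i < N) i)%N.
  by rewrite [RHS](reindex_inj (@perm_inj _ w)).
apply/permP=> i; rewrite perm1; apply: val_inj.
have := leqif_sum (fun (i : 'I_N) (_ : true) => leqif_eq (mono i)).
rewrite sumeq => -[_]; rewrite eqxx => /esym/forallP/(_ i) /=.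
by move/eqP.
Qed.

Variables (K : pzRingType) (d : nat) (g : 'I_N -> 'M[K]_d).
Hypothesis gg : forall k : 'I_N, (k.+1 < N)%N -> g k *m g k = 1%:M.
Hypothesis gcomm : forall k l : 'I_N, (k.+1 < N)%N -> (l.+1 < N)%N ->
  (k.+1 < l)%N -> g k *m g l = g l *m g k.
Hypothesis gbraid : forall k : 'I_N, (k.+2 < N)%N ->
  g k *m g (succo k) *m g k = g (succo k) *m g k *m g (succo k).

(** Product of the generators along one reduced word, obtained by removing an arbitrarily picked
    descent at each step. The first argument is fuel. *)
Fixpoint crec (n : nat) (w : {perm 'I_N}) : 'M[K]_d :=
  if n is m.+1 then
    if [pick k | descent w k] is Some k then crec m (adjt k * w)%g *m g k else 1%:M
  else 1%:M.

Lemma crec_fuel n m w : (pmeas w < n)%N -> (pmeas w < m)%N -> crec n w = crec m w.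
Proof.
elim: n m w => // n IH [//|m] w hn hm /=.
case: pickP => // k /pmeas_descent hd.
by congr (_ *m _); apply: IH; lia.
Qed.

Definition crho (w : {perm 'I_N}) := crec (pmeas w).+1 w.

Lemma crho_pick w : crho w =
  if [pick k | descent w k] is Some k then crho (adjt k * w)%g *m g k else 1%:M.
Proof.
rewrite /crho [LHS]/=; case: pickP => // k /pmeas_descent hd.
by congr (_ *m _); apply: crec_fuel; lia.
Qed.

Lemma descentE (w : {perm 'I_N}) (k l : 'I_N) : (k.+1 < N)%N -> (l.+1 < N)%N ->
  descent (adjt k * w)%g l = (w (adjt k (succo l)) < w (adjt k l))%N.
Proof. by move=> hk hl; rewrite /descent hl !permM. Qed.

(* Matsumoto's argument: two descents either commute or generate a braid. *)
Lemma crho_descent w (k : 'I_N) : descent w k -> crho w = crho (adjt k * w)%g *m g k.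
Proof.
move: {2}(pmeas w).+1 (ltnSn (pmeas w)) => n; elim: n w k => // n IH w k hn dk.
rewrite crho_pick; case: pickP => [l dl|/(_ k)]; last by rewrite dk.
have hk : (k.+1 < N)%N by case/andP: dk.
have hl : (l.+1 < N)%N by case/andP: dl.
have [->//|nkl] := eqVneq k l.
(* Each side is reduced once more by the other transposition; both reductions reach the same
   permutation. *)
have far (a b : 'I_N) : (a.+1 < b)%N -> descent w a -> descent w b ->
   crho (adjt a * w)%g *m g a = crho (adjt b * w)%g *m g b.
  move=> ab da db; have ha : (a.+1 < N)%N by case/andP: da.
  have hb : (b.+1 < N)%N by case/andP: db.
  rewrite (IH (adjt a * w)%g b); first last.
  - rewrite descentE // /adjt !tpermD -?val_eqE /= ?val_succo //=; try lia.
    by case/andP: db.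
  - by have := pmeas_descent da; lia.
  rewrite (IH (adjt b * w)%g a); first last.
  - rewrite descentE // /adjt !tpermD -?val_eqE /= ?val_succo //=; try lia.
    by case/andP: da.
  - by have := pmeas_descent db; lia.
  by rewrite -!mulmxA !mulgA (gcomm ha hb ab) (adjt_comm ha hb ab).
(* Here [w] decreases on three consecutive positions. Three removals from either side reach the same
   permutation, and [gbraid] compares the two words. *)
have near (a b : 'I_N) : b = succo a -> (b.+1 < N)%N -> descent w a -> descent w b ->
   crho (adjt a * w)%g *m g a = crho (adjt b * w)%g *m g b.
  move=> eb hb da db; have ha : (a.+1 < N)%N by case/andP: da.
  have vb : val b = a.+1 by rewrite eb val_succo.
  have vsb : val (succo b) = a.+2 by rewrite val_succo // vb.
  have e1 : adjt a b = a by rewrite eb adjtR.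
  have e2 : adjt a (succo b) = succo b.
    by rewrite /adjt tpermD // -val_eqE vsb /= ?val_succo //=; lia.
  have e3 : adjt b a = a.
    by rewrite /adjt tpermD // -val_eqE ?vsb /= ?vb; lia.
  have e4 : adjt b b = succo b by rewrite adjtL.
  have e5 : adjt a a = b by rewrite adjtL eb.
  have [_ da'] := andP da; have [_ db'] := andP db; rewrite -eb in da'.
  have d1 : descent (adjt a * w)%g b.
    by rewrite descentE // e1 e2; lia.
  have d2 : descent (adjt b * w)%g a.
    by rewrite descentE // -eb e3 e4; lia.
  have d3 : descent (adjt b * (adjt a * w))%g a.
    by rewrite descentE // -eb e3 e4 !permM e2 e5.
  have d4 : descent (adjt a * (adjt b * w))%g b.
    by rewrite descentE // e1 e2 !permM e3 adjtR.
  have m1 := pmeas_descent da; have m2 := pmeas_descent db.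
  have m3 := pmeas_descent d1; have m4 := pmeas_descent d2.
  rewrite (IH _ b _ d1); last exact: leq_trans m1 hn.
  rewrite (IH _ a _ d3); last exact: ltn_trans m3 (leq_trans m1 hn).
  rewrite (IH _ a _ d2); last exact: leq_trans m2 hn.
  rewrite (IH _ b _ d4); last exact: ltn_trans m4 (leq_trans m2 hn).
  rewrite -!mulmxA; congr (_ *m _).
    congr crho; rewrite !mulgA; congr (_ * _)%g.
    by rewrite -!mulgA eb adjt_braid // -?vb.
  by rewrite !mulmxA eb gbraid // -vb.
have : [|| (k.+1 < l)%N, (l.+1 < k)%N, val l == k.+1 | val k == l.+1].
  by move: nkl; rewrite -val_eqE /=; lia.
case/or4P=> [h|h|/eqP h|/eqP h].
- by rewrite (far k l).
- by rewrite (far l k).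
- by rewrite (near k l) //; apply: val_inj; rewrite val_succo.
- by rewrite (near l k) //; apply: val_inj; rewrite val_succo.
Qed.

(** Either [k] is a descent of [w] or it is one of [adjt k * w]. [crho_descent] applies to whichever
    has it, and [gg] concludes in the first case. *)
Lemma crho_adjt w (k : 'I_N) : (k.+1 < N)%N -> crho (adjt k * w)%g = crho w *m g k.
Proof.
move=> hk; case dk: (descent w k).
  by rewrite [in RHS](crho_descent dk) -mulmxA gg // mulmx1.
have : descent (adjt k * w)%g k.
  rewrite descentE // adjtL adjtR; move/negbT: dk.
  rewrite /descent hk /= -leqNgt leq_eqVlt => /orP[|//].
  by move=> /eqP/val_inj/perm_inj/eqP; rewrite (negPf (succo_inj hk)).
by move/crho_descent->; rewrite mulgA adjtK mul1g.
Qed.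

Lemma crho1 : crho 1%g = 1%:M.
Proof.
rewrite crho_pick; case: pickP => // k.
by rewrite /descent !perm1 => /andP[h]; rewrite val_succo //; lia.
Qed.

End CoxeterPresentation.

Lemma perm_adjt_ind (N : nat) (P : {perm 'I_N} -> Prop) :
  P 1%g -> (forall (w : {perm 'I_N}) (k : 'I_N), (k.+1 < N)%N -> P w -> P (adjt k * w)%g) ->
  forall w, P w.
Proof.
move=> P1 PM w; move: {2}(pmeas w).+1 (ltnSn (pmeas w)) => n.
elim: n w => // n IH w hn.
case: (pickP (descent w)) => [k dk|nd]; last first.
  by rewrite (@nodescent_eq1 _ w) // => k; rewrite nd.
have hk : (k.+1 < N)%N by case/andP: dk.
rewrite -[w]mul1g -(adjtK k) -mulgA; apply: (PM) => //; apply: IH.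
exact: leq_trans (pmeas_descent dk) hn.
Qed.

(** The source of the existence required by the [epsilon] in [tauM]. The factors are reversed
    because the product of permutations composes from left to right. *)
Lemma coxeter_extension (N d : nat) (K : pzRingType) (g : 'I_N -> 'M[K]_d) :
  (forall k : 'I_N, (k.+1 < N)%N -> g k *m g k = 1%:M) ->
  (forall k l : 'I_N, (k.+1 < N)%N -> (l.+1 < N)%N ->
     (k.+1 < l)%N -> g k *m g l = g l *m g k) ->
  (forall k : 'I_N, (k.+2 < N)%N ->
     g k *m g (succo k) *m g k = g (succo k) *m g k *m g (succo k)) ->
  exists rho : {perm 'I_N} -> 'M[K]_d,
    [/\ rho 1%g = 1%:M, (forall s t, rho (s * t)%g = rho t *m rho s)
      & (forall k : 'I_N, (k.+1 < N)%N -> rho (adjt k) = g k)].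
Proof.
move=> gg gc gb; exists (crho g); have c1 := crho1 g.
have cM := crho_adjt gg gc gb.
split=> // [s t|k hk]; last by rewrite -[adjt k]mulg1 cM // c1 mul1mx.
elim/perm_adjt_ind: s => [|w k hk IH]; first by rewrite mul1g c1 mulmx1.
by rewrite -mulgA (cM (w * t)%g _ hk) IH (cM w _ hk) mulmxA.
Qed.


(** * Reverse standard tableaux and the seminormal representation *)

(* Off-diagonal coefficient of tau(s_k) for content difference d; it vanishes
   exactly for d = 1, -1, when the swapped filling is not a tableau. *)
Definition phic (d : int) : Cx := if 2 <= d then 1 else 1 - (d%:~R) ^- 2.
Definition bcoef (d : int) : Cx := (d%:~R)^-1.

Lemma intC_neq0 (d : int) : d != 0 -> (d%:~R : Cx) != 0.
Proof. by rewrite intr_eq0. Qed.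

(** The relation that makes each block of tau(s_k) an involution. If |d| >= 2 one of the factors is
    1; if |d| = 1 both sides vanish. *)
Lemma phicN d : d != 0 -> phic d * phic (- d) = 1 - bcoef d ^+ 2.
Proof.
move=> d0; rewrite /phic /bcoef rmorphN /= sqrrN exprVn.
case: ifP => h1; case: ifP => h2; try lia; rewrite ?mul1r ?mulr1 //.
have : (d == 1) || (d == -1) by lia.
by case/orP=> /eqP ->; rewrite ?rmorphN /= ?sqrrN expr1n invr1 subrr mul0r.
Qed.

Lemma phic1 : phic 1 = 0. Proof. by rewrite /phic /= expr1n invr1 subrr. Qed.
Lemma phicN1 : phic (-1) = 0.
Proof. by rewrite /phic /= rmorphN sqrrN expr1n invr1 subrr. Qed.

Section Tableaux.
Variables (N : nat) (tau : seq nat).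
Hypothesis htau : is_partition N tau.
Implicit Types (T : rsyt N tau) (S : {ffun 'I_N -> 'I_N * 'I_N}).

Definition fil T : {ffun 'I_N -> 'I_N * 'I_N} := val T.

Lemma filSub S (h : is_rsyt tau S) : fil (Sub S h) = S.
Proof. exact: SubK. Qed.

Lemma fil_inj : injective fil.
Proof. exact: val_inj. Qed.

Definition trow S (k : 'I_N) : nat := (S k).1.
Definition tcol S (k : 'I_N) : nat := (S k).2.

Lemma tab_inj T : injective (fil T).
Proof. by have /and4P[/injectiveP] := valP T. Qed.

Lemma tab_diag T k : in_diagram tau (fil T k).
Proof. by have /and4P[_ /forallP h _ _] := valP T; exact: h. Qed.

Lemma tab_row T a b : trow (fil T) a = trow (fil T) b ->
  (tcol (fil T) a < tcol (fil T) b)%N -> (b < a)%N.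
Proof.
have /and4P[_ _ /forallP/(_ a)/forallP/(_ b)/implyP h _] := valP T.
by move=> e l; apply: h; rewrite -val_eqE /= [X in X == _]e eqxx.
Qed.

Lemma tab_col T a b : tcol (fil T) a = tcol (fil T) b ->
  (trow (fil T) a < trow (fil T) b)%N -> (b < a)%N.
Proof.
have /and4P[_ _ _ /forallP/(_ a)/forallP/(_ b)/implyP h] := valP T.
by move=> e l; apply: h; rewrite -val_eqE /= [X in X == _]e eqxx.
Qed.

Lemma part_geq i j : (i <= j)%N -> (nth 0%N tau j <= nth 0%N tau i)%N.
Proof.
case/and3P: htau => hs _ _ le.
have [hj|hj] := ltnP j (size tau); last by rewrite [X in (X <= _)%N]nth_default.
have geqT : transitive geq by move=> x y z /= h1 h2; exact: leq_trans h2 h1.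
apply: (sorted_leq_nth geqT (leqnn) 0%N hs) => //; rewrite inE //.
exact: leq_ltn_trans le hj.
Qed.

Lemma part_size : (size tau <= N)%N.
Proof.
case/and3P: htau => _ ha /eqP <-.
elim: tau ha => //= x s IH /andP[hx /IH]; lia.
Qed.

Lemma part_nth i : (nth 0%N tau i <= N)%N.
Proof.
case/and3P: htau => _ _ /eqP <-.
by elim: tau i => [|x s IH] [|i] //=; [lia | have := IH i; lia].
Qed.

Lemma card_diagram : #|[pred c : 'I_N * 'I_N | in_diagram tau c]| = N.
Proof.
rewrite -sum1_card.
transitivity (\sum_(r < N) \sum_(c < N | (r < size tau)%N && (c < nth 0%N tau r)%N) 1)%N.
  by rewrite pair_big_dep /=; apply: eq_bigl => -[a b]; rewrite inE.
transitivity (\sum_(r < N) nth 0%N tau r)%N.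
  apply: eq_bigr => r _.
  have [hr|hr] := ltnP r (size tau); last by rewrite nth_default // big_pred0.
  by rewrite /= -(big_ord_widen N (fun _ => 1%N)) ?part_nth // sum1_card card_ord.
rewrite -(big_mkord predT (fun r => nth 0%N tau r)) (big_cat_nat _ (n := size tau)) ?part_size //=.
rewrite [X in (_ + X)%N]big1_seq ?addn0; last first.
  by move=> i /=; rewrite mem_index_iota => /andP[h _]; rewrite nth_default.
have : sumn tau = N by case/and3P: htau => _ _ /eqP.
by rewrite sumnE (big_nth 0%N).
Qed.

(** A tableau is only required to be injective into the diagram; surjectivity comes from counting
    the cells. *)
Lemma tab_surj T (c : 'I_N * 'I_N) : in_diagram tau c -> exists k, fil T k = c.
Proof.
move=> hc.
have sub : {subset codom (fil T) <= [pred c | in_diagram tau c]}.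
  by move=> x /codomP[k ->]; rewrite inE tab_diag.
have : [pred c | in_diagram tau c] =i codom (fil T).
  move=> x; apply/esym; move: x; apply/subset_cardP; last exact/subsetP.
  by rewrite card_codom ?card_ord ?card_diagram //; exact: tab_inj.
by move/(_ c); rewrite inE hc => /esym/codomP[k ->]; exists k.
Qed.

Lemma tab_cell T r c (k : 'I_N) : (r <= trow (fil T) k)%N -> (c <= tcol (fil T) k)%N ->
  exists m, trow (fil T) m = r /\ tcol (fil T) m = c.
Proof.
move=> hr hc; have /andP[d1 d2] := tab_diag T k.
have rN : (r < N)%N by apply: leq_ltn_trans hr _; exact: ltn_ord.
have cN : (c < N)%N by apply: leq_ltn_trans hc _; exact: ltn_ord.
have [|m hm] := @tab_surj T (Ordinal rN, Ordinal cN).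
  apply/andP; split; first exact: leq_ltn_trans hr d1.
  apply: leq_ltn_trans hc (leq_trans d2 _); exact: part_geq.
by exists m; rewrite /trow /tcol hm.
Qed.

Lemma tab_rc T a b : trow (fil T) a = trow (fil T) b -> tcol (fil T) a = tcol (fil T) b -> a = b.
Proof.
move=> h1 h2; apply: (@tab_inj T).
move: h1 h2; rewrite /trow /tcol; case: (fil T a) (fil T b) => [a1 a2] [b1 b2] /=.
by move=> /val_inj-> /val_inj->.
Qed.

(** The cell in the row of [a] and the column of [b] belongs to the diagram: go along the row from
    [a] to it, then down the column to [b]. *)
Lemma tab_se T a b : (trow (fil T) a <= trow (fil T) b)%N ->
  (tcol (fil T) a <= tcol (fil T) b)%N -> (b <= a)%N.
Proof.
move=> hr hc.
have [m [mr mc]] := tab_cell hr (leqnn (tcol (fil T) b)).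
have hma : (m <= a)%N.
  move: hc; rewrite leq_eqVlt => /orP[/eqP e|l].
    by rewrite (@tab_rc T a m) // e mc.
  by apply: ltnW; apply: (@tab_row T a m) => //; rewrite mc.
have hbm : (b <= m)%N.
  move: hr; rewrite leq_eqVlt => /orP[/eqP e|l].
    by rewrite (@tab_rc T m b) // mr e.
  by apply: ltnW; apply: (@tab_col T m b) => //; rewrite mr.
exact: leq_trans hbm hma.
Qed.

(** The two other corners of the rectangle spanned by [a] and [b] carry distinct entries strictly
    between them, hence a gap of at least 3. *)
Lemma tab_se_strict T a b : (trow (fil T) a < trow (fil T) b)%N ->
  (tcol (fil T) a < tcol (fil T) b)%N -> (b.+2 < a)%N.
Proof.
move=> hr hc.
have [m [mr mc]] := tab_cell (ltnW hr) (leqnn (tcol (fil T) b)).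
have [p [pr pc]] := tab_cell (leqnn (trow (fil T) b)) (ltnW hc).
have h1 : (m < a)%N by apply: (@tab_row T a m); rewrite ?mr ?mc.
have h2 : (b < m)%N by apply: (@tab_col T m b); rewrite ?mr ?mc.
have h3 : (p < a)%N by apply: (@tab_col T a p); rewrite ?pr ?pc.
have h4 : (b < p)%N by apply: (@tab_row T p b); rewrite ?pr ?pc.
have : val m != val p.
  by apply/eqP=> /val_inj e; move: hr; rewrite -mr e pr ltnn.
by rewrite /=; lia.
Qed.

Definition fcont S (k : 'I_N) : int := (tcol S k)%:Z - (trow S k)%:Z.
Definition dcont S (k : 'I_N) : int := fcont S k - fcont S (succo k).

Variant dcont_spec T (k : 'I_N) : int -> Prop :=
 | DcRow of trow (fil T) k = trow (fil T) (succo k) : dcont_spec T k 1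
 | DcCol of tcol (fil T) k = tcol (fil T) (succo k)
     & trow (fil T) k <> trow (fil T) (succo k) : dcont_spec T k (-1)
 | DcPos d of (2 <= d)%R & (trow (fil T) k < trow (fil T) (succo k))%N
     & (tcol (fil T) (succo k) < tcol (fil T) k)%N : dcont_spec T k d
 | DcNeg d of (2 <= - d)%R & (trow (fil T) (succo k) < trow (fil T) k)%N
     & (tcol (fil T) k < tcol (fil T) (succo k))%N : dcont_spec T k d.

(** No entry fits between consecutive ones. This excludes the south-east position and makes the two
    cells adjacent when they share a row or a column. Otherwise rows and columns differ in opposite
    directions, so the content difference is at least 2 in absolute value. *)
Lemma dcontP T (k : 'I_N) : (k.+1 < N)%N -> dcont_spec T k (dcont (fil T) k).
Proof.
move=> hk; have vs := val_succo hk; move: vs => /= vs.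
case: (ltngtP (trow (fil T) k) (trow (fil T) (succo k))) => hr.
- case: (leqP (tcol (fil T) k) (tcol (fil T) (succo k))) => hc.
    by have := tab_se (ltnW hr) hc; rewrite vs ltnn.
  by apply: DcPos => //; rewrite /dcont /fcont; lia.
- case: (ltngtP (tcol (fil T) k) (tcol (fil T) (succo k))) => hc.
  + by apply: DcNeg => //; rewrite /dcont /fcont; lia.
  + by have := tab_se_strict hr hc; rewrite vs; lia.
  + have hm : (trow (fil T) (succo k)).+1 = trow (fil T) k.
      apply/eqP; rewrite eqn_leq hr /= leqNgt; apply/negP => h.
      have [m [mr mc]] := tab_cell (ltnW h) (leqnn (tcol (fil T) k)).
      have := @tab_col T (succo k) m; rewrite mr mc => /(_ (esym hc) (ltnSn _)).
      have := @tab_col T m k; rewrite mr mc => /(_ erefl h).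
      by rewrite vs; lia.
    have -> : dcont (fil T) k = -1 by rewrite /dcont /fcont; lia.
    by apply: DcCol => //; lia.
- have hc : (tcol (fil T) (succo k) < tcol (fil T) k)%N.
    rewrite ltnNge; apply/negP => h.
    by have := tab_se (eq_leq hr) h; rewrite vs ltnn.
  have hm : (tcol (fil T) (succo k)).+1 = tcol (fil T) k.
    apply/eqP; rewrite eqn_leq hc /= leqNgt; apply/negP => h.
    have [m [mr mc]] := tab_cell (leqnn (trow (fil T) k)) (ltnW h).
    have := @tab_row T (succo k) m; rewrite mr mc => /(_ (esym hr) (ltnSn _)).
    have := @tab_row T m k; rewrite mr mc => /(_ erefl h).
    by rewrite vs; lia.
  have -> : dcont (fil T) k = 1 by rewrite /dcont /fcont; lia.
  exact: DcRow.
Qed.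

Definition fswap (k : 'I_N) S : {ffun 'I_N -> 'I_N * 'I_N} := [ffun a => S (adjt k a)].

Lemma fswapK k S : fswap k (fswap k S) = S.
Proof. by apply/ffunP=> a; rewrite !ffunE -permM adjtK perm1. Qed.

Lemma fcont_swap k S a : fcont (fswap k S) a = fcont S (adjt k a).
Proof. by rewrite /fcont /tcol /trow ffunE. Qed.

Lemma dcont_swap k S : dcont (fswap k S) k = - dcont S k.
Proof. by rewrite /dcont !fcont_swap adjtL adjtR [RHS]opprB. Qed.

Lemma adjt_mono (k a b : 'I_N) : (k.+1 < N)%N -> (adjt k a < adjt k b)%N ->
  (a < b)%N \/ (adjt k a = k /\ adjt k b = succo k).
Proof.
move=> hk; have vs := val_succo hk; move: (vs) => /= vs'; rewrite !adjtE // => h.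
have [|] := ltnP a b; [by left | move=> hba; right].
have : (a == k.+1 :> nat) && (b == k :> nat).
  by move: h; do ?[case: ifP => /eqP]; lia.
case/andP=> /eqP ha /eqP hb.
have -> : a = succo k by apply: val_inj; rewrite vs.
have -> : b = k by apply: val_inj.
by rewrite adjtL adjtR.
Qed.

Lemma fswap_rsyt T (k : 'I_N) : (k.+1 < N)%N ->
  trow (fil T) k <> trow (fil T) (succo k) -> tcol (fil T) k <> tcol (fil T) (succo k) ->
  is_rsyt tau (fswap k (fil T)).
Proof.
move=> hk nr nc; apply/and4P; split.
- by apply/injectiveP => a b; rewrite !ffunE => /tab_inj/perm_inj.
- by apply/forallP=> a; rewrite ffunE tab_diag.
- apply/forallP=> a; apply/forallP=> b; apply/implyP; rewrite !ffunE => /andP[/eqP e l].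
  have h := @tab_row T _ _ (congr1 val e) l.
  have [//|[e1 e2]] := adjt_mono hk h.
  by move: e; rewrite e1 e2 => e; case: nr; rewrite /trow e.
- apply/forallP=> a; apply/forallP=> b; apply/implyP; rewrite !ffunE => /andP[/eqP e l].
  have h := @tab_col T _ _ (congr1 val e) l.
  have [//|[e1 e2]] := adjt_mono hk h.
  by move: e; rewrite e1 e2 => e; case: nc; rewrite /tcol e.
Qed.

Lemma fswap_nrsyt T (k : 'I_N) : (k.+1 < N)%N ->
  is_rsyt tau (fswap k (fil T)) ->
  trow (fil T) k <> trow (fil T) (succo k) /\ tcol (fil T) k <> tcol (fil T) (succo k).
Proof.
move=> hk hr; pose T' : rsyt N tau := Sub _ hr.
have vs := val_succo hk; move: vs => /= vs.
have e1 : fil T' k = fil T (succo k) by rewrite filSub ffunE adjtL.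
have e2 : fil T' (succo k) = fil T k by rewrite filSub ffunE adjtR.
have ne := tab_rc (T := T) (a := k) (b := succo k).
have nk : k <> succo k by move=> h; move: vs; rewrite -h; lia.
split=> e.
  case: (ltngtP (tcol (fil T) k) (tcol (fil T) (succo k))) => h; last by apply/nk/ne.
    by have := tab_row e h; rewrite vs; lia.
  have := @tab_row T' k (succo k); rewrite /trow /tcol e1 e2 => /(_ (esym e) h).
  by rewrite vs; lia.
case: (ltngtP (trow (fil T) k) (trow (fil T) (succo k))) => h; last by apply/nk/ne.
  by have := tab_col e h; rewrite vs; lia.
have := @tab_col T' k (succo k); rewrite /trow /tcol e1 e2 => /(_ (esym e) h).
by rewrite vs; lia.
Qed.

Lemma fswap_ok T (k : 'I_N) : (k.+1 < N)%N ->
  is_rsyt tau (fswap k (fil T)) = (phic (dcont (fil T) k) != 0).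
Proof.
move=> hk; case: (dcontP T hk) => [e|e ne|d hd h1 h2|d hd h1 h2].
- rewrite phic1 eqxx; apply/negP => /(fswap_nrsyt hk)[]; by rewrite e.
- rewrite phicN1 eqxx; apply/negP => /(fswap_nrsyt hk)[]; by rewrite e.
- rewrite fswap_rsyt //; try lia; by rewrite /phic hd oner_neq0.
- rewrite fswap_rsyt //; try lia.
  rewrite /phic ifF; last by lia.
  rewrite subr_eq0 eq_sym invr_eq1 -rmorphXn /= (eqr_int _ _ 1).
  by apply/esym; rewrite expr2; nia.
Qed.

Local Notation dimV := (dimV N tau).

(** Extended by 0 to fillings that are not tableaux, so that swaps can be iterated without checking
    that each one yields a tableau. *)
Definition fev S : 'cV[Cx]_dimV :=
  if insub S is Some T then ev T else 0.

Lemma fev_val T : fev (fil T) = ev T. Proof. by rewrite /fev /fil valK. Qed.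
Lemma fev_no S : ~~ is_rsyt tau S -> fev S = 0. Proof. by move=> h; rewrite /fev insubN. Qed.

Lemma mul_ev T (m : nat) (M : 'M[Cx]_(m, dimV)) i : (M *m ev T) i 0 = M i (enum_rank T).
Proof.
rewrite mxE (bigD1 (enum_rank T)) //= mxE /tabi enum_rankK eqxx mulr1 big1 ?addr0 //.
move=> j hj; rewrite mxE; case: eqP => [e|]; last by rewrite mulr0.
by move: hj; rewrite -e enum_valK eqxx.
Qed.

Lemma mx_ev_eq (m : nat) (A B : 'M[Cx]_(m, dimV)) :
  (forall T, A *m ev T = B *m ev T) -> A = B.
Proof.
move=> h; apply/matrixP=> i j.
have := h (tabi j) => /matrixP/(_ i 0); rewrite !mul_ev /tabi.
by rewrite enum_valK.
Qed.

Lemma vec_ev (v : 'cV[Cx]_dimV) : v = \sum_T v (enum_rank T) 0 *: ev T.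
Proof.
apply/colP=> i; rewrite summxE (bigD1 (tabi i)) //= !mxE eqxx mulr1 /tabi enum_valK.
rewrite big1 ?addr0 // => T hT; rewrite !mxE /tabi eq_sym (negPf hT) mulr0 //.
Qed.

Lemma gen_ev T (k : 'I_N) : (k.+1 < N)%N ->
  gen tau k *m ev T = bcoef (dcont (fil T) k) *: ev T
     + phic (dcont (fil T) k) *: fev (fswap k (fil T)).
Proof.
move=> hk; apply/colP=> i; rewrite mul_ev !mxE -/(tabi i) /tabi enum_rankK -/(tabi i).
rewrite -/(succo k) -/(adjt k) -/(fil _) -/(fil _).
have Dfev : phic (dcont (fil T) k) != 0 ->
  fev (fswap k (fil T)) i 0 = (fil (tabi i) == fswap k (fil T))%:R.
  rewrite -fswap_ok // => h.
  have -> : fswap k (fil T) = fil (Sub _ h : rsyt N tau) by rewrite filSub.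
  by rewrite fev_val mxE (inj_eq fil_inj).
rewrite -/(trow _ _) -/(tcol _ _) -[cont T k]/(fcont (fil T) k).
rewrite -[cont T (succo k)]/(fcont (fil T) (succo k)) -/(dcont _ _).
have e1 : ((fil T k).1 == (fil T (succo k)).1) = (trow (fil T) k == trow (fil T) (succo k)) by [].
have e2 : ((fil T k).2 == (fil T (succo k)).2) = (tcol (fil T) k == tcol (fil T) (succo k)) by [].
rewrite e1 e2.
case: (dcontP T hk) Dfev => [e|e ne|d hd h1 h2|d hd h1 h2] Dfev.
- by rewrite phic1 mul0r addr0 e eqxx /bcoef invr1 mul1r.
- rewrite phicN1 mul0r addr0 e eqxx /bcoef rmorphN invrN1 mulN1r.
  by rewrite ifF //; apply/eqP.
- rewrite ifF; last by apply/eqP; lia.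
  rewrite ifF; last by apply/eqP; lia.
  rewrite ifT; last exact: h1.
  by move: Dfev; rewrite /phic hd mul1r => ->; rewrite ?oner_neq0 // addrC.
- rewrite ifF; last by apply/eqP; lia.
  rewrite ifF; last by apply/eqP; lia.
  rewrite ifF; last by apply/negP => h; have := ltn_trans h h1; rewrite ltnn.
  rewrite addrC; congr (_ + _).
  have hd2 : (2 <= d) = false by lia.
  rewrite /phic hd2 /bcoef exprVn in Dfev *.
  have [->|/Dfev ->//] := eqVneq (1 - d%:~R ^- 2 : Cx) 0; by rewrite !mul0r.
Qed.

(** The case to check is a non-tableau whose swap is a tableau. Since swapping back leaves the
    tableaux, the content difference is 1 or -1, and the coefficient [phic] vanishes for both
    signs. *)
Lemma gen_fev S (k : 'I_N) : (k.+1 < N)%N ->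
  gen tau k *m fev S = bcoef (dcont S k) *: fev S + phic (dcont S k) *: fev (fswap k S).
Proof.
move=> hk; have [hS|hS] := boolP (is_rsyt tau S).
  by rewrite -(filSub hS) fev_val gen_ev.
rewrite (fev_no hS) mulmx0 scaler0 add0r.
have [hS'|hS'] := boolP (is_rsyt tau (fswap k S)); last by rewrite fev_no // scaler0.
have := @fswap_ok (Sub _ hS') k hk; rewrite filSub fswapK (negPf hS) dcont_swap.
move/esym/negbFE/eqP => h.
have : phic (dcont S k) = 0; last by move->; rewrite scale0r.
have := dcontP (Sub _ hS' : rsyt N tau) hk; rewrite filSub dcont_swap.
rewrite -[in X in _ -> phic X = 0](opprK (dcont S k)).
move: (- dcont S k) h => d h D; case: D h => [_|_ _|e he _ _|e he _ _].
- by rewrite phicN1.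
- by rewrite opprK phic1.
- by rewrite /phic he => /eqP; rewrite oner_eq0.
- rewrite /phic ifF; last by lia.
  move/eqP; rewrite subr_eq0 eq_sym invr_eq1 -rmorphXn /= (eqr_int _ _ 1) => h.
  have : e ^+ 2 <> 1 by rewrite expr2; nia.
  by move/eqP: h.
Qed.

End Tableaux.


(** * Scalar identities behind the Coxeter relations *)

Section LinearCombinations.
Variables (K : fieldType) (n : nat).
Implicit Types (E : 'cV[K]_n).

Lemma comb_comm E0 E1 E2 E3 (b c p q : K) :
  c *: (b *: E0 + p *: E1) + q *: (b *: E2 + p *: E3) =
  b *: (c *: E0 + q *: E2) + p *: (c *: E1 + q *: E3).
Proof. by apply/colP=> i; rewrite !mxE; ring. Qed.

Lemma comb_sq E0 E1 (b p p' : K) : p * p' = 1 - b ^+ 2 ->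
  b *: (b *: E0 + p *: E1) + p *: (- b *: E1 + p' *: E0) = E0.
Proof.
move=> h; apply/colP=> i; rewrite !mxE.
transitivity ((p * p' + b ^+ 2) * E0 i 0); first by ring.
by rewrite h; ring.
Qed.

(** The braid relation on a tableau, with [x] and [y] the content differences of neighbouring
    entries and the vectors indexed by words of swaps. All coefficients agree identically except
    that of [E0], which needs the two quadratic relations. *)
Lemma comb_braid E0 E1 E2 E12 E21 E121 (x y p12 p13 p23 p21 p32 : K) :
  x != 0 -> y != 0 -> x + y != 0 ->
  p12 * p21 = 1 - x^-1 ^+ 2 -> p23 * p32 = 1 - y^-1 ^+ 2 ->
  x^-1 *: (y^-1 *: (x^-1 *: E0 + p12 *: E1) + p23 *: ((x + y)^-1 *: E2 + p13 *: E21))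
  + p12 *: ((x + y)^-1 *: (- x^-1 *: E1 + p21 *: E0) + p13 *: (y^-1 *: E12 + p23 *: E121)) =
  y^-1 *: (x^-1 *: (y^-1 *: E0 + p23 *: E2) + p12 *: ((x + y)^-1 *: E1 + p13 *: E12))
  + p23 *: ((x + y)^-1 *: (- y^-1 *: E2 + p32 *: E0) + p13 *: (x^-1 *: E21 + p12 *: E121)).
Proof.
move=> x0 y0 xy0 h1 h2; apply/colP=> i; rewrite !mxE.
move: (E0 i 0) (E1 i 0) (E2 i 0) (E12 i 0) (E21 i 0) (E121 i 0) => e0 e1 e2 e3 e4 e5.
apply/eqP; rewrite -subr_eq0; apply/eqP.
transitivity ((p12 * p21 - (1 - x^-1 ^+ 2)) / (x + y) * e0
  - (p23 * p32 - (1 - y^-1 ^+ 2)) / (x + y) * e0).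
  by field; rewrite x0 y0 xy0.
by rewrite h1 h2 !subrr.
Qed.

End LinearCombinations.

(** * The seminormal representation and its Jucys-Murphy elements *)

Section SeminormalRepresentation.
Variables (N : nat) (tau : seq nat).
Hypothesis htau : is_partition N tau.
Implicit Types (T : rsyt N tau) (S : {ffun 'I_N -> 'I_N * 'I_N}).

Lemma dcont_neq0 T (k : 'I_N) : (k.+1 < N)%N -> dcont (fil T) k != 0.
Proof. by move=> hk; case: (dcontP htau T hk) => // d hd _ _; lia. Qed.

(** Equal contents mean the same diagonal, hence strict south-east position and a gap of at least 3.
    Thus three consecutive entries have distinct contents, which the denominators of the braid
    relation require. *)
Lemma tab_same_content T a b : fcont (fil T) a = fcont (fil T) b -> a != b ->
  (a.+2 < b)%N \/ (b.+2 < a)%N.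
Proof.
rewrite /fcont => h ne.
case: (ltngtP (trow (fil T) a) (trow (fil T) b)) => hr.
- by right; apply: (tab_se_strict htau hr); lia.
- by left; apply: (tab_se_strict htau hr); lia.
- by case/eqP: ne; apply: (tab_rc hr); lia.
Qed.

Lemma gen_sq (k : 'I_N) : (k.+1 < N)%N -> gen tau k *m gen tau k = 1%:M.
Proof.
move=> hk; apply: mx_ev_eq => T; rewrite mul1mx -mulmxA -fev_val.
rewrite (gen_fev htau _ hk) mulmxDr -!scalemxAr !(gen_fev htau _ hk) fswapK dcont_swap.
have d0 := dcont_neq0 T hk; have := phicN d0; move: d0.
set d := dcont _ _ => d0 hp.
have -> : bcoef (- d) = - bcoef d by rewrite /bcoef rmorphN invrN.
exact: comb_sq.
Qed.

Lemma fswap_comm (k l : 'I_N) S : (k.+1 < N)%N -> (l.+1 < N)%N -> (k.+1 < l)%N ->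
  fswap k (fswap l S) = fswap l (fswap k S).
Proof.
move=> hk hl kl; apply/ffunP=> a; rewrite !ffunE.
by have /permP/(_ a) := adjt_comm hk hl kl; rewrite !permM => ->.
Qed.

Lemma dcont_swap_far (k l : 'I_N) S : (k.+1 < N)%N -> (l.+1 < N)%N ->
  (k.+1 < l)%N || (l.+1 < k)%N -> dcont (fswap k S) l = dcont S l.
Proof.
move=> hk hl kl; rewrite /dcont !fcont_swap /adjt !tpermD // -val_eqE ?val_succo //=; lia.
Qed.

Lemma gen_comm (k l : 'I_N) : (k.+1 < N)%N -> (l.+1 < N)%N -> (k.+1 < l)%N ->
  gen tau k *m gen tau l = gen tau l *m gen tau k.
Proof.
move=> hk hl kl; apply: mx_ev_eq => T; rewrite -!mulmxA -fev_val.
rewrite (gen_fev htau _ hk) (gen_fev htau _ hl) !mulmxDr -!scalemxAr.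
rewrite !(gen_fev htau _ hk) !(gen_fev htau _ hl).
have kl1 : (k.+1 < l)%N || (l.+1 < k)%N by rewrite kl.
have kl2 : (l.+1 < k)%N || (k.+1 < l)%N by rewrite kl orbT.
rewrite (dcont_swap_far (fil T) hk hl kl1) (dcont_swap_far (fil T) hl hk kl2).
rewrite (fswap_comm _ hk hl kl); exact: comb_comm.
Qed.

Lemma gen_braid (k : 'I_N) : (k.+2 < N)%N ->
  gen tau k *m gen tau (succo k) *m gen tau k =
  gen tau (succo k) *m gen tau k *m gen tau (succo k).
Proof.
move=> hk; have hk1 : (k.+1 < N)%N by lia.
have v1 : succo k = k.+1 :> nat := val_succo hk1.
have hk2 : ((succo k).+1 < N)%N by rewrite v1.
have v2 : succo (succo k) = k.+2 :> nat by rewrite [LHS]val_succo // v1.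
apply: mx_ev_eq => T; rewrite -!mulmxA -fev_val.
set l := succo k in v1 v2 hk2 *; set m := succo l in v2 *.
have kl : adjt k l = k by rewrite adjtR.
have kk : adjt k k = l by rewrite adjtL.
have km : adjt k m = m by rewrite /adjt tpermD // -val_eqE /= ?v2 -/l ?v1; lia.
have lk : adjt l k = k by rewrite /adjt tpermD // -val_eqE /= -/m ?v1 ?v2; lia.
have ll : adjt l l = m by rewrite adjtL.
have lm : adjt l m = l by rewrite adjtR.
have ek (x y : Cx) E E' : gen tau k *m (x *: E + y *: E') = x *: (gen tau k *m E) + y *: (gen tau k *m E').
  by rewrite mulmxDr !scalemxAr.
have el (x y : Cx) E E' : gen tau l *m (x *: E + y *: E') = x *: (gen tau l *m E) + y *: (gen tau l *m E').
  by rewrite mulmxDr !scalemxAr.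
have gk S := gen_fev htau S hk1; have gl S := gen_fev htau S hk2.
rewrite gk gl !el !ek !gl !gk !el !ek !gk !gl.
rewrite !fswapK /dcont -/l -/m !fcont_swap ?kl ?kk ?km ?lk ?ll ?lm.
rewrite ?kl ?kk ?km ?lk ?ll ?lm.
have -> : fswap k (fswap l (fswap k (fil T))) = fswap l (fswap k (fswap l (fil T))).
  apply/ffunP=> a; rewrite !ffunE.
  by have /permP/(_ a) := adjt_braid hk; rewrite !permM => ->.
have d12 : fcont (fil T) k - fcont (fil T) l != 0 := dcont_neq0 T hk1.
have d23 : fcont (fil T) l - fcont (fil T) m != 0 := dcont_neq0 T hk2.
have d13 : fcont (fil T) k - fcont (fil T) m != 0.
  rewrite subr_eq0; apply/eqP => /tab_same_content; rewrite -val_eqE /= v2.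
  by move=> /(_ ltac:(lia)); lia.
move: d12 d23 d13; set c1 := fcont _ k; set c2 := fcont _ l; set c3 := fcont _ m.
move=> d12 d23 d13.
clearbody c1 c2 c3; have := phicN d12; have := phicN d23.
rewrite (opprB c1 c2) (opprB c2 c3) => p23 p12.
have B21 : bcoef (c2 - c1) = - bcoef (c1 - c2) by rewrite -opprB /bcoef rmorphN invrN.
have B32 : bcoef (c3 - c2) = - bcoef (c2 - c3) by rewrite -opprB /bcoef rmorphN invrN.
have B13 : (c1 - c3)%:~R = (c1 - c2)%:~R + (c2 - c3)%:~R :> Cx.
  by rewrite -rmorphD /=; congr (_%:~R); ring.
have := intC_neq0 d13; rewrite {}B21 {}B32 /bcoef {}B13 => b13.
by apply: comb_braid p12 p23 => //; exact: intC_neq0.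
Qed.

Lemma tauM_hom : is_tau_hom (tauM (N:=N) tau).
Proof.
apply: epsilon_spec; have [rho [h1 h2 h3]] := coxeter_extension gen_sq gen_comm gen_braid.
by exists rho.
Qed.

Lemma tauM1 : tauM tau (1%g : {perm 'I_N}) = 1%:M. Proof. by case: tauM_hom. Qed.
Lemma tauMM (s t : {perm 'I_N}) : tauM tau (s * t)%g = tauM tau t *m tauM tau s.
Proof. by case: tauM_hom. Qed.
Lemma tauM_adjt (k : 'I_N) : (k.+1 < N)%N -> tauM tau (adjt k) = gen tau k.
Proof. by case: tauM_hom => _ _; exact. Qed.

Lemma tauM_ev T (k : 'I_N) : (k.+1 < N)%N ->
  tauM tau (adjt k) *m ev T = bcoef (dcont (fil T) k) *: ev T
     + phic (dcont (fil T) k) *: fev tau (fswap k (fil T)).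
Proof. by move=> hk; rewrite tauM_adjt // gen_ev. Qed.

Lemma fcont_last T (k : 'I_N) : k.+1 = N -> fcont (fil T) k = 0.
Proof.
move=> hk; have [m [mr mc]] := tab_cell htau (leq0n (trow (fil T) k)) (leq0n (tcol (fil T) k)).
have := @tab_se _ _ htau T m k; rewrite mr mc => /(_ isT isT) h.
have e : m = k by apply: val_inj => /=; have := ltn_ord m; lia.
by rewrite /fcont -e mr mc.
Qed.

(** Jucys-Murphy elements; the sum runs over larger indices because the tableaux are reversed. *)
Definition jm (i : 'I_N) : 'M[Cx]_(dimV N tau) :=
  \sum_(j < N | (i < j)%N) tauM tau (tperm i j).

Lemma jm_step (i : 'I_N) : (i.+1 < N)%N ->
  jm i = tauM tau (adjt i) + tauM tau (adjt i) *m jm (succo i) *m tauM tau (adjt i).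
Proof.
move=> hi; have vi : succo i = i.+1 :> nat := val_succo hi.
rewrite /jm (bigD1 (succo i)) /=; last by rewrite vi.
congr (_ + _); rewrite mulmx_sumr mulmx_suml; apply: eq_big => [j|j].
  by rewrite vi -val_eqE /= vi; lia.
case/andP=> ij nj; rewrite -!tauMM; congr tauM.
have -> : tperm i j = (tperm (succo i) j ^ adjt i)%g.
  rewrite tpermJ /adjt tpermR tpermD // eq_sym // -val_eqE /=; lia.
by rewrite conjgE /adjt tpermV mulgA.
Qed.

(** Downward induction from the largest entry, which sits in the corner with content 0. [jm_step]
    passes from i+1 to i, since s_i T is a combination of T and its swap, whose contents at
    [succo i] are known. *)
Lemma jm_ev (i : 'I_N) T : jm i *m ev T = (fcont (fil T) i)%:~R *: ev T.
Proof.
move: {2}(N - i)%N (erefl (N - i)%N) => n; elim: n i T => [|n IH] i T hn.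
  by have := ltn_ord i; lia.
have [hi|hi] := ltnP i.+1 N; last first.
  rewrite fcont_last; last by have := ltn_ord i; lia.
  rewrite scale0r /jm big_pred0 ?mul0mx // => j; have := ltn_ord j; lia.
have vi : succo i = i.+1 :> nat := val_succo hi.
have IH' T' : jm (succo i) *m ev T' = (fcont (fil T') (succo i))%:~R *: ev T'.
  by apply: IH; rewrite vi; lia.
set s := tauM tau (adjt i).
have ss : s *m s = 1%:M by rewrite /s -tauMM adjtK tauM1.
rewrite jm_step // -/s mulmxDl -!mulmxA.
have key : jm (succo i) *m (s *m ev T) = (fcont (fil T) i)%:~R *: (s *m ev T) - ev T.
  have d0 := intC_neq0 (dcont_neq0 T hi).
  rewrite tauM_ev // mulmxDr -!scalemxAr IH'.
  have -> : phic (dcont (fil T) i) *: (jm (succo i) *m fev tau (fswap i (fil T))) =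
    phic (dcont (fil T) i) *: ((fcont (fil T) i)%:~R *: fev tau (fswap i (fil T))).
    have [->|] := eqVneq (phic (dcont (fil T) i)) 0; first by rewrite !scale0r.
    rewrite -fswap_ok // => h; rewrite -(filSub h) fev_val IH'.
    by rewrite filSub fcont_swap adjtR.
  apply/colP=> j; rewrite !mxE /bcoef.
  have e : (fcont (fil T) (succo i))%:~R = (fcont (fil T) i)%:~R - (dcont (fil T) i)%:~R :> Cx.
    by rewrite /dcont -rmorphB /=; congr (_%:~R); ring.
  by rewrite e; field.
rewrite key mulmxBr -scalemxAr mulmxA ss mul1mx addrC subrK //.
Qed.

Lemma norm0_gt0 T : (0 < norm0 T)%R.
Proof.
rewrite /norm0; apply: prodr_gt0 => a _; apply: prodr_gt0 => b /andP[_ h].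
rewrite subr_gt0 -rmorphXn /= invf_lt1 ?ltr0z ?ltr1z //.
  by rewrite expr2; nia.
by rewrite expr2; nia.
Qed.

Lemma norm0_fcont T : norm0 T =
  \prod_(a < N) \prod_(b < N | (a < b)%N && (fcont (fil T) a <= fcont (fil T) b - 2))
     (1 - ((fcont (fil T) a - fcont (fil T) b)%:~R) ^- 2).
Proof. by []. Qed.

(** An adjacent transposition preserves the order of every pair except (k, k+1), so reindexing
    alters a product over ordered pairs only there. *)
Lemma prod_pair_swap (R0 : comPzRingType) (k : 'I_N) (P : rel 'I_N) (F : 'I_N -> 'I_N -> R0) :
  (k.+1 < N)%N ->
  \prod_(a < N) \prod_(b < N | (a < b)%N && P (adjt k a) (adjt k b)) F (adjt k a) (adjt k b) =
  (if P (succo k) k then F (succo k) k else 1) *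
  \prod_(a < N) \prod_(b < N | (a < b)%N && P a b && ((a, b) != (k, succo k))) F a b.
Proof.
move=> hk; have vk : succo k = k.+1 :> nat := val_succo hk.
rewrite !pair_big_dep /=.
have hb : bijective (fun p : 'I_N * 'I_N => (adjt k p.1, adjt k p.2)).
  have inv : involutive (fun p : 'I_N * 'I_N => (adjt k p.1, adjt k p.2)).
    by case=> a b /=; rewrite -!permM adjtK !perm1.
  exact: inv_bij.
rewrite (reindex _ (onW_bij _ hb)) /=.
under eq_bigl => p do rewrite -!permM adjtK !perm1.
under eq_bigr => p _ do rewrite -!permM adjtK !perm1.
rewrite (bigID (pred1 (succo k, k))) /=; congr (_ * _).
  case: ifP => hP.
    rewrite (big_pred1 (succo k, k)) // => -[a b] /=; rewrite andbC.
    case: eqP => [[-> ->]|//] /=; rewrite hP adjtL adjtR vk ltnSn //.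
  rewrite big_pred0 // => -[a b] /=; rewrite andbC.
  by case: eqP => [[-> ->]|//] /=; rewrite hP andbF.
apply: eq_bigl => -[a b] /=.
case: (P a b); rewrite ?andbF // !andbT.
rewrite !xpair_eqE -!val_eqE /= vk !adjtE //.
have := ltn_ord a; have := ltn_ord b.
by repeat case: eqP => //=; lia.
Qed.

(** Only the factor of the pair (k, k+1) is concerned: it is absent from the norm of [T], where the
    content difference is positive, and present in that of the swap. *)
Lemma norm0_swap T T' (k : 'I_N) : (k.+1 < N)%N -> fil T' = fswap k (fil T) ->
  2 <= dcont (fil T) k -> norm0 T' = (1 - (dcont (fil T) k)%:~R ^- 2) * norm0 T.
Proof.
move=> hk e hd; have vk : succo k = k.+1 :> nat := val_succo hk.
rewrite !norm0_fcont e.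
pose P (a b : 'I_N) := fcont (fil T) a <= fcont (fil T) b - 2.
pose F (a b : 'I_N) : R := 1 - ((fcont (fil T) a - fcont (fil T) b)%:~R) ^- 2.
transitivity (\prod_(a < N) \prod_(b < N | (a < b)%N && P (adjt k a) (adjt k b))
   F (adjt k a) (adjt k b)).
  by apply: eq_bigr => a _; apply: eq_big => [b|b _]; rewrite !fcont_swap.
rewrite prod_pair_swap //; congr (_ * _).
  rewrite ifT; last by rewrite /P; move: hd; rewrite /dcont; lia.
  by rewrite /F /dcont -(opprB (fcont (fil T) k)) rmorphN /= sqrrN.
apply: eq_bigr => a _; apply: eq_bigl => b; rewrite /P.
case: eqP => [[-> ->]|_] /=; last by rewrite andbT.
by rewrite andbF; apply/esym/negP => /andP[_]; move: hd; rewrite /dcont; lia.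
Qed.

End SeminormalRepresentation.


(** * Dunkl and Cherednik operators *)

Section DividedDifferences.
Variables (K : fieldType) (N : nat).
Implicit Types (p q r : {mpoly K[N]}) (w : {perm 'I_N}).

Definition mnact (w : {perm 'I_N}) (m : 'X_{1..N}) : 'X_{1..N} := [multinom m (w i) | i < N].

Lemma msym_coef w p m : (msym w p)@_m = p@_(mnact w m).
Proof. exact: mcoeff_sym. Qed.

Lemma msym_comp w p : p \mPo [tuple ('X_(w i) : {mpoly K[N]}) | i < N] = msym w p.
Proof.
rewrite -[RHS]comp_mpoly_id msym_mPo; congr (_ \mPo _).
by apply: eq_from_tnth => i; rewrite !tnth_mktuple.
Qed.

Lemma msym_var w i : msym w ('X_i : {mpoly K[N]}) = 'X_(w i).
Proof.
rewrite msymX; congr 'X_[_]; apply/mnmP=> j.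
by rewrite mnmE !mnm1E -(inj_eq (@perm_inj _ w)) permKV.
Qed.

Lemma msymC w c : msym w (c%:MP : {mpoly K[N]}) = c%:MP.
Proof. by rewrite -msym_comp comp_mpolyC. Qed.

Lemma msym_mderiv w i p : msym w (mderiv i p) = mderiv (w i) (msym w p).
Proof.
apply/mpolyP=> m; rewrite msym_coef !mcoeff_deriv msym_coef mnmE; congr (_@__ *+ _).
by apply/mnmP=> j; rewrite mnmDE [RHS]mnmE mnmDE !mnm1E mnmE (inj_eq perm_inj).
Qed.

Lemma mpoly_gen_ind (P : {mpoly K[N]} -> Prop) :
  P 0 -> P 1 -> (forall p q, P p -> P q -> P (p + q)) ->
  (forall p q, P p -> P q -> P (p * q)) -> (forall c p, P p -> P (c *: p)) ->
  (forall k, P 'X_k) -> forall p, P p.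
Proof.
move=> P0 P1 PD PM PZ PX.
elim/mpolyind => [|c m q _ _ h]; first exact: P0.
apply: PD h; apply: PZ; rewrite mpolyXE_id.
apply: (big_ind P) => // k _; elim: (m k) => [|n IH]; first exact: P1.
by rewrite exprS; apply: PM.
Qed.

(** Divisibility holds for the variables and passes to products by the twisted Leibniz rule pq -
    s(pq) = (p - s p) q + s(p) (q - s q). *)
Lemma tperm_dvd (i j : 'I_N) p : exists r, ('X_i - 'X_j) * r = p - msym (tperm i j) p.
Proof.
elim/mpoly_gen_ind: p => [||q q' [r h] [r' h']|q q' [r h] [r' h']|c q [r h]|k].
- by exists 0; rewrite msym0 mulr0 subrr.
- by exists 0; rewrite msym1 mulr0 subrr.
- by exists (r + r'); rewrite mulrDr h h' msymD opprD addrACA.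
- exists (r * q' + msym (tperm i j) q * r').
  by rewrite mulrDr mulrA h mulrCA h' msymM; ring.
- by exists (c *: r); rewrite -scalerAr h scalerBr msymZ.
- have [->|ki] := eqVneq k i.
    by exists 1; rewrite msym_var tpermL mulr1.
  have [->|kj] := eqVneq k j.
    by exists (-1); rewrite msym_var tpermR mulrN1 opprB.
  by exists 0; rewrite msym_var tpermD 1?eq_sym // subrr mulr0.
Qed.

Lemma varB_neq0 (i j : 'I_N) : i != j -> ('X_i - 'X_j : {mpoly K[N]}) != 0.
Proof.
move=> ij; apply/eqP=> /(congr1 (mcoeff U_(i))).
rewrite mcoeffB !mcoeffXU eqxx eq_sym (negPf ij) subr0 mcoeff0 => /eqP.
by rewrite oner_eq0.
Qed.

End DividedDifferences.

(** * Dunkl operators for an arbitrary representation over a field *)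

Section DunklOperators.
Variables (K : fieldType) (N d : nat) (rho : {perm 'I_N} -> 'M[K]_d) (kc : K).
Hypothesis rho1 : rho 1%g = 1%:M.
Hypothesis rhoM : forall s t, rho (s * t)%g = rho t *m rho s.

Local Notation PN := {mpoly K[N]}.
Local Notation V := 'cV[PN]_d.
Implicit Types (p q : V) (w s t : {perm 'I_N}).

Definition gpolyM (M : 'M[K]_d) : 'M[PN]_d := map_mx (fun c => c%:MP) M.
Definition gpw w p : V :=
  map_mx (fun r : PN => r \mPo [tuple ('X_(w i) : PN) | i < N]) p.
Definition gddiff (i j : 'I_N) p : V :=
  epsilon (inhabits 0)
    (fun q => map_mx (fun r => ('X_i - 'X_j) * r) q = p - gpw (tperm i j) p).
Definition gdunkl (i : 'I_N) p : V :=
  map_mx (mderiv i) p +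
  (kc%:MP) *: \sum_(j < N | j != i) (gpolyM (rho (tperm i j)) *m gddiff i j p).
Definition gcher (i : 'I_N) p : V :=
  gdunkl i (map_mx (fun r => 'X_i * r) p) -
  (kc%:MP) *: \sum_(j < N | (j < i)%N) (gpolyM (rho (tperm i j)) *m gpw (tperm i j) p).


(* Sealed copies of the operations: without them failed unifications unfold
   multivariate polynomial arithmetic. *)
Definition smul : PN -> V -> V := locked (fun (c : PN) p => c *: p).
Definition tmul : 'M[K]_d -> V -> V := locked (fun (M : 'M[K]_d) p => gpolyM M *m p).
Definition gpm : {perm 'I_N} -> V -> V := locked gpw.
Definition vact : {perm 'I_N} -> V -> V := locked (fun w p => tmul (rho w) (gpm w p)).
Definition gdd := locked gddiff.

Lemma smulE c p : smul c p = c *: p. Proof. by rewrite /smul -lock. Qed.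
Lemma tmulE M p : tmul M p = gpolyM M *m p. Proof. by rewrite /tmul -lock. Qed.
Lemma gpmE w p : gpm w p = map_mx (msym w) p.
Proof. by rewrite /gpm -lock; apply/matrixP=> a b; rewrite !mxE msym_comp. Qed.
Lemma vactE w p : vact w p = tmul (rho w) (gpm w p). Proof. by rewrite /vact -lock. Qed.

Lemma smulDr c p q : smul c (p + q) = smul c p + smul c q.
Proof. by rewrite !smulE scalerDr. Qed.
Lemma smulBr c p q : smul c (p - q) = smul c p - smul c q.
Proof. by rewrite !smulE scalerBr. Qed.
Lemma smulBl a b p : smul (a - b) p = smul a p - smul b p.
Proof. by rewrite !smulE scalerBl. Qed.
Lemma smulA a b p : smul a (smul b p) = smul (a * b) p.
Proof. by rewrite !smulE scalerA. Qed.
Lemma smulC a b p : smul a (smul b p) = smul b (smul a p).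
Proof. by rewrite !smulA mulrC. Qed.
Lemma smul0 c : smul c 0 = 0. Proof. by rewrite smulE scaler0. Qed.
Lemma smul_sum c (I : Type) (r : seq I) (P : pred I) (F : I -> V) :
  smul c (\sum_(i <- r | P i) F i) = \sum_(i <- r | P i) smul c (F i).
Proof. by apply: (big_morph (smul c)); [exact: smulDr | exact: smul0]. Qed.

Lemma tmulD M p q : tmul M (p + q) = tmul M p + tmul M q.
Proof. by rewrite !tmulE mulmxDr. Qed.
Lemma tmul_smul M c p : tmul M (smul c p) = smul c (tmul M p).
Proof. by rewrite !tmulE !smulE scalemxAr. Qed.
Lemma tmulM A B p : tmul A (tmul B p) = tmul (A *m B) p.
Proof. by rewrite !tmulE mulmxA /gpolyM map_mxM. Qed.
Lemma tmul1 p : tmul 1%:M p = p.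
Proof. by rewrite tmulE /gpolyM map_mx1 mul1mx. Qed.
Lemma tmulB M p q : tmul M (p - q) = tmul M p - tmul M q.
Proof. by rewrite !tmulE mulmxBr. Qed.

Lemma gpmD w p q : gpm w (p + q) = gpm w p + gpm w q.
Proof. by rewrite !gpmE; apply/matrixP=> a b; rewrite !mxE msymD. Qed.
Lemma gpm_smul w c p : gpm w (smul c p) = smul (msym w c) (gpm w p).
Proof. by rewrite !gpmE !smulE; apply/matrixP=> a b; rewrite !mxE msymM. Qed.
Lemma gpm_tmul w M p : gpm w (tmul M p) = tmul M (gpm w p).
Proof.
rewrite !gpmE !tmulE; apply/matrixP=> a b; rewrite !mxE raddf_sum /=.
by apply: eq_bigr => k _; rewrite !mxE msymM msymC.
Qed.
Lemma gpmM s t p : gpm s (gpm t p) = gpm (t * s)%g p.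
Proof. by rewrite !gpmE; apply/matrixP=> a b; rewrite !mxE msymMm. Qed.
Lemma gpm1 p : gpm 1%g p = p.
Proof. by rewrite gpmE; apply/matrixP=> a b; rewrite !mxE msym1m. Qed.

Lemma vact1 p : vact 1%g p = p.
Proof. by rewrite vactE rho1 tmul1 gpm1. Qed.
Lemma vactM s t p : vact s (vact t p) = vact (t * s)%g p.
Proof. by rewrite !vactE gpm_tmul tmulM -rhoM gpmM. Qed.
Lemma vactD w p q : vact w (p + q) = vact w p + vact w q.
Proof. by rewrite !vactE gpmD tmulD. Qed.
Lemma vactZ w c p : vact w (smul c p) = smul (msym w c) (vact w p).
Proof. by rewrite !vactE gpm_smul tmul_smul. Qed.
Lemma vactX w i p : vact w (smul 'X_i p) = smul 'X_(w i) (vact w p).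
Proof. by rewrite vactZ msym_var. Qed.
Lemma vactC w (c : K) p : vact w (smul c%:MP p) = smul c%:MP (vact w p).
Proof. by rewrite vactZ msymC. Qed.

Lemma smulI c p q : c != 0 -> smul c p = smul c q -> p = q.
Proof.
rewrite !smulE => c0 h; apply/matrixP=> a b; apply: (mulfI c0).
by have := congr1 (fun M : V => M a b) h; rewrite !mxE.
Qed.

(** Divisibility of each component supplies the witness that gives the [epsilon] choice its
    meaning. *)
Lemma gddE i j p : smul ('X_i - 'X_j) (gdd i j p) = p - gpm (tperm i j) p.
Proof.
rewrite smulE /gdd -lock gpmE.
have -> : map_mx (msym (tperm i j)) p = gpw (tperm i j) p.
  by apply/matrixP=> a b; rewrite !mxE msym_comp.
have sE (c : PN) (q : V) : c *: q = map_mx (fun r => c * r) q.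
  by apply/matrixP=> a b; rewrite !mxE.
rewrite sE.
apply: (@epsilon_spec _ (inhabits 0)
  (fun q => map_mx (fun r => ('X_i - 'X_j) * r) q = p - gpw (tperm i j) p)).
have h a := tperm_dvd i j (p a 0).
have [f hf] := fin_all_exists h.
exists (\col_a f a); apply/colP=> a.
by rewrite !mxE hf msym_comp.
Qed.

(** One term of the Dunkl sum, including the representation. It is characterised by [ediffE] after
    cancelling X_i - X_j, so every commutation rule below is checked after multiplication by that
    factor. *)
Definition ediff : 'I_N -> 'I_N -> V -> V := locked (fun i j p => tmul (rho (tperm i j)) (gdd i j p)).

Lemma ediffE i j p :
  smul ('X_i - 'X_j) (ediff i j p) = tmul (rho (tperm i j)) p - vact (tperm i j) p.
Proof. by rewrite /ediff -lock -tmul_smul gddE tmulB vactE. Qed.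

Lemma ediff_uniq i j p q : i != j ->
  smul ('X_i - 'X_j) q = tmul (rho (tperm i j)) p - vact (tperm i j) p -> ediff i j p = q.
Proof. by move=> ij h; apply: (smulI (varB_neq0 K ij)); rewrite h ediffE. Qed.

Lemma ediffD i j p q : i != j -> ediff i j (p + q) = ediff i j p + ediff i j q.
Proof.
move=> ij; apply: ediff_uniq => //.
by rewrite smulDr !ediffE vactD tmulD opprD addrACA.
Qed.

Lemma ediffC i j (c : K) p : i != j -> ediff i j (smul c%:MP p) = smul c%:MP (ediff i j p).
Proof.
move=> ij; apply: ediff_uniq => //.
by rewrite smulC ediffE vactC tmul_smul smulBr.
Qed.

Lemma ediff_act w i j p : i != j -> vact w (ediff i j p) = ediff (w i) (w j) (vact w p).
Proof.
move=> ij; apply/esym/ediff_uniq; first by rewrite (inj_eq perm_inj).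
have -> : ('X_(w i) - 'X_(w j) : PN) = msym w ('X_i - 'X_j).
  by rewrite msymB !msym_var.
have vactB x y : vact w (x - y) = vact w x - vact w y.
  by apply/eqP; rewrite eq_sym subr_eq -vactD subrK.
rewrite -vactZ ediffE vactB; congr (_ - _).
  rewrite !vactE gpm_tmul !tmulM -!rhoM; congr (tmul (rho _) _).
  by rewrite -tpermJ conjgE !mulgA mulgV mul1g.
by rewrite !vactM -tpermJ conjgE !mulgA mulgV mul1g.
Qed.

Lemma ediffX_far i j k p : i != j -> k != i -> k != j ->
  ediff i j (smul 'X_k p) = smul 'X_k (ediff i j p).
Proof.
move=> ij ki kj; apply: ediff_uniq => //.
by rewrite smulC ediffE vactX tpermD 1?eq_sym // tmul_smul smulBr.
Qed.

Lemma ediffXl i j p : i != j ->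
  ediff i j (smul 'X_i p) = smul 'X_i (ediff i j p) + vact (tperm i j) p.
Proof.
move=> ij; apply: ediff_uniq => //.
by rewrite smulDr smulC ediffE vactX tpermL tmul_smul smulBr smulBl addrA subrK.
Qed.

Lemma ediffXr i j p : i != j ->
  ediff i j (smul 'X_j p) = smul 'X_j (ediff i j p) - vact (tperm i j) p.
Proof.
move=> ij; apply: ediff_uniq => //.
by rewrite smulBr smulC ediffE vactX tpermR tmul_smul smulBr smulBl opprB addrA subrK.
Qed.

Definition vder := locked (fun (i : 'I_N) (p : V) => map_mx (mderiv i) p : V).
Lemma vderE i p : vder i p = map_mx (mderiv i) p. Proof. by rewrite /vder -lock. Qed.

Lemma vderD i p q : vder i (p + q) = vder i p + vder i q.
Proof. by rewrite !vderE; apply/matrixP=> a b; rewrite !mxE mderivD. Qed.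

Lemma vderC i (c : K) p : vder i (smul c%:MP p) = smul c%:MP (vder i p).
Proof. by rewrite !vderE !smulE; apply/matrixP=> a b; rewrite !mxE mderiv_mulC. Qed.

Lemma vderX i k p :
  vder i (smul 'X_k p) = smul 'X_k (vder i p) + (if k == i then p else 0).
Proof.
rewrite !vderE !smulE; apply/matrixP=> a b; rewrite !mxE mderivM addrC mderivX mnm1E.
congr (_ + _).
have [->|_] := eqVneq k i; last by rewrite scale0r !mul0r mxE.
have -> : (U_(i) - U_(i))%MM = 0%MM by apply/mnmP=> l; rewrite mnmBE mnm0E subnn.
by rewrite mpolyX0 scale1r mul1r.
Qed.

Lemma vact_vder w i p : vact w (vder i p) = vder (w i) (vact w p).
Proof.
rewrite !vactE !tmulE !gpmE !vderE; apply/matrixP=> a b; rewrite !mxE raddf_sum /=.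
by apply: eq_bigr => l _; rewrite !mxE msym_mderiv mderiv_mulC.
Qed.

Definition cherednik := locked gcher.

Lemma cherednikE i p : cherednik i p =
  vder i (smul 'X_i p) + smul kc%:MP (\sum_(j < N | j != i) ediff i j (smul 'X_i p))
  - smul kc%:MP (\sum_(j < N | (j < i)%N) vact (tperm i j) p).
Proof.
have mE (c : PN) (q : V) : map_mx (fun r => c * r) q = smul c q.
  by rewrite smulE; apply/matrixP=> a b; rewrite !mxE.
rewrite /cherednik -lock /gcher /gdunkl mE -!smulE -vderE.
congr (_ + smul _ _ - smul _ _); apply: eq_bigr => j _.
  by rewrite /ediff -lock tmulE /gdd -lock.
by rewrite vactE tmulE /gpm -lock.
Qed.

End DunklOperators.

(** * Relations of the Cherednik operators with permutations and the affine step *)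

Section CherednikRelations.
Variables (V : zmodType) (N : nat) (act : {perm 'I_N} -> V -> V) (X : 'I_N -> V -> V)
  (E : 'I_N -> 'I_N -> V -> V) (der : 'I_N -> V -> V) (kap : V -> V).
Hypothesis act1 : forall p, act 1%g p = p.
Hypothesis actM : forall s t p, act s (act t p) = act (t * s)%g p.
Hypothesis actD : forall w p q, act w (p + q) = act w p + act w q.
Hypothesis kapD : forall p q, kap (p + q) = kap p + kap q.
Hypothesis XD : forall i p q, X i (p + q) = X i p + X i q.
Hypothesis Xkap : forall i p, X i (kap p) = kap (X i p).
Hypothesis XX : forall i j p, X i (X j p) = X j (X i p).
Hypothesis actX : forall w i p, act w (X i p) = X (w i) (act w p).
Hypothesis actkap : forall w p, act w (kap p) = kap (act w p).
Hypothesis actE : forall w i j p, i != j -> act w (E i j p) = E (w i) (w j) (act w p).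
Hypothesis EX_far : forall i j k p, i != j -> k != i -> k != j -> E i j (X k p) = X k (E i j p).
Hypothesis EXl : forall i j p, i != j -> E i j (X i p) = X i (E i j p) + act (tperm i j) p.
Hypothesis EXr : forall i j p, i != j -> E i j (X j p) = X j (E i j p) - act (tperm i j) p.
Hypothesis derX : forall i k p, der i (X k p) = X k (der i p) + (if k == i then p else 0).
Hypothesis actder : forall w i p, act w (der i p) = der (w i) (act w p).

(** The operators are rebuilt from uninterpreted maps, so that the relations rest on the listed
    commutation rules alone and no polynomial arithmetic is unfolded. *)
Definition dunk (i : 'I_N) (p : V) : V := der i p + kap (\sum_(j < N | j != i) E i j p).
Definition cher (i : 'I_N) (p : V) : V :=
  dunk i (X i p) - kap (\sum_(j < N | (j < i)%N) act (tperm i j) p).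

Let add0 (f : V -> V) : (forall p q, f (p + q) = f p + f q) -> f 0 = 0.
Proof. by move=> h; apply: (addrI (f 0)); rewrite -h !addr0. Qed.
Let addN (f : V -> V) : (forall p q, f (p + q) = f p + f q) -> forall p, f (- p) = - f p.
Proof. by move=> h p; apply: (addrI (f p)); rewrite -h !subrr add0. Qed.
Let addB (f : V -> V) : (forall p q, f (p + q) = f p + f q) ->
  forall p q, f (p - q) = f p - f q.
Proof. by move=> h p q; rewrite h addN. Qed.
Let addS (f : V -> V) : (forall p q, f (p + q) = f p + f q) ->
  forall (I : Type) (r : seq I) (P : pred I) (F : I -> V),
  f (\sum_(i <- r | P i) F i) = \sum_(i <- r | P i) f (F i).
Proof. by move=> h I r P F; apply: (big_morph f); [exact: h | exact: add0]. Qed.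

Lemma act_dunk w i p : act w (dunk i p) = dunk (w i) (act w p).
Proof.
rewrite /dunk actD actkap actder; congr (_ + kap _).
rewrite (addS (actD w)) [RHS](reindex_inj (@perm_inj _ w)) /=.
apply: eq_big => [j|j ji]; first by rewrite (inj_eq perm_inj).
by rewrite actE // eq_sym.
Qed.

Lemma dunkX_same i p : dunk i (X i p) =
  X i (dunk i p) + p + kap (\sum_(j < N | j != i) act (tperm i j) p).
Proof.
rewrite /dunk derX eqxx XD -!addrA; congr (_ + _).
rewrite [RHS]addrCA; congr (_ + _).
rewrite (eq_bigr (fun j => X i (E i j p) + act (tperm i j) p)); last first.
  by move=> j ji; rewrite EXl // eq_sym.
by rewrite big_split /= kapD Xkap (addS (XD i)).
Qed.

Lemma dunkX_diff i k p : k != i -> dunk i (X k p) = X k (dunk i p) - kap (act (tperm i k) p).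
Proof.
move=> ki; rewrite /dunk derX (negPf ki) addr0 XD -addrA; congr (_ + _).
rewrite Xkap -(addB kapD); congr (kap _).
rewrite (bigD1 k) //= [in RHS](bigD1 k) //= EXr ?(eq_sym i) // XD addrAC; congr (_ + _ - _).
rewrite (addS (XD k)); apply: eq_bigr => j /andP[ji jk].
by rewrite EX_far // eq_sym.
Qed.

(** Conjugation by s_i carries the Dunkl part and the terms j < i of U_i to those of U_{i+1}. The
    one additional term of U_{i+1}, for j = i, is s_i itself and produces kappa. *)
Lemma cher_adjt (i : 'I_N) p : (i.+1 < N)%N ->
  act (adjt i) (cher i p) = cher (succo i) (act (adjt i) p) + kap p.
Proof.
move=> hi; have vi : succo i = i.+1 :> nat := val_succo hi.
rewrite /cher (addB (actD _)) act_dunk actX adjtL actkap -[RHS]addrA; congr (_ + _).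
rewrite -[kap p]opprK -opprD -(addB kapD); congr (- (kap _)).
rewrite [in RHS](bigD1 i) /=; last by rewrite vi.
rewrite actM -/(adjt i) (tpermC (succo i)) -/(adjt i) adjtK act1 addrAC subrr add0r (addS (actD _)).
apply: eq_big => [j|j ji]; first by rewrite vi -val_eqE /=; lia.
rewrite !actM; congr act.
have -> : tperm (succo i) j = (tperm i j ^ adjt i)%g.
  by rewrite tpermJ adjtL /adjt tpermD // -val_eqE /= ?vi; lia.
by rewrite conjgE !mulgA mulgV mul1g.
Qed.

Lemma cher_adjtS (i : 'I_N) p : (i.+1 < N)%N ->
  act (adjt i) (cher (succo i) p) = cher i (act (adjt i) p) - kap p.
Proof.
move=> hi; have := cher_adjt (act (adjt i) p) hi.
rewrite actM adjtK act1 => /(congr1 (act (adjt i))).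
rewrite actM adjtK act1 actD actkap actM adjtK act1 => ->.
by rewrite addrK.
Qed.

Lemma cher_adjt_far (i j : 'I_N) p : (i.+1 < N)%N -> j != i -> j != succo i ->
  act (adjt i) (cher j p) = cher j (act (adjt i) p).
Proof.
move=> hi ji js; have vi : succo i = i.+1 :> nat := val_succo hi.
have ej : adjt i j = j by rewrite /adjt tpermD // eq_sym.
rewrite /cher (addB (actD _)) act_dunk actX ej actkap; congr (_ - kap _).
rewrite (addS (actD _)) [RHS](reindex_inj (@perm_inj _ (adjt i))) /=.
apply: eq_big => [l|l lj].
  rewrite adjtE //; move: ji js; rewrite -!val_eqE /= vi.
  by repeat case: eqP => //=; lia.
rewrite !actM; congr act.
have -> : tperm j (adjt i l) = (tperm j l ^ adjt i)%g by rewrite tpermJ ej.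
by rewrite conjgE !mulgA mulgV mul1g.
Qed.

Variables (cyc : {perm 'I_N}) (first last : 'I_N).
Hypothesis val_first : first = 0%N :> nat.
Hypothesis val_last : last.+1 = N.
Hypothesis cyc_first : cyc first = last.
Hypothesis cyc_succ : forall i : 'I_N, (i.+1 < N)%N -> cyc (succo i) = i.

(** Moving x_N across the Dunkl part costs kappa times the transposition of i and N; this is the
    image under [cyc] of the term j = [first] in the lower sum of U_{i+1}. *)
Lemma affine_inner (i : 'I_N) p : (i.+1 < N)%N ->
  cher i (X last (act cyc p)) = X last (act cyc (cher (succo i) p)).
Proof.
move=> hi; have vi : succo i = i.+1 :> nat := val_succo hi.
have il : last != i by rewrite -val_eqE /=; lia.
set q := act cyc p.
have -> : act cyc (cher (succo i) p) = dunk i (X i q)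
    - kap (act (tperm i last) q + \sum_(j < N | (j < i)%N) act (tperm i j) q).
  rewrite /cher (addB (actD _)) act_dunk actX cyc_succ // actkap (addS (actD _)).
  congr (_ - kap _).
  have tp j : act cyc (act (tperm (succo i) j) p) = act (tperm i (cyc j)) q.
    rewrite !actM; congr act.
    by rewrite -[in RHS](cyc_succ hi) -tpermJ conjgE !mulgA mulgV mul1g.
  rewrite (eq_bigr _ (fun j _ => tp j)) (bigD1 first) /=; last by rewrite val_first vi.
  rewrite cyc_first; congr (_ + _).
  rewrite [RHS](reindex_inj (@perm_inj _ cyc)) /=; apply: eq_bigl => j.
  have [->|jf] := eqVneq j first; first by rewrite andbF cyc_first; lia.
  have hj : (j.-1.+1 < N)%N.
    by move: jf; rewrite -val_eqE /= val_first; have := ltn_ord j; lia.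
  have -> : j = succo (Ordinal (ltnW hj)).
    by apply: val_inj; rewrite val_succo //=; move: jf; rewrite -val_eqE /= val_first; lia.
  by rewrite cyc_succ // andbT vi val_succo.
rewrite /cher XX dunkX_diff // actX tpermL (addB (XD _)) -[LHS]addrA.
congr (_ + _); rewrite -opprD; congr (- _).
rewrite Xkap -kapD XD (addS (XD _)); congr (kap (_ + _)).
by apply: eq_bigr => j ji; rewrite actX tpermD // -val_eqE /=; lia.
Qed.

(** The commutator of D_N with x_N is 1 plus kappa times the sum of all transpositions with N, and
    that sum is the lower sum subtracted in U_N. *)
Lemma affine_last p :
  cher last (X last (act cyc p)) = X last (act cyc (cher first p + p)).
Proof.
rewrite actD; set q := act cyc p.
have -> : act cyc (cher first p) = dunk last (X last q).
  rewrite /cher (addB (actD _)) act_dunk actX cyc_first big_pred0 ?(add0 kapD) ?(add0 (actD _)) ?subr0 //.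
  by move=> j; rewrite val_first.
rewrite /cher dunkX_same XD -[LHS]addrA -[RHS]addr0; congr (_ + _).
apply/eqP; rewrite subr_eq0; apply/eqP; congr kap.
apply: eq_bigl => j; rewrite -val_eqE /=; have := ltn_ord j; lia.
Qed.

End CherednikRelations.


(** * Exponents and the triangularity order *)

Section Exponents.
Variable N : nat.
Implicit Types (a b c : 'X_{1..N}) (i j k p q : 'I_N).

Lemma mnact_mnact (w v : {perm 'I_N}) a : mnact w (mnact v a) = mnact (w * v)%g a.
Proof. by apply/mnmP=> i; rewrite !mnmE permM. Qed.

Lemma mnact1 a : mnact 1%g a = a.
Proof. by apply/mnmP=> i; rewrite mnmE perm1. Qed.

Lemma mnactE (w : {perm 'I_N}) a i : mnact w a i = a (w i).
Proof. by rewrite mnmE. Qed.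

Lemma mnactK k : involutive (mnact (adjt k)).
Proof. by move=> a; rewrite mnact_mnact adjtK mnact1. Qed.

Lemma mdeg_mnact (w : {perm 'I_N}) a : mdeg (mnact w a) = mdeg a.
Proof. exact: mdeg_mperm. Qed.

(* [mv c b]: the monomial x^c can appear when a divided difference or a
   triangular Cherednik operator is applied to x^b. *)
Definition mv c b : Prop := exists p q : 'I_N,
  [/\ (b q < b p)%N, (c p + c q = b p + b q)%N,
      (forall r, r != p -> r != q -> c r = b r) &
      ((b q < c q < b p)%N \/ (c q = b p /\ (p < q)%N))].

(** Finer than [jack_lt] and, unlike it, stable under the affine step: (2,1,1,0) precedes (0,2,2,0)
    for [jack_lt], but their images (1,1,0,3) and (2,2,0,1) are not in that relation.
    [below_jack_lt] returns to the order of the definition. *)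
Inductive below a : 'X_{1..N} -> Prop :=
| BelowRefl : below a a
| BelowStep b c : below a b -> mv c b -> below a c.

Lemma adjt_lt (k p q : 'I_N) : (k.+1 < N)%N -> (p < q)%N ->
  (adjt k p < adjt k q)%N \/ (p = k /\ q = succo k).
Proof.
move=> hk pq; have vk : succo k = k.+1 :> nat := val_succo hk.
have [h|h] := ltnP (adjt k p) (adjt k q); [by left | right].
move: h; rewrite !adjtE // => h.
have : (p == k :> nat) && (q == k.+1 :> nat).
  by move: h; repeat case: eqP => //=; lia.
case/andP=> /eqP e1 /eqP e2.
by split; apply: val_inj; rewrite /= ?vk.
Qed.

(** s_k maps a move to a move, apart from the move that exchanges the values at k and k+1, which it
    undoes. *)
Lemma mv_adjt k b c : (k.+1 < N)%N -> mv c b ->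
  mv (mnact (adjt k) c) (mnact (adjt k) b) \/ mnact (adjt k) c = b.
Proof.
move=> hk [p [q [h1 h2 h3 h4]]].
have nr r : r != adjt k p -> r != adjt k q -> mnact (adjt k) c r = mnact (adjt k) b r.
  move=> rp rq; rewrite !mnactE; apply: h3.
    by rewrite (canF_eq (tpermK _ _)).
  by rewrite (canF_eq (tpermK _ _)).
have ss x : adjt k (adjt k x) = x by rewrite -permM adjtK perm1.
case: h4 => [h4|[h4 pq]].
  left; exists (adjt k p), (adjt k q); rewrite !mnactE !ss; split=> //; by left.
have [h5|[ep eq]] := adjt_lt hk pq.
  left; exists (adjt k p), (adjt k q); rewrite !mnactE !ss; split=> //; by right.
right; apply/mnmP => r; rewrite mnactE.
have [->|rp] := eqVneq r p; first by rewrite ep adjtL -eq -ep h4.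
have [->|rq] := eqVneq r q; first by rewrite {1}eq adjtR -ep; lia.
by rewrite /adjt -eq -ep tpermD ?h3 // eq_sym.
Qed.

(** Triangularity of the intertwiner: if p is supported below [a], then both p and s_k p are
    supported below s_k a. *)
Lemma below_adjt k a b : (k.+1 < N)%N -> (a k < a (succo k))%N -> below a b ->
  below (mnact (adjt k) a) b /\ below (mnact (adjt k) a) (mnact (adjt k) b).
Proof.
move=> hk ak; have vk : succo k = k.+1 :> nat := val_succo hk.
elim=> [|{}b c _ [IH1 IH2] mvc].
  split; last exact: BelowRefl.
  apply: (BelowStep (BelowRefl _)); exists k, (succo k).
  rewrite !mnactE adjtL adjtR; split=> //; first by rewrite addnC.
    by move=> r rk rs; rewrite mnactE /adjt tpermD // eq_sym.
  by right; rewrite vk.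
split; first exact: BelowStep IH1 mvc.
case: (mv_adjt hk mvc) => [h|->//]; exact: BelowStep IH2 h.
Qed.

Lemma bigD2_nat (F : 'I_N -> nat) p q : p != q ->
  (\sum_i F i = F p + F q + \sum_(i | (i != p) && (i != q)) F i)%N.
Proof. by move=> pq; rewrite (bigD1 p) //= (bigD1 q) ?(eq_sym q) //= addnA. Qed.

Lemma mv_neq p q b : (b q < b p)%N -> p != q.
Proof. by move=> h; apply/eqP=> e; rewrite e ltnn in h. Qed.

Lemma mv_mdeg c b : mv c b -> mdeg c = mdeg b.
Proof.
move=> [p [q [h1 h2 h3 _]]]; rewrite !mdegE !(@bigD2_nat _ p q) ?(mv_neq h1) // h2.
by congr (_ + _)%N; apply: eq_bigr => i /andP[ip iq]; rewrite h3.
Qed.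

Lemma below_mdeg a b : below a b -> mdeg b = mdeg a.
Proof. by elim=> // {}b c _ <- /mv_mdeg. Qed.

(** A potential lowered by every move. Bringing two values closer lowers the squares, whose weight N
    outweighs the linear term; exchanging a larger value to the right keeps the squares and lowers
    the linear term. *)
Definition mmeas a : nat := \sum_i (N * (a i * a i) + (N - i) * a i).

Lemma mv_mmeas c b : mv c b -> (mmeas c < mmeas b)%N.
Proof.
move=> [p [q [h1 h2 h3 h4]]]; rewrite /mmeas !(@bigD2_nat _ p q) ?(mv_neq h1) //.
rewrite [X in (_ + X < _)%N](eq_bigr (fun i => N * (b i * b i) + (N - i) * b i)%N); last first.
  by move=> i /andP[ip iq]; rewrite h3.
rewrite ltn_add2r; have hp := ltn_ord p; have hq := ltn_ord q.
case: h4 => [h4|[h4 pq]]; last first.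
  have -> : c p = b q by lia.
  rewrite h4; move: (b p) (b q) h1 => x y h1.
  have -> : (N - q = N - p - (q - p))%N by lia.
  nia.
have [t ht] : exists t, c q = (b q + t.+1)%N by exists (c q - b q).-1; lia.
have [u hu] : exists u, b p = (c q + u.+1)%N by exists (b p - c q).-1; lia.
have -> : c p = (b q + u.+1)%N by lia.
rewrite ht hu ht; move: (b q) => y {h1 h2 h3 h4 ht hu}.
have [P hP] : exists P, P = (N - p)%N by exists (N - p)%N.
have [Q hQ] : exists Q, Q = (N - q)%N by exists (N - q)%N.
rewrite -hP -hQ.
have : (P <= N)%N by lia.
have : (Q <= N)%N by lia.
have : (0 < P)%N by lia.
move: (nat_of_ord p) (nat_of_ord q) hp hq hP hQ => *.
have : (Q * t.+1 <= N * t.+1)%N by rewrite leq_mul2r; lia.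
nia.
Qed.

Lemma below_mmeas a b : below a b -> b = a \/ (mmeas b < mmeas a)%N.
Proof.
elim; first by left.
move=> {}b c _ IH /mv_mmeas h; right; case: IH => [<-//|]; exact: ltn_trans.
Qed.

Lemma psum_mseq a n : (n <= N)%N -> psum (mseq a) n = \sum_(i < N | (i < n)%N) a i.
Proof.
move=> hn; have sz : size (mseq a) = N by rewrite size_map size_enum_ord.
rewrite /psum sumnE (big_nth 0%N) size_takel ?sz // big_mkord.
rewrite (big_ord_widen N (fun x => nth 0%N (take n (mseq a)) x)) //.
apply: eq_bigr => i hi; rewrite nth_take // (nth_map i 0%N) ?size_enum_ord //.
by rewrite nth_ord_enum.
Qed.

Lemma psum_inj (s t : seq nat) : size s = N -> size t = N ->
  (forall k : 'I_N, psum s k.+1 = psum t k.+1) -> s = t.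
Proof.
move=> hs ht h; apply: (@eq_from_nth _ 0%N); rewrite ?hs ?ht // => i hi.
have := h (Ordinal hi); rewrite /psum /= !(take_nth 0%N) ?hs ?ht // !sumn_rcons.
case: i hi => [|i] hi; first by rewrite !take0 !add0n.
have hi' : (i < N)%N by lia.
by have := h (Ordinal hi'); rewrite /psum /= => ->; lia.
Qed.

Lemma dom_lt_trans (s t u : seq nat) : size s = N -> size t = N ->
  dom_lt N s t -> dom_lt N t u -> dom_lt N s u.
Proof.
move=> hs ht /andP[/forallP h1 n1] /andP[/forallP h2 n2]; apply/andP; split.
  by apply/forallP=> k; exact: leq_trans (h1 k) (h2 k).
apply/eqP=> e; case/eqP: n1; apply: psum_inj => // k.
by apply/eqP; rewrite eqn_leq h1 /= e h2.
Qed.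

Lemma size_mseq a : size (mseq a) = N.
Proof. by rewrite size_map size_enum_ord. Qed.

Lemma size_mplus a : size (mplus a) = N.
Proof. by rewrite size_sort size_mseq. Qed.

Lemma jack_lt_trans a b c : jack_lt c b -> jack_lt b a -> jack_lt c a.
Proof.
rewrite /jack_lt => /andP[/eqP -> h1] /andP[-> h2] /=.
case/orP: h1 => [h1|/andP[/eqP -> h1]]; case/orP: h2 => [h2|/andP[/eqP e h2]].
- by rewrite (dom_lt_trans _ _ h1 h2) // size_mplus.
- by rewrite -e h1.
- by rewrite h2.
- by rewrite e eqxx (dom_lt_trans _ _ h1 h2) ?orbT // size_mseq.
Qed.

(* The sum of the k largest terms of s is the minimum over x of k x + sum (s_i - x)^+. *)
Lemma psum_le_excess (s : seq nat) n x :
  (psum s n <= n * x + \sum_(y <- s) (y - x))%N.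
Proof.
rewrite /psum; elim: s n => [|y s IH] [|n] //=.
rewrite big_cons; have := IH n; lia.
Qed.

Lemma psum_sorted_excess (s : seq nat) n : sorted geq s -> (n <= size s)%N ->
  psum s n = (n * nth 0%N s n + \sum_(y <- s) (y - nth 0%N s n))%N.
Proof.
move=> hs hn; set x := nth 0%N s n.
have geqT : transitive geq by move=> u v w /= h1 h2; exact: leq_trans h2 h1.
have mono (i j : nat) : (i <= j)%N -> (nth 0%N s j <= nth 0%N s i)%N.
  move=> ij; have [hj|hj] := ltnP j (size s); last by rewrite [X in (X <= _)%N]nth_default.
  apply: (sorted_leq_nth geqT (leqnn) 0%N hs) => //; rewrite inE //.
  exact: leq_ltn_trans ij hj.
have e1 (t : seq nat) : all (leq x) t -> sumn t = (size t * x + \sum_(y <- t) (y - x))%N.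
  elim: t => [|y t IH] /=; first by rewrite big_nil.
  by case/andP=> h /IH ->; rewrite big_cons; lia.
have e2 (t : seq nat) : all (geq x) t -> (\sum_(y <- t) (y - x) = 0)%N.
  move=> /allP h; rewrite big1_seq // => y /= /h /=; lia.
rewrite /psum -{2}(cat_take_drop n s) big_cat /= (e1 (take n s)) ?size_takel // ?(e2 (drop n s)) ?addn0 //.
  apply/(all_nthP 0%N) => i; rewrite size_drop => hi.
  by rewrite nth_drop /=; apply: (mono n (n + i)%N); exact: leq_addr.
apply/(all_nthP 0%N) => i; rewrite size_takel // => hi.
by rewrite nth_take //; apply: (mono i n); exact: ltnW.
Qed.

Lemma sum_mplus (F : nat -> nat) a : (\sum_(y <- mplus a) F y = \sum_i F (a i))%N.
Proof.
have h : perm_eq (mplus a) (mseq a) by rewrite /mplus perm_sort.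
by rewrite (perm_big _ h) /= big_map big_enum.
Qed.

Lemma majorization a b : (forall x, \sum_i (b i - x) <= \sum_i (a i - x))%N ->
  forall k : 'I_N, (psum (mplus b) k.+1 <= psum (mplus a) k.+1)%N.
Proof.
move=> h k.
rewrite [leqRHS]psum_sorted_excess; last by rewrite size_mplus ltn_ord.
  apply: leq_trans (psum_le_excess _ _ (nth 0%N (mplus a) k.+1)) _.
  by rewrite leq_add2l !(sum_mplus (fun y => y - _)%N).
by apply: sort_sorted => x y /=; rewrite leq_total.
Qed.

Lemma mplus_mnact (w : {perm 'I_N}) a : mplus (mnact w a) = mplus a.
Proof.
apply/perm_sortP.
- by move=> x y /=; exact: leq_total.
- by move=> x y z /= h1 h2; exact: leq_trans h2 h1.
- by move=> x y /=; rewrite andbC => /anti_leq.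
have -> : mseq (mnact w a) = [seq a i | i <- [seq w i | i <- enum 'I_N]].
  by rewrite -map_comp; apply: eq_map => i /=; rewrite mnactE.
apply: perm_map; apply: uniq_perm; rewrite ?enum_uniq //.
  by rewrite map_inj_uniq ?enum_uniq //; exact: perm_inj.
move=> i; rewrite mem_enum; apply/mapP; exists (w^-1 i)%g; rewrite ?mem_enum //.
by rewrite permKV.
Qed.

(** Bringing two values closer lowers the sorted partial sums weakly, and the sum of squares shows
    that the sorted sequences differ. An exchange keeps the sorted sequence and lowers the partial
    sums of the exponent itself. *)
Lemma mv_jack_lt c b : mv c b -> jack_lt c b.
Proof.
move=> mvc; rewrite /jack_lt (mv_mdeg mvc) eqxx /=.
case: mvc => [p [q [h1 h2 h3 h4]]]; have pq := mv_neq h1.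
case: h4 => [h4|[h4 lpq]]; apply/orP; [left|right].
  apply/andP; split.
    apply/forallP=> k; apply: majorization => x.
    rewrite !(@bigD2_nat _ p q) // leq_add //; first lia.
    by apply: leq_sum => i /andP[ip iq]; rewrite h3.
  apply/eqP=> e; have := sum_mplus (fun y => y * y)%N c.
  rewrite e (sum_mplus (fun y => y * y)%N) !(@bigD2_nat _ p q) //.
  rewrite [X in (_ + X)%N = _](eq_bigr (fun i => c i * c i)%N); last first.
    by move=> i /andP[ip iq]; rewrite h3.
  move/addIn; nia.
have ec : c = mnact (tperm p q) b.
  apply/mnmP=> i; rewrite mnactE.
  have [->|ip] := eqVneq i p; first by rewrite tpermL; lia.
  have [->|iq] := eqVneq i q; first by rewrite tpermR.
  by rewrite tpermD ?h3 // eq_sym.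
rewrite [X in mplus X == _]ec mplus_mnact eqxx /=; apply/andP; split.
  apply/forallP=> k; rewrite !psum_mseq // big_mkcond [leqRHS]big_mkcond /=.
  rewrite !(@bigD2_nat _ p q) // leq_add //.
    by rewrite h4; do 2!case: ifP; lia.
  by apply: leq_sum => i /andP[ip iq]; rewrite h3.
apply/eqP=> e; have := congr1 (fun s => nth 0%N s p) e.
rewrite !(nth_map p 0%N) ?size_enum_ord // nth_ord_enum; lia.
Qed.

Lemma below_jack_lt a b : below a b -> b = a \/ jack_lt b a.
Proof.
elim; first by left.
move=> {}b c _ IH /mv_jack_lt h; right; case: IH => [<-//|h']; exact: jack_lt_trans h h'.
Qed.

Section Affine.
Variables (cyc : {perm 'I_N}) (first last : 'I_N).
Hypothesis val_first : first = 0%N :> nat.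
Hypothesis val_last : last.+1 = N.
Hypothesis cyc_first : cyc first = last.
Hypothesis cyc_succ : forall i : 'I_N, (i.+1 < N)%N -> cyc (succo i) = i.

(** The map (a_1, ..., a_N) -> (a_2, ..., a_N, a_1 + 1): the exponent of x_N p(xw) when p = x^a. *)
Definition affm a : 'X_{1..N} := (mnact cyc^-1 a + U_(last))%MM.

Lemma affmE a i : affm a (cyc i) = (a i + (i == first))%N.
Proof.
rewrite mnmDE mnactE permK mnm1E; congr (_ + nat_of_bool _)%N.
by rewrite -cyc_first (inj_eq perm_inj) eq_sym.
Qed.

Lemma cyc_pred i : i != first -> (cyc i).+1 = i :> nat.
Proof.
rewrite -val_eqE /= val_first => i0; have hi := ltn_ord i.
have hj : (i.-1.+1 < N)%N by lia.
have -> : i = succo (Ordinal (ltnW hj)) by apply: val_inj; rewrite val_succo //=; lia.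
by rewrite cyc_succ // [RHS]val_succo.
Qed.

Lemma mv_affm b c : mv c b -> mv (affm c) (affm b).
Proof.
move=> [p [q [h1 h2 h3 h4]]]; have pq := mv_neq h1.
exists (cyc p), (cyc q); rewrite !affmE.
have h3' r : r != cyc p -> r != cyc q -> affm c r = affm b r.
  rewrite -(permKV cyc r) !(inj_eq perm_inj) !affmE => rp rq; by rewrite h3.
have [ep|np] := eqVneq p first.
  have nq : (q == first) = false by apply/eqP=> e; rewrite ep e eqxx in pq.
  rewrite nq /=; split=> //; try lia.
(* The value at [q] gains one and may now equal the old value at [p]. Since [q] has become the last
   position, the move is then an exchange to the right, which [mv] allows. *)
have [eq|nq] := eqVneq q first.
  have vp := cyc_pred np.
  have vq : cyc q = last by rewrite eq.
  have hl : (cyc p < cyc q)%N by rewrite vq; have := ltn_ord p; lia.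
  case: h4 => [h4|[_ h4]]; last by rewrite eq val_first in h4.
  split=> //=; try lia.
have vp := cyc_pred np; have vq := cyc_pred nq.
split=> //=; try lia.
Qed.

Lemma below_affm a b : below a b -> below (affm a) (affm b).
Proof. by elim=> [|{}b c _ IH /mv_affm h]; [exact: BelowRefl | exact: BelowStep IH h]. Qed.

End Affine.

(** The total order counted by [rank]: larger values first, ties broken by position. *)
Definition bef a j i := (a i < a j)%N || ((a j == a i) && (j <= i)%N).

Lemma rankE a i : rank a i = #|[pred j | bef a j i]|.
Proof.
have E (P : pred 'I_N) : #|[pred j | P j]| = (\sum_j P j)%N.
  by rewrite -sum1_card big_mkcond; apply: eq_bigr => j _; rewrite inE; case: (P j).
rewrite /rank !E -big_split; apply: eq_bigr => j _ /=.
by rewrite /bef [(j <= i)%N && _]andbC; case: (ltngtP (a i) (a j)) => //= _; case: leqP.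
Qed.

Lemma bef_refl a i : bef a i i. Proof. by rewrite /bef eqxx leqnn orbT. Qed.

Lemma bef_trans a : transitive (bef a).
Proof. by move=> j i k; rewrite /bef; lia. Qed.

Lemma bef_anti a i j : bef a i j -> bef a j i -> i = j.
Proof. by rewrite /bef => h1 h2; apply: val_inj => /=; lia. Qed.

Lemma bef_total a i j : bef a i j || bef a j i.
Proof. by rewrite /bef; lia. Qed.

Lemma rank_lt a i j : bef a i j -> i != j -> (rank a i < rank a j)%N.
Proof.
move=> ij ne; rewrite !rankE; apply: proper_card; apply/properP; split.
  by apply/subsetP=> k; rewrite !inE => ki; apply: bef_trans ki ij.
exists j; rewrite !inE ?bef_refl //.
by apply/negP => ji; case/eqP: ne; exact: bef_anti ij ji.
Qed.

Lemma rank_inj a : injective (rank a).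
Proof.
move=> i j e; apply/eqP/negPn/negP => ne.
case/orP: (bef_total a i j) => h; have := rank_lt h.
  by rewrite ne e ltnn => /(_ isT).
by rewrite eq_sym ne e ltnn => /(_ isT).
Qed.

Lemma rpermE a i : (rperm a i).+1 = rank a i.
Proof.
have rk_gt0 k : (0 < rank a k)%N by rewrite rankE; apply/card_gt0P; exists k; rewrite inE bef_refl.
have rk_le k : ((rank a k).-1 < N)%N.
  have : (rank a k <= N)%N by rewrite rankE -[leqRHS]card_ord max_card.
  by have := rk_gt0 k; lia.
have inj : injective (fun k => Ordinal (rk_le k)).
  move=> k l /(congr1 val) /= e; apply: (@rank_inj a).
  by have := rk_gt0 k; have := rk_gt0 l; lia.
rewrite /rperm; case: pickP => [s /forallP/(_ i)/eqP //|/(_ (perm inj))].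
by move/negP; case; apply/forallP=> k; rewrite permE /= prednK.
Qed.

Lemma rperm_uniq a (s : {perm 'I_N}) : (forall i, (s i).+1 = rank a i) -> rperm a = s.
Proof. by move=> h; apply/permP=> i; apply: val_inj; have := rpermE a i; rewrite -h => -[]. Qed.

Lemma rank_mono a b (w : {perm 'I_N}) :
  (forall i j, bef b (w j) (w i) = bef a j i) -> rperm a = (w * rperm b)%g.
Proof.
move=> h; apply: rperm_uniq => i; rewrite permM rpermE !rankE.
rewrite -!sum1_card (reindex_inj (@perm_inj _ w)) /=.
by apply: eq_bigl => j; rewrite !inE h.
Qed.

Lemma rperm_adjt a k : (k.+1 < N)%N -> a k != a (succo k) ->
  rperm (mnact (adjt k) a) = (adjt k * rperm a)%g.
Proof.
move=> hk ne; have vk : succo k = k.+1 :> nat := val_succo hk.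
apply: rank_mono => i j; rewrite /bef !mnactE; congr (_ || _).
case: eqP => //= e; rewrite [LHS]leqNgt [RHS]leqNgt; congr (~~ _).
have E u v : a (adjt k u) = a (adjt k v) -> (u < v)%N -> (adjt k u < adjt k v)%N.
  move=> h uv; case: (adjt_lt hk uv) => // -[e1 e2].
  by move: h; rewrite e1 e2 adjtL adjtR => h; rewrite h eqxx in ne.
apply/idP/idP => h; last by apply: E.
have : (adjt k (adjt k i) < adjt k (adjt k j))%N.
  case: (adjt_lt hk h) => // -[e1 e2].
  by move: e; rewrite e1 e2 => e; rewrite e eqxx in ne.
by rewrite -!permM adjtK !perm1.
Qed.

Lemma rperm_eq a k : (k.+1 < N)%N -> a k = a (succo k) ->
  ((rperm a k).+1 < N)%N /\ rperm a (succo k) = succo (rperm a k).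
Proof.
move=> hk e; have vk : succo k = k.+1 :> nat := val_succo hk.
have h : rperm a (succo k) = (rperm a k).+1 :> nat.
  apply: succn_inj; rewrite !rpermE !rankE.
  rewrite [LHS](cardD1 (succo k)) inE bef_refl add1n; congr _.+1.
  apply: eq_card => j; rewrite !inE /bef -e -val_eqE /= vk.
  have : nat_of_ord j <> k.+1 \/ a j = a k.
    have [h|] := eqVneq j (succo k); first by right; rewrite h.
    by rewrite -val_eqE /= vk; left; apply/eqP.
  lia.
have hr : ((rperm a k).+1 < N)%N by rewrite -h ltn_ord.
by split=> //; apply: val_inj; rewrite [RHS]val_succo.
Qed.

Lemma rperm_eq_comm a k : (k.+1 < N)%N -> a k = a (succo k) ->
  (adjt k * rperm a = rperm a * adjt (rperm a k))%g.
Proof.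
move=> hk e; have [h1 h2] := rperm_eq hk e.
apply/permP=> i; rewrite !permM.
have [->|ik] := eqVneq i k; first by rewrite !adjtL h2.
have [->|isk] := eqVneq i (succo k); first by rewrite adjtR h2 adjtR.
by rewrite /adjt !tpermD // 1?eq_sym // -?h2 (inj_eq perm_inj) // eq_sym.
Qed.

Lemma rperm0 : rperm (0%MM : 'X_{1..N}) = 1%g.
Proof.
apply: rperm_uniq => i; rewrite perm1 rankE -sum1_card.
rewrite (eq_bigl (fun j : 'I_N => (j < i.+1)%N)); last by move=> j; rewrite inE /bef !mnm0E eqxx.
by rewrite -(big_ord_widen N (fun _ => 1%N)) ?ltn_ord // sum1_card card_ord.
Qed.

Section AffineRank.
Variables (cyc : {perm 'I_N}) (first last : 'I_N).
Hypothesis val_first : first = 0%N :> nat.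
Hypothesis val_last : last.+1 = N.
Hypothesis cyc_first : cyc first = last.
Hypothesis cyc_succ : forall i : 'I_N, (i.+1 < N)%N -> cyc (succo i) = i.

(** The affine step preserves the sorting order. The first entry preceded its equals by position and
    now exceeds them; those larger by one now tie with it and still precede it by position. *)
Lemma rperm_affm a : rperm a = (cyc * rperm (affm cyc last a))%g.
Proof.
apply: rank_mono => i j; rewrite /bef !(affmE cyc_first).
have [->|ni] := eqVneq i first; have [->|nj] := eqVneq j first; rewrite ?addn0 //=.
- by rewrite !eqxx !leqnn !orbT.
- have := cyc_pred val_first val_last cyc_succ nj; have := ltn_ord j; rewrite val_first cyc_first.
  by move: nj; rewrite -val_eqE /= val_first; lia.
- have := cyc_pred val_first val_last cyc_succ ni; have := ltn_ord i; rewrite val_first cyc_first.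
  by move: ni; rewrite -val_eqE /= val_first; lia.
- have := cyc_pred val_first val_last cyc_succ ni; have := cyc_pred val_first val_last cyc_succ nj.
  lia.
Qed.

End AffineRank.

(** If the last entry is positive, undoing an affine step lowers the degree. Otherwise undoing a
    descent lowers the weighted sum [g]. With neither possible the exponent increases weakly up to a
    last entry 0, hence is 0. *)
Lemma exponent_ind (cyc : {perm 'I_N}) (last : 'I_N) (P : 'X_{1..N} -> Prop) :
  last.+1 = N -> P 0%MM ->
  (forall a, P a -> P (affm cyc last a)) ->
  (forall a k, (k.+1 < N)%N -> (a k < a (succo k))%N -> P a -> P (mnact (adjt k) a)) ->
  forall a, P a.
Proof.
move=> val_last P0 PA PS a.
move: {2}(mdeg a).+1 (ltnSn (mdeg a)) => d; elim: d a => // d IHd a.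
pose g (c : 'X_{1..N}) := (\sum_(i < N) (N - i) * c i)%N.
move: {2}(g a).+1 (ltnSn (g a)) => n; elim: n a => // n IHn a hg hd.
have [->//|a0] := eqVneq a 0%MM.
have [al|al] := posnP (a last); last first.
  pose a' := mnact cyc (a - U_(last))%MM.
  have -> : a = affm cyc last a'.
    rewrite /affm mnact_mnact mulVg mnact1; apply/mnmP=> i; rewrite mnmDE mnmBE mnm1E.
    by case: eqP => [<-|_] /=; [rewrite subnK | rewrite subn0 addn0].
  apply: PA; apply: IHd; rewrite mdeg_mnact.
  have : (mdeg (a - U_(last)) + 1 = mdeg a)%N.
    rewrite -(mdeg1 last) -mdegD; congr mdeg; apply/mnmP=> i; rewrite mnmDE mnmBE mnm1E.
    by case: eqP => [<-|_] /=; [rewrite subnK | rewrite subn0 addn0].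
  lia.
case: (pickP (fun k : 'I_N => (k.+1 < N)%N && (a (succo k) < a k)%N)) => [k /andP[hk hak]|nd].
  have vk : succo k = k.+1 :> nat := val_succo hk.
  rewrite -[a](mnactK k); apply: PS => //; first by rewrite !mnactE adjtL adjtR.
  apply: IHn; last by rewrite mdeg_mnact.
  rewrite -ltnS; apply: leq_trans hg; rewrite ltnS /g.
  rewrite !(@bigD2_nat _ k (succo k)) ?succo_inj // !mnactE adjtL adjtR.
  rewrite [X in (_ + X < _)%N](eq_bigr (fun i => (N - i) * a i)%N); last first.
    by move=> i /andP[i1 i2]; rewrite mnactE /adjt tpermD // eq_sym.
  rewrite ltn_add2r vk; move: hak; move: (a k) (a (succo k)) => x y xy.
  have -> : (N - k = (N - k.+1).+1)%N by lia.
  by rewrite !mulSn; nia.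
case/eqP: a0; apply/mnmP=> i; rewrite mnm0E.
have mono m : forall (hm : (m < N)%N), (a (Ordinal hm) <= a last)%N.
  move: {2}(N - m)%N (erefl (N - m)%N) => e; elim: e m => [|e IH] m he hm; first by lia.
  have [h|h] := ltnP m.+1 N; last first.
    by rewrite (_ : Ordinal hm = last) //; apply: val_inj => /=; lia.
  have := nd (Ordinal hm); rewrite /= h /= => /negbT; rewrite -leqNgt => h1.
  apply: leq_trans h1 _.
  have -> : succo (Ordinal hm) = Ordinal h by apply: val_inj; rewrite val_succo.
  by apply: IH; lia.
case: i => m hm; have := mono m hm; lia.
Qed.

End Exponents.


(** * Nonsymmetric Jack polynomials and the torus form *)

Section CyclicShift.
Variables (N : nat) (N0 : (0 < N)%N).

Definition ocyc : {perm 'I_N} := perm (@ord_pred_inj N).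
Definition ofirst : 'I_N := Ordinal N0.
Definition olast : 'I_N := ord_pred ofirst.

Lemma olastE : olast.+1 = N.
Proof. by rewrite /= add0n modn_small prednK. Qed.
Lemma ocyc_first : ocyc ofirst = olast. Proof. by rewrite permE. Qed.
Lemma ocyc_succ (i : 'I_N) : (i.+1 < N)%N -> ocyc (succo i) = i.
Proof.
move=> hi; rewrite permE; apply: val_inj => /=.
rewrite [nat_of_ord (succo i)]val_succo // addSn /= modnDr modn_small //.
Qed.

End CyclicShift.

(** * Construction, basis property and uniqueness of the Jack polynomials *)

Section JackPolynomials.
Variables (K : fieldType) (N d : nat) (N0 : (0 < N)%N).
Variables (rho : {perm 'I_N} -> 'M[K]_d) (kc : K).
Hypothesis rho1 : rho 1%g = 1%:M.
Hypothesis rhoM : forall s t, rho (s * t)%g = rho t *m rho s.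
Variables (I : finType) (ev : I -> 'cV[K]_d) (ct : I -> 'I_N -> int).
Hypothesis jmE : forall (T : I) (i : 'I_N),
  (\sum_(j < N | (i < j)%N) rho (tperm i j)) *m ev T = (ct T i)%:~R *: ev T.
Hypothesis ev_free : forall c : I -> K, \sum_T c T *: ev T = 0 -> forall T, c T = 0.
Hypothesis ev_span : forall v, exists c : I -> K, v = \sum_T c T *: ev T.
Hypothesis nondeg : forall (m : int) (T : I) (i : 'I_N) (T' : I) (j : 'I_N),
  m%:~R + kc * (ct T i - ct T' j)%:~R = 0 -> m = 0.

Local Notation PN := {mpoly K[N]}.
Local Notation V := 'cV[PN]_d.
Local Notation act := (@vact K N d rho).
Local Notation U := (@cherednik K N d rho kc).
Local Notation cyc := (ocyc N).
Local Notation first := (ofirst N0).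
Local Notation last := (olast N0).

Implicit Types (m a b : 'X_{1..N}) (i j k : 'I_N) (p q : V) (T : I) (w : {perm 'I_N}).

Definition cf : 'X_{1..N} -> V -> 'cV[K]_d := locked (fun m p => map_mx (fun r : PN => r@_m) p).
Definition cmul : K -> V -> V := locked (fun c p => smul c%:MP p).
Definition mulX : 'I_N -> V -> V := locked (fun i p => smul 'X_i p).

Lemma cfE m p : cf m p = map_mx (fun r : PN => r@_m) p. Proof. by rewrite /cf -lock. Qed.
Lemma cmulE c p : cmul c p = smul c%:MP p. Proof. by rewrite /cmul -lock. Qed.
Lemma mulXE i p : mulX i p = smul 'X_i p. Proof. by rewrite /mulX -lock. Qed.

Lemma cf_eq p q : (forall m, cf m p = cf m q) -> p = q.
Proof.
move=> h; apply/colP=> a; apply/mpolyP=> m.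
by have /colP/(_ a) := h m; rewrite !cfE !mxE.
Qed.
Lemma cfD m p q : cf m (p + q) = cf m p + cf m q.
Proof. by rewrite !cfE; apply/colP=> a; rewrite !mxE mcoeffD. Qed.
Lemma cfN m p : cf m (- p) = - cf m p.
Proof. by rewrite !cfE; apply/colP=> a; rewrite !mxE mcoeffN. Qed.
Lemma cf0 m : cf m 0 = 0.
Proof. by rewrite cfE; apply/colP=> a; rewrite !mxE mcoeff0. Qed.
Lemma cfC m c p : cf m (cmul c p) = c *: cf m p.
Proof. by rewrite cmulE smulE !cfE; apply/colP=> a; rewrite !mxE mcoeffCM. Qed.
Lemma cf_sum m (J : Type) (r : seq J) (P : pred J) (F : J -> V) :
  cf m (\sum_(i <- r | P i) F i) = \sum_(i <- r | P i) cf m (F i).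
Proof. by apply: (big_morph (cf m)); [exact: cfD | exact: cf0]. Qed.
Lemma cf_act m w p : cf m (act w p) = rho w *m cf (mnact w m) p.
Proof.
rewrite vactE tmulE gpmE !cfE; apply/colP=> a; rewrite !mxE raddf_sum /=.
by apply: eq_bigr => b _; rewrite !mxE mcoeffCM msym_coef.
Qed.
Lemma cfX m i p : cf (m + U_(i))%MM (mulX i p) = cf m p.
Proof.
rewrite mulXE smulE !cfE; apply/colP=> a; rewrite !mxE.
by rewrite mulrC addmC mcoeffMX.
Qed.
Lemma cfX0 m i p : m i = 0%N -> cf m (mulX i p) = 0.
Proof.
move=> mi; rewrite mulXE smulE !cfE; apply/colP=> a; rewrite !mxE.
apply/eqP; rewrite mcoeff_eq0; apply/negP => /msuppM_le /allpairsP[[u v] /= [hu _ e]].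
move: hu; rewrite msuppX inE => /eqP hu.
by move: mi; rewrite e hu mnmDE mnm1E eqxx.
Qed.

Ltac lincomb := let m := fresh in let x := fresh in
  apply: cf_eq => m; rewrite ?(cfD, cfN, cfC, cf0); apply/colP => x; rewrite !mxE.

Lemma cmulDr c p q : cmul c (p + q) = cmul c p + cmul c q. Proof. by lincomb; ring. Qed.
Lemma cmulDl (x y : K) p : cmul (x + y) p = cmul x p + cmul y p. Proof. by lincomb; ring. Qed.
Lemma cmulA (x y : K) p : cmul x (cmul y p) = cmul (x * y) p. Proof. by lincomb; ring. Qed.
Lemma cmul1 p : cmul 1 p = p. Proof. by lincomb; ring. Qed.
Lemma cmul0l p : cmul 0 p = 0. Proof. by lincomb; ring. Qed.
Lemma cmul0r c : cmul c 0 = 0. Proof. by apply: cf_eq => m; rewrite cfC !cf0 scaler0. Qed.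
Lemma cmul_sum c (J : Type) (r : seq J) (P : pred J) (F : J -> V) :
  cmul c (\sum_(i <- r | P i) F i) = \sum_(i <- r | P i) cmul c (F i).
Proof. by apply: (big_morph (cmul c)); [exact: cmulDr | exact: cmul0r]. Qed.

Lemma act1 p : act 1%g p = p. Proof. exact: vact1. Qed.
Lemma actM s t p : act s (act t p) = act (t * s)%g p. Proof. exact: vactM. Qed.
Lemma actD w p q : act w (p + q) = act w p + act w q. Proof. exact: vactD. Qed.
Lemma actC w c p : act w (cmul c p) = cmul c (act w p).
Proof. by rewrite !cmulE vactC. Qed.
Lemma actX w i p : act w (mulX i p) = mulX (w i) (act w p).
Proof. by rewrite !mulXE vactX. Qed.
Lemma mulXD i p q : mulX i (p + q) = mulX i p + mulX i q.
Proof. by rewrite !mulXE smulDr. Qed.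
Lemma mulXC i c p : mulX i (cmul c p) = cmul c (mulX i p).
Proof. by rewrite !mulXE !cmulE smulC. Qed.
Lemma mulXX i j p : mulX i (mulX j p) = mulX j (mulX i p).
Proof. by rewrite !mulXE smulC. Qed.

Let E := @ediff K N d rho.
Let der := @vder K N d.
Let kapD := cmulDr kc.
Let Xkap i p := mulXC i kc p.
Let actkap w p := actC w kc p.
Let actE w i j p (ij : i != j) : act w (E i j p) = E (w i) (w j) (act w p).
Proof. exact: ediff_act. Qed.
Let EX_far i j k p : i != j -> k != i -> k != j -> E i j (mulX k p) = mulX k (E i j p).
Proof. by rewrite !mulXE; exact: ediffX_far. Qed.
Let EXl i j p : i != j -> E i j (mulX i p) = mulX i (E i j p) + act (tperm i j) p.
Proof. by rewrite !mulXE; exact: ediffXl. Qed.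
Let EXr i j p : i != j -> E i j (mulX j p) = mulX j (E i j p) - act (tperm i j) p.
Proof. by rewrite !mulXE; exact: ediffXr. Qed.
Let derX i k p : der i (mulX k p) = mulX k (der i p) + (if k == i then p else 0).
Proof. by rewrite !mulXE; exact: vderX. Qed.
Let actder w i p : act w (der i p) = der (w i) (act w p).
Proof. exact: vact_vder. Qed.

Lemma UE i p : U i p = cher act mulX E der (cmul kc) i p.
Proof.
rewrite cherednikE /cher /dunk !cmulE; congr (_ + smul _ _ - _).
  by rewrite mulXE.
by apply: eq_bigr => j _; rewrite mulXE.
Qed.

Lemma U_adjt (i : 'I_N) p : (i.+1 < N)%N ->
  act (adjt i) (U i p) = U (succo i) (act (adjt i) p) + cmul kc p.
Proof. by move=> hi; rewrite !UE; apply: cher_adjt => //; [exact: act1 | exact: actM | exact: actD | exact: actX]. Qed.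

Lemma U_adjtS (i : 'I_N) p : (i.+1 < N)%N ->
  act (adjt i) (U (succo i) p) = U i (act (adjt i) p) - cmul kc p.
Proof. by move=> hi; rewrite !UE; apply: cher_adjtS => //; [exact: act1 | exact: actM | exact: actD | exact: actX]. Qed.

Lemma U_adjt_far (i j : 'I_N) p : (i.+1 < N)%N -> j != i -> j != succo i ->
  act (adjt i) (U j p) = U j (act (adjt i) p).
Proof. by move=> hi h1 h2; rewrite !UE; apply: cher_adjt_far => //; [exact: actM | exact: actD | exact: actX]. Qed.

Lemma U_affine (i : 'I_N) p : (i.+1 < N)%N ->
  U i (mulX last (act cyc p)) = mulX last (act cyc (U (succo i) p)).
Proof.
move=> hi; rewrite !UE; have vf : first = 0%N :> nat by [].
exact: (affine_inner actM actD kapD mulXD Xkap mulXX actX actkap actE EX_far EXr derX actder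
  vf (olastE N0) (ocyc_first N0) (@ocyc_succ N)).
Qed.

Lemma U_affine_last p :
  U last (mulX last (act cyc p)) = mulX last (act cyc (U first p + p)).
Proof.
rewrite !UE; have vf : first = 0%N :> nat by [].
exact: (affine_last actD kapD mulXD Xkap actX actkap actE EXl derX actder
  vf (olastE N0) (ocyc_first N0)).
Qed.

Lemma UD i p q : U i (p + q) = U i p + U i q.
Proof.
rewrite !cherednikE smulDr vderD.
rewrite (eq_bigr (fun j => ediff rho i j (smul 'X_i p) + ediff rho i j (smul 'X_i q))); last first.
  by move=> j ji; rewrite ediffD // eq_sym.
rewrite [X in _ - smul _ X](eq_bigr (fun j => act (tperm i j) p + act (tperm i j) q)); last first.
  by move=> j _; rewrite vactD.
by rewrite !big_split /= !smulDr opprD [X in X + _ = _]addrACA [LHS]addrACA.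
Qed.

Lemma UC i c p : U i (cmul c p) = cmul c (U i p).
Proof.
rewrite cmulE !cherednikE smulC vderC.
rewrite (eq_bigr (fun j => smul c%:MP (ediff rho i j (smul 'X_i p)))); last first.
  by move=> j ji; rewrite ediffC // eq_sym.
rewrite [X in _ - smul _ X](eq_bigr (fun j => smul c%:MP (act (tperm i j) p))); last first.
  by move=> j _; rewrite vactC.
by rewrite -!smul_sum ![smul kc%:MP (smul c%:MP _)]smulC -smulDr -smulBr cmulE.
Qed.

Lemma U0 i : U i 0 = 0.
Proof. by have := UC i 0 0; rewrite !cmul0l. Qed.

Lemma U_sum i (J : Type) (r : seq J) (P : pred J) (F : J -> V) :
  U i (\sum_(i <- r | P i) F i) = \sum_(j <- r | P j) U i (F j).
Proof. by apply: (big_morph (U i)); [exact: UD | exact: U0]. Qed.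

Definition spec (a : 'X_{1..N}) (T : I) (i : 'I_N) : K :=
  (a i).+1%:R + kc * (ct T (rperm a i))%:~R.

(** The conditions of [is_zeta] with [below] for the triangularity, since [below] is what the
    recursive construction preserves. *)
Definition isz a T p := [/\ cf a p = rho (rperm a)^-1 *m ev T,
  (forall b, cf b p != 0 -> below a b) & (forall i, U i p = cmul (spec a T i) p)].

Definition cst (v : 'cV[K]_d) : V := map_mx (fun c => c%:MP) v.

Lemma cf_cst m v : cf m (cst v) = (m == 0%MM)%:R *: v.
Proof. by rewrite cfE; apply/colP=> a; rewrite !mxE mcoeffC mulrC. Qed.

Lemma act_cst w v : act w (cst v) = cst (rho w *m v).
Proof.
apply: cf_eq => m; rewrite cf_act !cf_cst.
have -> : (mnact w m == 0%MM) = (m == 0%MM).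
  apply/eqP/eqP => [h|->]; last by apply/mnmP=> i; rewrite mnactE !mnm0E.
  by apply/mnmP=> i; rewrite mnm0E -(permKV w i) -mnactE h mnm0E.
by rewrite scalemxAr.
Qed.

(** On a constant the divided differences vanish and only the terms produced by the factor x_i
    survive. Subtracting the lower sum of U_i leaves 1 plus kappa times the Jucys-Murphy element. *)
Lemma isz0 T : isz 0%MM T (cst (ev T)).
Proof.
split=> [|b|i].
- by rewrite rperm0 invg1 rho1 mul1mx cf_cst eqxx scale1r.
- rewrite cf_cst; case: (b =P 0%MM) => [-> _|_]; first exact: BelowRefl.
  by rewrite scale0r eqxx.
have dX := derX i i (cst (ev T)); rewrite /der eqxx in dX.
rewrite cherednikE -mulXE dX.
have -> : vder i (cst (ev T)) = 0.
  by rewrite vderE; apply/colP=> a; rewrite !mxE mderivC.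
have E0 j : i != j -> ediff rho i j (cst (ev T)) = 0.
  move=> ij; apply: ediff_uniq => //; rewrite smul0 act_cst tmulE.
  apply/esym/eqP; rewrite subr_eq0; apply/eqP.
  by rewrite /cst /gpolyM map_mxM.
rewrite (eq_bigr (fun j => act (tperm i j) (cst (ev T)))); last first.
  move=> j ji; rewrite eq_sym in ji; have eX := EXl (cst (ev T)) ji.
  by rewrite [LHS]eX /E (E0 _ ji) mulXE smul0 add0r.
rewrite mulXE smul0 add0r -addrA -smulBr -!cmulE.
have -> : \sum_(j < N | j != i) act (tperm i j) (cst (ev T)) =
  \sum_(j < N | (i < j)%N) act (tperm i j) (cst (ev T)) +
  \sum_(j < N | (j < i)%N) act (tperm i j) (cst (ev T)).
  rewrite (bigID (fun j : 'I_N => (i < j)%N)) /=; congr (_ + _); apply: eq_bigl => j.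
    by rewrite -val_eqE /=; lia.
  by rewrite -val_eqE /=; lia.
rewrite addrK.
rewrite (eq_bigr _ (fun j _ => act_cst (tperm i j) (ev T))).
have -> : \sum_(j < N | (i < j)%N) cst (rho (tperm i j) *m ev T) =
   cst ((ct T i)%:~R *: ev T).
  rewrite -jmE mulmx_suml; apply: cf_eq => m; rewrite cf_sum cf_cst.
  by rewrite scaler_sumr; apply: eq_bigr => j _; rewrite cf_cst.
rewrite /spec rperm0 perm1 mnm0E.
apply: cf_eq => m; rewrite ?(cfD, cfC) !cf_cst; apply/colP => x; rewrite !mxE.
by ring.
Qed.

(** Content differences cannot compensate a nonzero integer, by [nondeg]. This keeps the
    denominators of the intertwiners away from 0. *)
Lemma spec_diff a T T' i j : spec a T i = spec a T' j -> a i = a j.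
Proof.
move=> h; have : ((a i)%:Z - (a j)%:Z)%:~R +
    kc * (ct T (rperm a i) - ct T' (rperm a j))%:~R = 0 :> K.
  by move/eqP: h; rewrite -subr_eq0 => /eqP <-; rewrite /spec !rmorphB /= -!pmulrn -!natr1; ring.
by move/nondeg; lia.
Qed.

Lemma spec_adjt a T k i : (k.+1 < N)%N -> a k != a (succo k) ->
  spec (mnact (adjt k) a) T i = spec a T (adjt k i).
Proof. by move=> hk h; rewrite /spec mnactE rperm_adjt // permM. Qed.

(** The intertwiner s_k + kappa / (xi(k+1) - xi(k)): the relations [U_adjt] and [U_adjtS] show that
    it exchanges the two eigenvalues, and the constant is forced by them. *)
Lemma isz_adjt a T p k : (k.+1 < N)%N -> (a k < a (succo k))%N -> isz a T p ->
  isz (mnact (adjt k) a) T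
    (act (adjt k) p + cmul (kc / (spec a T (succo k) - spec a T k)) p).
Proof.
move=> hk ha [h1 h2 h3].
have ne : a k != a (succo k) by lia.
have sne : spec a T (succo k) - spec a T k != 0.
  by rewrite subr_eq0; apply/eqP=> /spec_diff; lia.
set b := kc / _; have hb : b * (spec a T (succo k) - spec a T k) = kc by rewrite divfK.
split=> [|c|i].
- rewrite cfD cfC cf_act mnactK h1.
  have -> : cf (mnact (adjt k) a) p = 0.
    apply/eqP/negPn/negP => /h2 /below_mmeas[/(congr1 (fun m : 'X_{1..N} => m k))|].
      by rewrite mnactE adjtL => e; rewrite e eqxx in ne.
    have [_ /below_mmeas] := below_adjt hk ha (BelowRefl a).
    have [/below_mmeas + _] := below_adjt hk ha (BelowRefl a).
    case=> [e|hlt]; first by rewrite -e ltnn.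
    by move=> _ hlt'; have := ltn_trans hlt hlt'; rewrite ltnn.
  by rewrite scaler0 addr0 rperm_adjt // mulmxA -rhoM invMg /adjt tpermV.
- rewrite cfD cfC cf_act.
  have [hc|hc] := eqVneq (cf c p) 0.
    rewrite hc scaler0 addr0 => hn.
    have : cf (mnact (adjt k) c) p != 0.
      by apply: contraNneq hn => ->; rewrite mulmx0.
    by move/h2/(below_adjt hk ha) => [_]; rewrite mnactK.
  by move=> _; have [] := below_adjt hk ha (h2 _ hc).
rewrite spec_adjt // UD UC h3.
have [->|ik] := eqVneq i k.
  have := U_adjtS p hk; rewrite h3 actC => /eqP; rewrite eq_sym subr_eq => /eqP ->.
  rewrite adjtL -hb; move: (act (adjt k) p) => q; lincomb; ring.
have [->|isk] := eqVneq i (succo k).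
  have := U_adjt p hk; rewrite h3 actC => /eqP; rewrite -subr_eq => /eqP <-.
  rewrite adjtR -hb; move: (act (adjt k) p) => q; lincomb; ring.
rewrite -U_adjt_far // h3 actC /adjt tpermD 1?eq_sym //.
by move: (act _ p) => q; lincomb; ring.
Qed.

Lemma isz_affm a T p : isz a T p -> isz (affm cyc last a) T (mulX last (act cyc p)).
Proof.
have vl := olastE N0; have cF := ocyc_first N0; have cS := @ocyc_succ N.
have vf : first = 0%N :> nat by [].
move=> [h1 h2 h3]; split=> [|b|i].
- rewrite cfX cf_act mnact_mnact mulgV mnact1 h1 mulmxA -rhoM.
  by rewrite [in LHS](rperm_affm vf vl cF cS a) invMg mulgKV.
- have [b0|b0] := eqVneq (b last) 0%N; first by rewrite cfX0 ?eqxx.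
  have e : (b = (b - U_(last)) + U_(last))%MM.
    apply/mnmP=> i; rewrite mnmDE mnmBE mnm1E.
    by case: (last =P i) => [<-|_] /=; [rewrite subnK // lt0n | rewrite subn0 addn0].
  rewrite {1}e cfX cf_act => hn.
  have : cf (mnact cyc (b - U_(last))) p != 0.
    by apply: contraNneq hn => ->; rewrite mulmx0.
  move/h2/(below_affm vf vl cF cS); rewrite {2}/affm mnact_mnact mulVg mnact1.
  by rewrite -e.
have [il|il] := eqVneq i last.
  rewrite il U_affine_last h3.
  have -> : spec (affm cyc last a) T last = spec a T first + 1.
    have e1 : affm cyc last a last = (a first).+1.
      by have := affmE cF a first; rewrite cF eqxx addn1.
    have e2 : rperm (affm cyc last a) last = rperm a first.
      by rewrite (rperm_affm vf vl cF cS a) permM cF.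
    by rewrite /spec e1 e2 -[in LHS]natr1; ring.
  by rewrite !actD !mulXD !actC !mulXC; move: (mulX _ _) => q; lincomb; ring.
have hi : (i.+1 < N)%N.
  by move: il; rewrite -val_eqE /=; have := ltn_ord i; move: vl => /= vl; lia.
rewrite U_affine // h3 actC mulXC; congr (cmul _ _).
have e1 : affm cyc last a i = a (succo i).
  have := affmE cF a (succo i); rewrite (cS i hi) => ->.
  have -> : (succo i == first) = false by rewrite -val_eqE /= [nat_of_ord _]val_succo.
  by rewrite addn0.
have e2 : rperm (affm cyc last a) i = rperm a (succo i).
  by rewrite (rperm_affm vf vl cF cS a) permM (cS i hi).
by rewrite /spec e1 e2.
Qed.

Lemma isz_exists a T : exists p, isz a T p.
Proof.
apply: (@exponent_ind N cyc last (fun a => exists p, isz a T p) (olastE N0) _ _ _ a) => {a} [|a [p hp]|a k hk ha [p hp]].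
- by eexists; exact: isz0.
- by eexists; exact: isz_affm hp.
- by eexists; exact: isz_adjt hp.
Qed.

Definition jack a T : V := epsilon (inhabits 0) (isz a T).
Lemma ZP a T : isz a T (jack a T).
Proof. by apply: epsilon_spec; exact: isz_exists. Qed.

Lemma rhoVK (w : {perm 'I_N}) (v : 'cV[K]_d) : rho w *m v = 0 -> v = 0.
Proof.
move=> h; have : rho w^-1 *m (rho w *m v) = 0 by rewrite h mulmx0.
by rewrite mulmxA -rhoM mulgV rho1 mul1mx.
Qed.

Lemma cf_Z_combination a (c : I -> K) :
  cf a (\sum_T cmul (c T) (jack a T)) = rho (rperm a)^-1 *m (\sum_T c T *: ev T).
Proof.
rewrite cf_sum mulmx_sumr; apply: eq_bigr => T _.
by have [h _ _] := ZP a T; rewrite cfC h scalemxAr.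
Qed.

(** Take [a] of maximal [mmeas] among the exponents that occur. No other one reaches x^a by
    triangularity, so the coefficient of x^a is a relation between the independent vectors [ev]. *)
Lemma Z_free D (c : 'X_{1..N < D} -> I -> K) :
  \sum_(a : 'X_{1..N < D}) \sum_T cmul (c a T) (jack a T) = 0 -> forall x T, c x T = 0.
Proof.
move=> h a0 T0; apply/eqP/negPn/negP => n0.
pose P (x : 'X_{1..N < D}) := [exists T, c x T != 0].
have Pa0 : P a0 by apply/existsP; exists T0.
case: (@arg_maxnP _ a0 P (fun x => mmeas x) Pa0) => a Pa amax.
have : cf a (\sum_(a : 'X_{1..N < D}) \sum_T cmul (c a T) (jack a T)) = 0 by rewrite h cf0.
rewrite cf_sum (bigD1 a) //= [X in _ + X]big1 ?addr0; last first.
  move=> b ba; rewrite cf_sum big1 // => T _; rewrite cfC.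
  have [->|cb] := eqVneq (c b T) 0; first by rewrite scale0r.
  have Pb : P b by apply/existsP; exists T.
  have [->|hb] := eqVneq (cf a (jack b T)) 0; first by rewrite scaler0.
  have [_ /(_ _ hb) hba _] := ZP b T.
  case: (below_mmeas hba) => [e|hlt]; first by case/eqP: ba; apply: val_inj.
  by have /= := amax b Pb; rewrite leqNgt hlt.
rewrite cf_Z_combination => /rhoVK/ev_free c0.
by case/existsP: Pa => T; rewrite c0 eqxx.
Qed.

Definition mono (a : 'X_{1..N}) (v : 'cV[K]_d) : V := smul 'X_[a] (cst v).

Lemma cf_mono m a v : cf m (mono a v) = (m == a)%:R *: v.
Proof.
rewrite /mono smulE cfE; apply/colP=> x; rewrite !mxE mulrC mcoeffCM mcoeffX.
by rewrite mulrC eq_sym.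
Qed.

(** The predicate [Q] records which exponents are used. For a monomial these are the exponents of
    the same degree, whence the orthogonality of different degrees. *)
Definition inspan D (Q : pred 'X_{1..N}) (p : V) : Prop :=
  exists2 c : 'X_{1..N < D} -> I -> K, (forall (x : 'X_{1..N < D}) T, ~~ Q x -> c x T = 0)
    & p = \sum_(a : 'X_{1..N < D}) \sum_T cmul (c a T) (jack a T).

Lemma inspan0 D Q : inspan D Q 0.
Proof.
exists (fun _ _ => 0) => //; rewrite big1 // => a _; rewrite big1 // => T _.
by rewrite cmul0l.
Qed.

Lemma inspanD D Q p q : inspan D Q p -> inspan D Q q -> inspan D Q (p + q).
Proof.
case=> c hc -> [e he ->]; exists (fun x T => c x T + e x T).
  by move=> a T h; rewrite hc // he // addr0.
rewrite -big_split; apply: eq_bigr => a _; rewrite -big_split; apply: eq_bigr => T _.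
by rewrite cmulDl.
Qed.

Lemma inspanC D Q x p : inspan D Q p -> inspan D Q (cmul x p).
Proof.
case=> c hc ->; exists (fun y T => x * c y T).
  by move=> a T h; rewrite hc // mulr0.
by rewrite cmul_sum; apply: eq_bigr => a _; rewrite cmul_sum; apply: eq_bigr => T _; rewrite cmulA.
Qed.

Lemma inspan_sum D Q (J : Type) (r : seq J) (P : pred J) (F : J -> V) :
  (forall x, P x -> inspan D Q (F x)) -> inspan D Q (\sum_(j <- r | P j) F j).
Proof. by move=> h; apply: big_ind => //; [exact: inspan0 | exact: inspanD]. Qed.

Lemma inspanZ D (Q : pred 'X_{1..N}) a T : (mdeg a < D)%N -> Q a -> inspan D Q (jack a T).
Proof.
move=> ha Qa; pose b : 'X_{1..N < D} := BMultinom ha.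
exists (fun x S => ((x == b) && (S == T))%:R).
  move=> x S hx; case: (x =P b) => [e|//]; by rewrite e /= Qa in hx.
rewrite (bigD1 b) //= (bigD1 T) //= !eqxx cmul1 !big1 ?addr0 // => [x xb|S ST].
  by rewrite big1 // => S _; rewrite (negPf xb) cmul0l.
by rewrite (negPf ST) cmul0l.
Qed.

Lemma cf_expand D p : (forall a, cf a p != 0 -> (mdeg a < D)%N) ->
  p = \sum_(a : 'X_{1..N < D}) mono a (cf a p).
Proof.
move=> h; apply: cf_eq => m; rewrite cf_sum.
have [hm|hm] := ltnP (mdeg m) D.
  rewrite (bigD1 (BMultinom hm)) //= cf_mono eqxx scale1r big1 ?addr0 // => b hb.
  rewrite cf_mono; case: eqP => [e|_]; last by rewrite scale0r.
  by case/eqP: hb; apply: val_inj.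
rewrite big1; last first.
  move=> b _; rewrite cf_mono; case: eqP => [e|_]; last by rewrite scale0r.
  by move: hm; rewrite e leqNgt bmdeg.
by apply/eqP/negPn/negP => /h; rewrite ltnNge hm.
Qed.

(** Inversion of the triangular system by induction on [mmeas]: subtract the combination with the
    same coefficient at x^a; what remains is supported strictly below. *)
Lemma inspan_mono D a v : (mdeg a < D)%N -> inspan D [pred b | mdeg b == mdeg a] (mono a v).
Proof.
move: {2}(mmeas a).+1 (ltnSn (mmeas a)) => n; elim: n a v => // n IH a v hn hD.
have [c hc] := ev_span (rho (rperm a) *m v).
pose z := \sum_T cmul (c T) (jack a T).
have hz : cf a z = v.
  by rewrite cf_Z_combination -hc mulmxA -rhoM mulgV rho1 mul1mx.
have hs b : cf b z != 0 -> below a b.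
  move=> h; have : has (fun T => cf b (jack a T) != 0) (index_enum I).
    apply: contraNT h => /hasPn h0; rewrite cf_sum big1_seq // => T /= hT.
    by have := h0 T hT; rewrite negbK cfC => /eqP ->; rewrite scaler0.
  by case/hasP=> T _ hT; have [_ h2 _] := ZP a T; exact: h2.
have -> : mono a v = z + cmul (-1) (z - mono a v) by lincomb; ring.
apply: inspanD.
  by apply: inspan_sum => T _; apply: inspanC; apply: inspanZ => //=.
apply: inspanC; set q := z - _.
have hq b : cf b q != 0 -> below a b /\ b != a.
  rewrite cfD cfN cf_mono; case: (b =P a) => [->|_].
    by rewrite hz scale1r subrr eqxx.
  by rewrite scale0r subr0 => /hs.
have hqD b : cf b q != 0 -> (mdeg b < D)%N by case/hq => /below_mdeg ->.
rewrite (cf_expand hqD); apply: inspan_sum => b _.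
have [->|hb] := eqVneq (cf b q) 0.
  have -> : mono b 0 = 0 by apply: cf_eq => m; rewrite cf_mono cf0 scaler0.
  exact: inspan0.
have [hab nab] := hq _ hb; have e := below_mdeg hab.
have -> : [pred b0 | mdeg b0 == mdeg a] = [pred b0 | mdeg b0 == mdeg b] :> pred _.
  by rewrite e.
apply: IH; last by rewrite e.
case: (below_mmeas hab) => [e'|hlt]; first by rewrite e' eqxx in nab.
exact: leq_trans hlt hn.
Qed.

Lemma inspan_all D p : (forall a, cf a p != 0 -> (mdeg a < D)%N) -> inspan D predT p.
Proof.
move=> h; rewrite (cf_expand h); apply: inspan_sum => a _.
have [c hc ->] := inspan_mono (cf a p) (bmdeg a).
by exists c.
Qed.

Lemma cf_bounded p : exists D, forall a, cf a p != 0 -> (mdeg a < D)%N.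
Proof.
exists (\max_(x < d) msize (p x ord0)) => a h.
have : [exists x, cf a p x 0 != 0].
  rewrite -[_ != 0]negbK in h; apply: contraNT h; rewrite negb_exists => /forallP h.
  by rewrite negbK; apply/eqP/colP=> i; have := h i; rewrite negbK => /eqP ->; rewrite mxE.
case/existsP=> i; rewrite cfE mxE -mcoeff_msupp => /msize_mdeg_lt hi.
by apply: leq_trans hi _; apply: (leq_bigmax (F := fun x => msize (p x ord0))).
Qed.

(** The uniqueness principle. By [nondeg] the integer parts of the spectrum leave only the terms of
    exponent [a] in the expansion, and these are detected by the coefficient of x^a. The contents
    enter through an arbitrary [w], so that permuted spectra are covered. *)
Lemma eig_zero a T (w : 'I_N -> 'I_N) q : cf a q = 0 ->
  (forall i, U i q = cmul ((a i).+1%:R + kc * (ct T (w i))%:~R) q) -> q = 0.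
Proof.
move=> q0 hq; have [D hD] := cf_bounded q.
have [c _ e] := inspan_all hD.
have h i : \sum_(b : 'X_{1..N < D}) \sum_S
   cmul (c b S * (spec b S i - ((a i).+1%:R + kc * (ct T (w i))%:~R))) (jack b S) = 0.
  transitivity (U i q + cmul (-1) (cmul ((a i).+1%:R + kc * (ct T (w i))%:~R) q)); last first.
    by rewrite hq -[X in X + _]cmul1 cmulA cmulA -cmulDl mul1r mulN1r subrr cmul0l.
  rewrite e U_sum !cmul_sum -big_split; apply: eq_bigr => b _ /=.
  rewrite U_sum !cmul_sum -big_split; apply: eq_bigr => S _ /=.
  have [_ _ hz] := ZP b S; rewrite UC hz !cmulA -cmulDl; congr (cmul _ _); ring.
have hc (b : 'X_{1..N < D}) S : c b S != 0 -> val b = a.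
  move=> cb; apply/mnmP=> i; have /eqP := Z_free (h i) b S.
  rewrite mulf_eq0 (negPf cb) /= => /eqP hs.
  have : ((b i)%:Z - (a i)%:Z)%:~R + kc * (ct S (rperm b i) - ct T (w i))%:~R = 0 :> K.
    by rewrite -hs /spec !rmorphB /= -!pmulrn -!natr1; ring.
  by move/nondeg; lia.
have cz S (b : 'X_{1..N < D}) : c b S = 0.
  have [//|cb] := eqVneq (c b S) 0; have eb := hc _ _ cb.
  have : cf a q = rho (rperm a)^-1 *m (\sum_T c b T *: ev T).
    rewrite -cf_Z_combination e; congr (cf a _).
    rewrite (bigD1 b) //= eb [X in _ + X]big1 ?addr0 // => b' nb; rewrite big1 // => S' _.
    have [->|/hc e'] := eqVneq (c b' S') 0; first by rewrite cmul0l.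
    by case/eqP: nb; apply: val_inj; rewrite e' eb.
  by rewrite q0 => /esym/rhoVK/ev_free ->.
by rewrite e big1 // => b _; rewrite big1 // => S _; rewrite cz cmul0l.
Qed.

Lemma Z_uniq a T p : cf a p = rho (rperm a)^-1 *m ev T ->
  (forall i, U i p = cmul (spec a T i) p) -> p = jack a T.
Proof.
move=> h1 h2; have [z1 _ z2] := ZP a T.
have : p + cmul (-1) (jack a T) = 0.
  apply: (@eig_zero a T (rperm a)).
    by rewrite cfD cfC h1 z1 scaleN1r subrr.
  move=> i; rewrite UD UC h2 z2 -/(spec a T i) cmulDr !cmulA.
  by congr (_ + cmul _ _); ring.
by move/eqP; rewrite addr_eq0 => /eqP ->; lincomb; ring.
Qed.

Lemma Z_affm a T : jack (affm cyc last a) T = mulX last (act cyc (jack a T)).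
Proof. by have [h1 _ h3] := isz_affm (ZP a T); rewrite -(Z_uniq h1 h3). Qed.

Lemma Z_adjt a T k : (k.+1 < N)%N -> (a k < a (succo k))%N ->
  jack (mnact (adjt k) a) T =
    act (adjt k) (jack a T) + cmul (kc / (spec a T (succo k) - spec a T k)) (jack a T).
Proof. by move=> hk ha; have [h1 _ h3] := isz_adjt hk ha (ZP a T); rewrite -(Z_uniq h1 h3). Qed.

Lemma Z_cst T : jack 0%MM T = cst (ev T).
Proof. by have [h1 _ h3] := isz0 T; rewrite -(Z_uniq h1 h3). Qed.

(* When a_k = a_{k+1}, s_k acts on zeta_{a,T} as tau(s_j) acts on T, j = r_a(k). *)
Lemma Z_eq a T T' (be ga : K) k : (k.+1 < N)%N -> a k = a (succo k) ->
  rho (adjt (rperm a k)) *m ev T = be *: ev T + ga *: ev T' ->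
  be * (ct T (rperm a k) - ct T (succo (rperm a k)))%:~R = 1 ->
  (ga = 0 \/ forall i, ct T' i = ct T (adjt (rperm a k) i)) ->
  act (adjt k) (jack a T) = cmul be (jack a T) + cmul ga (jack a T').
Proof.
move=> hk ak hT hbe hga; have [hr rS] := rperm_eq hk ak.
set j := rperm a k in hr rS hT hbe hga *.
have ea : mnact (adjt k) a = a.
  apply/mnmP=> i; rewrite mnactE.
  have [->|ik] := eqVneq i k; first by rewrite adjtL.
  have [->|isk] := eqVneq i (succo k); first by rewrite adjtR.
  by rewrite /adjt tpermD // eq_sym.
have [z1 _ z2] := ZP a T; have [z1' _ z2'] := ZP a T'.
pose eta i := (a i).+1%:R + kc * (ct T (adjt j (rperm a i)))%:~R.
have hbe' : be * (spec a T k - spec a T (succo k)) = kc.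
  rewrite -[RHS]mulr1 -hbe /spec -ak rS -/j rmorphB /=; ring.
have heta : forall i, spec a T (adjt k i) = eta i.
  move=> i; have ai : a (adjt k i) = a i by rewrite -mnactE ea.
  have ri : rperm a (adjt k i) = adjt j (rperm a i) by rewrite -permM rperm_eq_comm // permM.
  by rewrite /spec /eta ai ri.
have hT' i : cmul ga (cmul (spec a T' i) (jack a T')) = cmul ga (cmul (eta i) (jack a T')).
  case: hga => [->|h]; first by rewrite !cmul0l.
  by rewrite /spec /eta h.
have : act (adjt k) (jack a T) + cmul (-1) (cmul be (jack a T) + cmul ga (jack a T')) = 0.
  (* The difference of both sides has no x^a term, and its spectrum is that of (a, T) with the ranks
     j and j+1 exchanged. *)
  apply: (@eig_zero a T (fun i => adjt j (rperm a i))).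
    rewrite cfD cf_act cfC cfD !cfC ea z1 z1' mulmxA -rhoM.
    have -> : ((rperm a)^-1 * adjt k = adjt j * (rperm a)^-1)%g.
      apply: (mulgI (rperm a)); rewrite mulgA mulgV mul1g mulgA -rperm_eq_comm //.
      by rewrite mulgK.
    by rewrite rhoM -mulmxA hT mulmxDr -!scalemxAr scaleN1r subrr.
  move=> i; rewrite -/(eta i) UD !UC UD !UC z2 z2' hT'.
  have [->|ik] := eqVneq i k.
    have := U_adjtS (jack a T) hk; rewrite z2 actC => /eqP; rewrite eq_sym subr_eq => /eqP ->.
    rewrite -heta adjtL; move: (jack a T) (jack a T') => q1 q2.
    by move: (act (adjt k) q1) => q; rewrite -hbe'; lincomb; ring.
  have [->|isk] := eqVneq i (succo k).
    have := U_adjt (jack a T) hk; rewrite z2 actC => /eqP; rewrite -subr_eq => /eqP <-.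
    rewrite -heta adjtR; move: (jack a T) (jack a T') => q1 q2.
    by move: (act (adjt k) q1) => q; rewrite -hbe'; lincomb; ring.
  rewrite -U_adjt_far // z2 actC -heta /adjt tpermD 1?eq_sym //.
  by move: (jack a T) (jack a T') => q1 q2; move: (vact _ _ q1) => q; lincomb; ring.
by move/eqP; rewrite addr_eq0 => /eqP ->; lincomb; ring.
Qed.

(** * The form in the Jack basis and its invariance *)

Section JackForm.
Variables (cj : {rmorphism K -> K}) (n0 : I -> K).
Hypothesis cj_kc : cj kc = kc.
Variables (tsw : 'I_N -> I -> I) (ph : int -> K).
Local Notation dct T j := (ct T j - ct T (succo j)).
Hypothesis tau_ev : forall T j, (j.+1 < N)%N ->
  rho (adjt j) *m ev T = ((dct T j)%:~R)^-1 *: ev T + ph (dct T j) *: ev (tsw j T).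
Hypothesis dct_neq0 : forall T j, (j.+1 < N)%N -> (dct T j)%:~R != 0 :> K.
Hypothesis tsw_ct : forall T j, (j.+1 < N)%N ->
  ph (dct T j) = 0 \/ forall i, ct (tsw j T) i = ct T (adjt j i).
Hypothesis tswK : forall T j, (j.+1 < N)%N -> tsw j (tsw j T) = T.
Hypothesis n0_sym : forall T j, (j.+1 < N)%N ->
  ph (dct T j) * n0 (tsw j T) = ph (dct (tsw j T) j) * n0 T.
Hypothesis n0_neq0 : forall T, n0 T != 0.
Hypothesis cj_ph : forall x, cj (ph x) = ph x.

Definition gfac (l : nat) (x : int) : K := 1 - (kc / (l%:R + kc * x%:~R)) ^+ 2.

Definition gprod (n : nat) (x : int) : K := \prod_(l < n) gfac l.+1 x.

(** Norms for all exponents at once. A pair with a_p > a_q contributes a_p - a_q factors, one fewer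
    when [q] stands to the left of [p]; truncated subtraction leaves the other pairs empty. [gnormE]
    compares this with the definition by sorting. *)
Definition nz a T : K :=
  n0 T * \prod_(p < N) \prod_(q < N)
    gprod (a p - a q - (q < p))%N (ct T (rperm a p) - ct T (rperm a q)).

(** The first entry gains one unit and passes to the right of all others, so the correction (q < p)
    changes in step with a_p - a_q and every number of factors is kept. *)
Lemma nz_affm a T : nz (affm cyc last a) T = nz a T.
Proof.
have vl := olastE N0; have cF := ocyc_first N0; have cS := @ocyc_succ N.
have vf : first = 0%N :> nat by [].
rewrite /nz; congr (_ * _); rewrite (reindex_inj (@perm_inj _ cyc)) /=.
apply: eq_bigr => p _; rewrite (reindex_inj (@perm_inj _ cyc)) /=.
apply: eq_bigr => q _.
have er i : rperm (affm cyc last a) (cyc i) = rperm a i.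
  by rewrite (rperm_affm vf vl cF cS a) permM.
rewrite !er !(affmE cF); congr gprod.
have cp i : i != first -> (cyc i).+1 = i :> nat := cyc_pred vf vl cS (i := i).
have lp := ltn_ord p; have lq := ltn_ord q; move: vl => /= vl.
have [->|np] := eqVneq p first; have [->|nq] := eqVneq q first.
- by rewrite ltnn; lia.
- by rewrite cF; have := cp q nq; move: nq; rewrite -val_eqE /= => nq; lia.
- by rewrite cF; have := cp p np; move: np; rewrite -val_eqE /= => np; lia.
- by have := cp p np; have := cp q nq; lia.
Qed.

Lemma nz_reindex k a T T' : (k.+1 < N)%N ->
  (forall i, ct T' (rperm (mnact (adjt k) a) i) = ct T (rperm a (adjt k i))) ->
  \prod_(p < N) \prod_(q < N) gprod (mnact (adjt k) a p - mnact (adjt k) a q - (q < p))%N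
     (ct T' (rperm (mnact (adjt k) a) p) - ct T' (rperm (mnact (adjt k) a) q)) =
  \prod_(p < N) \prod_(q < N) gprod (a p - a q - (adjt k q < adjt k p))%N
     (ct T (rperm a p) - ct T (rperm a q)).
Proof.
move=> hk h; rewrite [RHS](reindex_inj (@perm_inj _ (adjt k))) /=.
apply: eq_bigr => p _; rewrite [RHS](reindex_inj (@perm_inj _ (adjt k))) /=.
apply: eq_bigr => q _; rewrite !h !mnactE.
by rewrite -[adjt k (adjt k p)]permM -[adjt k (adjt k q)]permM adjtK !perm1.
Qed.

Lemma adjt_ltE (k p q : 'I_N) : (k.+1 < N)%N -> (p, q) != (k, succo k) -> (p, q) != (succo k, k) ->
  (adjt k q < adjt k p)%N = (q < p)%N.
Proof.
move=> hk; have vk : succo k = k.+1 :> nat := val_succo hk.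
rewrite !xpair_eqE -!val_eqE /= vk !adjtE //.
by repeat case: eqP => //=; lia.
Qed.

Lemma nz_eq a T T' k : (k.+1 < N)%N -> a k = a (succo k) ->
  (forall i, ct T' i = ct T (adjt (rperm a k) i)) -> nz a T' * n0 T = nz a T * n0 T'.
Proof.
move=> hk ak h.
have ea : mnact (adjt k) a = a.
  apply/mnmP=> i; rewrite mnactE.
  have [->|ik] := eqVneq i k; first by rewrite adjtL.
  have [->|isk] := eqVneq i (succo k); first by rewrite adjtR.
  by rewrite /adjt tpermD // eq_sym.
have h' i : ct T' (rperm (mnact (adjt k) a) i) = ct T (rperm a (adjt k i)).
  by rewrite ea h -permM -rperm_eq_comm // permM.
have := nz_reindex hk h'; rewrite ea /nz => ->.
rewrite mulrAC [RHS]mulrAC [n0 T * _]mulrC; congr (_ * _).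
apply: eq_bigr => p _; apply: eq_bigr => q _.
have [[-> ->]|h1] := (p, q) =P (k, succo k); first by rewrite ak !subnn !sub0n.
have [[-> ->]|h2] := (p, q) =P (succo k, k); first by rewrite ak !subnn !sub0n.
by rewrite adjt_ltE //; apply/eqP.
Qed.

(** Only the pair (k+1, k) changes: after the exchange its correction by one disappears, and the
    factor gained is 1 minus the square of the intertwiner constant. *)
Lemma nz_asc a T k : (k.+1 < N)%N -> (a k < a (succo k))%N ->
  nz (mnact (adjt k) a) T = (1 - (kc / (spec a T (succo k) - spec a T k)) ^+ 2) * nz a T.
Proof.
move=> hk ak; have vk : succo k = k.+1 :> nat := val_succo hk.
have h i : ct T (rperm (mnact (adjt k) a) i) = ct T (rperm a (adjt k i)).
  by rewrite rperm_adjt ?permM //; lia.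
rewrite /nz (nz_reindex hk h) mulrCA; congr (_ * _).
rewrite !pair_big /= (bigD1 (succo k, k)) //= [in RHS](bigD1 (succo k, k)) //= mulrA.
congr (_ * _).
  rewrite adjtL adjtR vk ltnSn ltnNge leqnSn /= subn0.
  have -> : (a (succo k) - a k = (a (succo k) - a k - 1).+1)%N by lia.
  rewrite subSS subn0 {1}/gprod big_ord_recr /= mulrC -/(gprod _ _); congr (_ * _).
  have -> : (a (succo k) - a k - 1).+1 = (a (succo k) - a k)%N by lia.
  rewrite /gfac /spec rmorphB natrB; last exact: ltnW.
  by rewrite -!natr1; congr (1 - (kc / _) ^+ 2); ring.
apply: eq_bigr => -[p q] /= hpq.
have [[-> ->]|h1] := (p, q) =P (k, succo k).
  by rewrite (_ : a k - a (succo k) = 0)%N ?sub0n //; lia.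
by rewrite adjt_ltE //; apply/eqP.
Qed.

(* Coordinates in the basis jack, independent of the truncation degree. *)
Definition rep (D : nat) (c : 'X_{1..N} -> I -> K) p : Prop :=
  (forall a T, (D <= mdeg a)%N -> c a T = 0) /\
  p = \sum_(a : 'X_{1..N < D}) \sum_T cmul (c a T) (jack a T).

Lemma big_bmn_widen (A : nmodType) D D' (F : 'X_{1..N} -> A) : (D <= D')%N ->
  (forall a, (D <= mdeg a)%N -> F a = 0) ->
  \sum_(a : 'X_{1..N < D}) F a = \sum_(a : 'X_{1..N < D'}) F a.
Proof.
move=> hD hF.
rewrite [RHS](bigID (fun x : 'X_{1..N < D'} => (mdeg x < D)%N)) /=.
rewrite [X in _ = _ + X]big1 ?addr0; last by move=> x; rewrite -leqNgt; exact: hF.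
pose wd (x : 'X_{1..N < D}) : 'X_{1..N < D'} := BMultinom (leq_trans (bmdeg x) hD).
case: (pickP (fun _ : 'X_{1..N < D} => true)) => [x0 _|h]; last first.
  rewrite big1; last by move=> x _; have := h x.
  by rewrite big_pred0 // => x; apply/negP => hx; have := h (BMultinom hx).
pose back (x : 'X_{1..N < D'}) : 'X_{1..N < D} := insubd x0 (val x).
rewrite (reindex_onto wd back) /=; last first.
  by move=> x hx; apply: val_inj; rewrite /= /back insubdK.
apply: eq_big => [x|x _] //; rewrite bmdeg /=; apply/esym/eqP/val_inj.
by rewrite /back /wd /= insubdK // -topredE /= bmdeg.
Qed.

Lemma rep_widen D D' c p : (D <= D')%N -> rep D c p -> rep D' c p.
Proof.
move=> hD [h1 h2]; split; first by move=> a T h; apply: h1; exact: leq_trans h.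
rewrite h2 (big_bmn_widen (F := fun a => \sum_T cmul (c a T) (jack a T)) hD) // => a ha.
by rewrite big1 // => T _; rewrite h1 // cmul0l.
Qed.

Lemma rep_uniq D D' c c' p : rep D c p -> rep D' c' p -> c =2 c'.
Proof.
move=> /(rep_widen (leq_maxl D D')) [h1 h2] /(rep_widen (leq_maxr D D')) [h1' h2'] a T.
have [ha|ha] := leqP (maxn D D') (mdeg a); first by rewrite h1 // h1'.
have := @Z_free (maxn D D') (fun x S => c x S - c' x S) _ (BMultinom ha) T.
move=> /(_ _)/eqP; rewrite subr_eq0 => h; apply/eqP/h.
transitivity (p + cmul (-1) p); last by lincomb; ring.
rewrite {1}h2 h2' cmul_sum -big_split; apply: eq_bigr => x _.
rewrite cmul_sum -big_split; apply: eq_bigr => S _ /=.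
by rewrite cmulA -cmulDl mulN1r.
Qed.

Lemma rep_exists D p : (forall a, cf a p != 0 -> (mdeg a < D)%N) -> exists c, rep D c p.
Proof.
move=> hp; have [c _ hc] := inspan_all hp.
exists (fun a T => if insub a is Some x then c x T else 0); split.
  by move=> a T h; rewrite insubF // ltnNge h.
rewrite {1}hc; apply: eq_bigr => x _; apply: eq_bigr => T _.
by rewrite (valK x).
Qed.

Definition coz p : 'X_{1..N} -> I -> K :=
  epsilon (inhabits (fun _ _ => 0)) (fun c => exists D, rep D c p).

Lemma cozP p : exists D, rep D (coz p) p.
Proof.
have [D /rep_exists [c hc]] := cf_bounded p.
apply: (@epsilon_spec _ (inhabits (fun _ _ => 0)) (fun c => exists D, rep D c p)).
by exists c, D.
Qed.

Lemma coz_uniq D c p : rep D c p -> coz p =2 c.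
Proof. by move=> h; have [D' h'] := cozP p; exact: rep_uniq h' h. Qed.

Lemma coz_rep D p : (forall a, cf a p != 0 -> (mdeg a < D)%N) -> rep D (coz p) p.
Proof.
move=> /rep_exists [c hc]; have e := coz_uniq hc; case: hc => h1 h2; split.
  by move=> a T h; rewrite e h1.
rewrite {1}h2; apply: eq_bigr => x _; apply: eq_bigr => T _; by rewrite e.
Qed.

Lemma cozD p q a T : coz (p + q) a T = coz p a T + coz q a T.
Proof.
have [D1 /(rep_widen (leq_maxl _ _)) h1] := cozP p; have [D2 /(rep_widen (leq_maxr _ _)) h2] := cozP q.
apply: (@coz_uniq (maxn D1 D2) (fun a T => coz p a T + coz q a T)); split.
  by move=> b S h; rewrite (h1 D2).1 // (h2 D1).1 // addr0.
rewrite {1}(h1 D2).2 {1}(h2 D1).2 -big_split; apply: eq_bigr => x _.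
by rewrite -big_split; apply: eq_bigr => S _ /=; rewrite cmulDl.
Qed.

Lemma cozC x p a T : coz (cmul x p) a T = x * coz p a T.
Proof.
have [D [h1 h2]] := cozP p.
apply: (@coz_uniq D (fun a T => x * coz p a T)); split.
  by move=> b S h; rewrite h1 // mulr0.
rewrite {1}h2 cmul_sum; apply: eq_bigr => y _.
by rewrite cmul_sum; apply: eq_bigr => S _; rewrite cmulA.
Qed.

Lemma cozZ a T b S : coz (jack a T) b S = ((b == a) && (S == T))%:R.
Proof.
apply: (@coz_uniq (mdeg a).+1 (fun b S => ((b == a) && (S == T))%:R)); split.
  by move=> c T' h; case: eqP => // e; rewrite e ltnn in h.
rewrite (bigD1 (BMultinom (ltnSn (mdeg a)))) //= (bigD1 T) //= !eqxx cmul1 !big1 ?addr0 //.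
  move=> x nx; rewrite big1 // => S' _; case: (val x =P a) => [e|_]; last by rewrite cmul0l.
  by case/eqP: nx; apply: val_inj.
by move=> S' /negPf ->; rewrite andbF cmul0l.
Qed.

(** The truncation only makes the sum finite; by [FT_coz] and [FT_cozr] any degree bound for one of
    the arguments gives the same value. *)
Definition FT p q : K :=
  let D := (\max_(x < d) msize (p x ord0) + \max_(x < d) msize (q x ord0))%N in
  \sum_(a : 'X_{1..N < D}) \sum_T cj (coz p a T) * coz q a T * nz a T.

Lemma cf_msize p a : cf a p != 0 -> (mdeg a < \max_(x < d) msize (p x ord0))%N.
Proof.
move=> h; have : [exists x, cf a p x 0 != 0].
  rewrite -[_ != 0]negbK in h; apply: contraNT h; rewrite negb_exists => /forallP h.
  by rewrite negbK; apply/eqP/colP=> i; have := h i; rewrite negbK => /eqP ->; rewrite mxE.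
case/existsP=> i; rewrite cfE mxE -mcoeff_msupp => /msize_mdeg_lt hi.
by apply: leq_trans hi _; apply: (leq_bigmax (F := fun x => msize (p x ord0))).
Qed.

Lemma coz_ge p D a T : (forall a, cf a p != 0 -> (mdeg a < D)%N) -> (D <= mdeg a)%N ->
  coz p a T = 0.
Proof. by move/coz_rep => [h _]; exact: h. Qed.

Lemma FT_coz D p q : (forall a, cf a p != 0 -> (mdeg a < D)%N) ->
  FT p q = \sum_(a : 'X_{1..N < D}) \sum_T cj (coz p a T) * coz q a T * nz a T.
Proof.
move=> hD; rewrite /FT; set D0 := (_ + _)%N.
pose F a := \sum_T cj (coz p a T) * coz q a T * nz a T.
rewrite (big_bmn_widen (D := D0) (D' := maxn D0 D) (F := F)) ?leq_maxl //; last first.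
  move=> a ha; rewrite /F big1 // => T _; rewrite (coz_ge T (@cf_msize p)).
    by rewrite rmorph0 !mul0r.
  by apply: leq_trans ha; rewrite leq_addr.
rewrite [RHS](big_bmn_widen (D' := maxn D0 D) (F := F)) ?leq_maxr // => a ha.
by rewrite /F big1 // => T _; rewrite (coz_ge T hD) // rmorph0 !mul0r.
Qed.

Lemma FT_cozr D p q : (forall a, cf a q != 0 -> (mdeg a < D)%N) ->
  FT p q = \sum_(a : 'X_{1..N < D}) \sum_T cj (coz p a T) * coz q a T * nz a T.
Proof.
move=> hD; rewrite /FT; set D0 := (_ + _)%N.
pose F a := \sum_T cj (coz p a T) * coz q a T * nz a T.
rewrite (big_bmn_widen (D := D0) (D' := maxn D0 D) (F := F)) ?leq_maxl //; last first.
  move=> a ha; rewrite /F big1 // => T _; rewrite (coz_ge T (@cf_msize q)).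
    by rewrite mulr0 mul0r.
  by apply: leq_trans ha; rewrite leq_addl.
rewrite [RHS](big_bmn_widen (D' := maxn D0 D) (F := F)) ?leq_maxr // => a ha.
by rewrite /F big1 // => T _; rewrite (coz_ge T hD) // mulr0 mul0r.
Qed.

Lemma FT_Dr p q q' : FT p (q + q') = FT p q + FT p q'.
Proof.
have [D hD] := cf_bounded p; rewrite !(FT_coz _ hD) -big_split; apply: eq_bigr => x _.
by rewrite -big_split; apply: eq_bigr => T _ /=; rewrite cozD; ring.
Qed.

Lemma FT_Dl p p' q : FT (p + p') q = FT p q + FT p' q.
Proof.
have [D hD] := cf_bounded q; rewrite !(FT_cozr _ hD) -big_split; apply: eq_bigr => x _.
by rewrite -big_split; apply: eq_bigr => T _ /=; rewrite cozD rmorphD; ring.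
Qed.

Lemma FT_Cr p x q : FT p (cmul x q) = x * FT p q.
Proof.
have [D hD] := cf_bounded p; rewrite !(FT_coz _ hD) mulr_sumr; apply: eq_bigr => y _.
by rewrite mulr_sumr; apply: eq_bigr => T _ /=; rewrite cozC; ring.
Qed.

Lemma FT_Cl p x q : FT (cmul x p) q = cj x * FT p q.
Proof.
have [D hD] := cf_bounded q; rewrite !(FT_cozr _ hD) mulr_sumr; apply: eq_bigr => y _.
by rewrite mulr_sumr; apply: eq_bigr => T _ /=; rewrite cozC rmorphM; ring.
Qed.

Lemma FT_0l q : FT 0 q = 0. Proof. by rewrite -(cmul0l 0) FT_Cl rmorph0 mul0r. Qed.
Lemma FT_0r p : FT p 0 = 0. Proof. by rewrite -(cmul0l 0) FT_Cr mul0r. Qed.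

Lemma FT_suml (J : Type) (r : seq J) (P : pred J) (F : J -> V) q :
  FT (\sum_(i <- r | P i) F i) q = \sum_(i <- r | P i) FT (F i) q.
Proof. by apply: (big_morph (FT^~ q)); [move=> x y; exact: FT_Dl | exact: FT_0l]. Qed.

Lemma FT_sumr (J : Type) (r : seq J) (P : pred J) (F : J -> V) p :
  FT p (\sum_(i <- r | P i) F i) = \sum_(i <- r | P i) FT p (F i).
Proof. by apply: (big_morph (FT p)); [move=> x y; exact: FT_Dr | exact: FT_0r]. Qed.

Lemma FT_Z a T b S : FT (jack a T) (jack b S) = ((a == b) && (T == S))%:R * nz a T.
Proof.
have hD m : cf m (jack a T) != 0 -> (mdeg m < (mdeg a).+1)%N.
  by have [_ h _] := ZP a T => /h /below_mdeg ->.
rewrite (FT_coz _ hD) (bigD1 (BMultinom (ltnSn (mdeg a)))) //= (bigD1 T) //=.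
rewrite !cozZ !eqxx rmorph1 mul1r !big1 ?addr0 //.
  move=> x nx; rewrite big1 // => S' _; rewrite cozZ.
  case: (val x =P a) => [e|_]; last by rewrite rmorph0 !mul0r.
  by case/eqP: nx; apply: val_inj.
by move=> S' /negPf nS; rewrite cozZ nS andbF rmorph0 !mul0r.
Qed.

Lemma FT_basis (f g : V -> V) :
  (forall p q, f (p + q) = f p + f q) -> (forall x p, f (cmul x p) = cmul x (f p)) ->
  (forall p q, g (p + q) = g p + g q) -> (forall x p, g (cmul x p) = cmul x (g p)) ->
  forall (f' g' : V -> V),
  (forall p q, f' (p + q) = f' p + f' q) -> (forall x p, f' (cmul x p) = cmul x (f' p)) ->
  (forall p q, g' (p + q) = g' p + g' q) -> (forall x p, g' (cmul x p) = cmul x (g' p)) ->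
  (forall a T b S, FT (f (jack a T)) (g (jack b S)) = FT (f' (jack a T)) (g' (jack b S))) ->
  forall p q, FT (f p) (g q) = FT (f' p) (g' q).
Proof.
move=> fD fC gD gC f' g' fD' fC' gD' gC' h p q.
have z0 (u : V -> V) : (forall x p, u (cmul x p) = cmul x (u p)) -> u 0 = 0.
  by move=> uC; have := uC 0 0; rewrite !cmul0l.
have S (u : V -> V) : (forall p q, u (p + q) = u p + u q) ->
   (forall x p, u (cmul x p) = cmul x (u p)) ->
   forall (c : 'X_{1..N} -> I -> K) (D : nat), u (\sum_(x : 'X_{1..N < D}) \sum_R cmul (c x R) (jack x R)) =
   \sum_(x : 'X_{1..N < D}) \sum_R cmul (c x R) (u (jack x R)).
  move=> uD uC c D; rewrite (big_morph u uD (z0 _ uC)); apply: eq_bigr => a _.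
  by rewrite (big_morph u uD (z0 _ uC)); apply: eq_bigr => T _.
have [D [_ ->]] := cozP p; have [D' [_ ->]] := cozP q.
rewrite (S f) // (S f') // (S g) // (S g') // !FT_suml; apply: eq_bigr => a _.
rewrite !FT_suml; apply: eq_bigr => T _; rewrite !FT_Cl !FT_sumr; congr (_ * _).
by apply: eq_bigr => b _; rewrite !FT_sumr; apply: eq_bigr => R _; rewrite !FT_Cr h.
Qed.

(** The affine step maps the orthogonal basis injectively into itself and preserves the norms. *)
Lemma FT_affine p q :
  FT (mulX last (act cyc p)) (mulX last (act cyc q)) = FT p q.
Proof.
pose A p := mulX last (act cyc p).
have AD u v : A (u + v) = A u + A v by rewrite /A actD mulXD.
have AC x u : A (cmul x u) = cmul x (A u) by rewrite /A actC mulXC.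
apply: (@FT_basis A A AD AC AD AC id id) => // a T b S.
rewrite /A -!Z_affm !FT_Z nz_affm; congr ((_ && _)%:R * _).
apply/eqP/eqP => [h|->//]; apply/mnmP=> i.
have := congr1 (fun m : 'X_{1..N} => m (cyc i)) h.
by rewrite !(affmE (ocyc_first N0)) => /addIn.
Qed.

Lemma spec_real a T i : cj (spec a T i) = spec a T i.
Proof. by rewrite /spec rmorphD rmorphM cj_kc rmorph_nat rmorph_int. Qed.

Section Adjacent.
Variables (k : 'I_N) (hk : (k.+1 < N)%N).

Let jp (x : 'X_{1..N} * I) := rperm x.1 k.
Let bx (x : 'X_{1..N} * I) := kc / (spec x.1 x.2 (succo k) - spec x.1 x.2 k).
(** s_k acts on the basis in blocks made of an index and its partner: tableaux are exchanged if a_k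
    = a_{k+1}, exponents otherwise. [zdiag] and [zoff] are the two matrix coefficients. *)
Definition znext (x : 'X_{1..N} * I) : 'X_{1..N} * I :=
  if x.1 k == x.1 (succo k) then (x.1, tsw (jp x) x.2) else (mnact (adjt k) x.1, x.2).
Definition zdiag (x : 'X_{1..N} * I) : K :=
  if x.1 k == x.1 (succo k) then ((dct x.2 (jp x))%:~R)^-1 else - bx x.
Definition zoff (x : 'X_{1..N} * I) : K :=
  if x.1 k == x.1 (succo k) then ph (dct x.2 (jp x))
  else if (x.1 k < x.1 (succo k))%N then 1 else 1 - bx x ^+ 2.

Lemma bx_swap a T : (a k != a (succo k)) -> bx (mnact (adjt k) a, T) = - bx (a, T).
Proof. by move=> h; rewrite /bx /= !spec_adjt // adjtL adjtR -opprB invrN mulrN. Qed.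

Lemma Z_asc b S : (b k < b (succo k))%N ->
  act (adjt k) (jack b S) = cmul (- bx (b, S)) (jack b S) + cmul 1 (jack (mnact (adjt k) b) S).
Proof.
move=> hb; rewrite (Z_adjt S hk hb) -/(bx (b, S)).
by move: (jack b S) => u; move: (act _ u) => v; lincomb; ring.
Qed.

Lemma act_Z a T : act (adjt k) (jack a T) =
  cmul (zdiag (a, T)) (jack a T) + cmul (zoff (a, T)) (jack (znext (a, T)).1 (znext (a, T)).2).
Proof.
rewrite /zdiag /zoff /znext /jp /=; case: (ltngtP (a k) (a (succo k))) => ha /=.
- exact: Z_asc.
(* Here the exponent is the exchange of an ascending one, so the recursion is solved for s_k using
   s_k s_k = 1. *)
- have hb : (mnact (adjt k) a k < mnact (adjt k) a (succo k))%N by rewrite !mnactE adjtL adjtR.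
  have e := Z_adjt T hk hb; rewrite mnactK in e.
  rewrite {1}e actD actM adjtK act1 actC Z_asc // mnactK.
  have ne : a k != a (succo k) by lia.
  have -> : kc / (spec (mnact (adjt k) a) T (succo k) - spec (mnact (adjt k) a) T k) = - bx (a, T).
    by rewrite -bx_swap.
  rewrite bx_swap //.
  by move: (jack a T) (jack _ T) (bx _) => u v x; lincomb; ring.
have [hr rS] := rperm_eq hk ha; set j := rperm a k in hr rS *.
apply: Z_eq => //; first exact: tau_ev.
  by rewrite mulVf // dct_neq0.
exact: tsw_ct.
Qed.

Lemma znextK : involutive znext.
Proof.
case=> a T; rewrite {2}/znext /=; case: eqP => ha.
  have [hr _] := rperm_eq hk ha.
  by rewrite /znext /= ha eqxx /jp /= tswK.
rewrite /znext /= !mnactE adjtL adjtR eq_sym; case: eqP => // _.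
by rewrite mnactK.
Qed.

Lemma zoff_sym a T : zoff (a, T) * nz (znext (a, T)).1 (znext (a, T)).2 =
  zoff (znext (a, T)) * nz a T.
Proof.
rewrite /zoff /znext /=; case: (ltngtP (a k) (a (succo k))) => ha /=.
- rewrite !mnactE adjtL adjtR gtn_eqF // ltnNge ltnW //= mul1r nz_asc //.
  by rewrite bx_swap ?sqrrN // ltn_eqF.
- rewrite !mnactE adjtL adjtR ltn_eqF // ha mul1r.
  have hb : (mnact (adjt k) a k < mnact (adjt k) a (succo k))%N by rewrite !mnactE adjtL adjtR.
  have := nz_asc T hk hb; rewrite mnactK => ->; congr (_ * _).
  rewrite -/(bx (mnact (adjt k) a, T)) bx_swap ?sqrrN //.
  by rewrite gtn_eqF.
rewrite ha eqxx /jp /=; have [hr rS] := rperm_eq hk ha; set j := rperm a k in hr rS *.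
apply: (mulIf (n0_neq0 T)).
case: (tsw_ct T hr) => hT.
  by rewrite hT !mul0r mulrAC -n0_sym // hT !mul0r.
by rewrite -mulrA (nz_eq hk ha hT) mulrCA n0_sym //; ring.
Qed.

Lemma cj_zdiag x : cj (zdiag x) = zdiag x.
Proof.
rewrite /zdiag; case: ifP => _; first by rewrite fmorphV rmorph_int.
by rewrite rmorphN /bx rmorphM fmorphV rmorphB !spec_real cj_kc.
Qed.

Lemma cj_zoff x : cj (zoff x) = zoff x.
Proof.
rewrite /zoff; case: ifP => _; first exact: cj_ph.
case: ifP => _; first exact: rmorph1.
by rewrite rmorphB rmorph1 rmorphXn /bx rmorphM fmorphV rmorphB !spec_real /= cj_kc.
Qed.

(** As the coefficients are real, self-adjointness on a block amounts to the symmetry of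
    off-diagonal coefficient times norm, which is [zoff_sym]. *)
Lemma FT_adjt_sym p q : FT (act (adjt k) p) q = FT p (act (adjt k) q).
Proof.
apply: (@FT_basis (act (adjt k)) id (actD _) (actC _) _ _ id (act (adjt k)) _ _ (actD _) (actC _)) => //.
move=> a T b S; rewrite !act_Z FT_Dl FT_Dr !FT_Cl !FT_Cr !FT_Z cj_zdiag cj_zoff.
have pE (x y : 'X_{1..N} * I) : (x.1 == y.1) && (x.2 == y.2) = (x == y) by case: x y => ? ? [].
rewrite (pE (a, T) (b, S)) (pE (znext (a, T)) (b, S)) (pE (a, T) (znext (b, S))).
rewrite -(inv_eq znextK); congr (_ + _).
  by case: eqP => [[-> ->]|_] //; rewrite !mul0r !mulr0.
case: eqP => [e|_]; last by rewrite !mul0r !mulr0.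
by have := zoff_sym a T; rewrite e !mul1r.
Qed.

End Adjacent.

Lemma FT_act w p q : FT (act w p) (act w q) = FT p q.
Proof.
elim/perm_adjt_ind: w p q => [|w k hk IH] p q; first by rewrite !act1.
by rewrite -!actM IH FT_adjt_sym // actM adjtK act1.
Qed.

(** The affine step and the permutation [cyc] are both isometric, hence so is multiplication by x_N;
    conjugating by the transposition of i and N gives x_i. *)
Lemma FT_mulX i p q : FT (mulX i p) (mulX i q) = FT p q.
Proof.
rewrite -(FT_act (tperm i last)) !actX tpermL -[RHS](FT_act (tperm i last)).
move: (act (tperm i last) p) (act (tperm i last) q) => u v.
have e r : r = act cyc (act cyc^-1 r) by rewrite actM mulVg act1.
by rewrite (e u) (e v) FT_affine !FT_act.
Qed.

Lemma FT_cst T S : FT (cst (ev T)) (cst (ev S)) = (T == S)%:R * n0 T.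
Proof.
rewrite -!Z_cst FT_Z eqxx /nz; congr (_ * _).
rewrite big1 ?mulr1 // => p _; rewrite big1 // => q _.
by rewrite !mnm0E sub0n /gprod big_ord0.
Qed.

Lemma mulX_mono i a v : mulX i (mono a v) = mono (a + U_(i))%MM v.
Proof. by rewrite mulXE /mono smulA mulrC mpolyXD. Qed.

Lemma FT_mono_shift a b c u v :
  FT (mono (a + c)%MM u) (mono (b + c)%MM v) = FT (mono a u) (mono b v).
Proof.
move: {2}(mdeg c) (erefl (mdeg c)) => n; elim: n c => [|n IH] c hc.
  by move/eqP: hc; rewrite mdeg_eq0 => /eqP ->; rewrite !addm0.
have [i hi] : exists i, c i != 0%N.
  have c0 : c != 0%MM by rewrite -mdeg_eq0 hc.
  apply/existsP; apply: contraNT c0; rewrite negb_exists => /forallP h.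
  by apply/eqP/mnmP => i; rewrite mnm0E; have := h i; rewrite negbK => /eqP.
have e : (c = (c - U_(i)) + U_(i))%MM.
  apply/mnmP=> j; rewrite mnmDE mnmBE mnm1E.
  by case: (i =P j) => [<-|_] /=; [rewrite subnK // lt0n | rewrite subn0 addn0].
rewrite e !addmA -!mulX_mono FT_mulX; apply: IH.
by have := congr1 (@mdeg N) e; rewrite mdegD mdeg1 hc; lia.
Qed.

Lemma coz_mono a v b T : mdeg b != mdeg a -> coz (mono a v) b T = 0.
Proof.
move=> h; have [c hc e] := inspan_mono v (ltnSn (mdeg a)).
have hD m : cf m (mono a v) != 0 -> (mdeg m < (mdeg a).+1)%N.
  by rewrite cf_mono; case: (m =P a) => [->|_] //; rewrite scale0r eqxx.
have hr : rep (mdeg a).+1 (fun x S => if insub x is Some y then c y S else 0) (mono a v).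
  split; first by move=> x S hx; rewrite insubF // ltnNge hx.
  rewrite {1}e; apply: eq_bigr => x _; apply: eq_bigr => S _.
  by rewrite (valK x).
rewrite (coz_uniq hr); case: insubP => // x _ ex.
by apply: hc; rewrite /= ex.
Qed.

Lemma FT_mono_deg a b u v : mdeg a != mdeg b -> FT (mono a u) (mono b v) = 0.
Proof.
move=> h; have [D hD] := cf_bounded (mono a u); rewrite (FT_coz _ hD).
rewrite big1 // => x _; rewrite big1 // => T _.
have [e|ne] := eqVneq (mdeg x) (mdeg a); last by rewrite coz_mono // rmorph0 !mul0r.
by rewrite [coz (mono b v) _ _]coz_mono ?mulr0 ?mul0r // e.
Qed.

Lemma act_mono w a v : act w (mono a v) = mono (mnact w^-1 a) (rho w *m v).
Proof.
apply: cf_eq => m; rewrite cf_act !cf_mono scalemxAr.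
congr (_ *m ((_ : bool)%:R *: v)); apply/eqP/eqP => [<-|->].
  by rewrite mnact_mnact mulVg mnact1.
by rewrite mnact_mnact mulgV mnact1.
Qed.

Lemma FT_herm p q : (forall x, cj (cj x) = x) -> (forall a T, cj (nz a T) = nz a T) ->
  FT q p = cj (FT p q).
Proof.
move=> cjK hn; have [D hD] := cf_bounded p.
rewrite (FT_coz _ hD) (FT_cozr _ hD) rmorph_sum; apply: eq_bigr => x _ /=.
rewrite rmorph_sum; apply: eq_bigr => T _ /=.
by rewrite [RHS]rmorphM hn [in RHS]rmorphM /= cjK; ring.
Qed.

End JackForm.

End JackPolynomials.

(** * Agreement of the closed norm formula with the one through sorted exponents *)

Section SortedExponent.
Variable N : nat.
Implicit Types (a : 'X_{1..N}) (p q i j : 'I_N).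

Lemma rperm_lt a p q : (rperm a p < rperm a q)%N -> (a q <= a p)%N.
Proof.
move=> h; case/orP: (bef_total a p q) => [|hb]; first by rewrite /bef; lia.
have ne : q != p by apply/eqP=> e; rewrite e ltnn in h.
by have := rank_lt hb ne; rewrite -!rpermE; lia.
Qed.

Lemma nth_mplus a p : nth 0%N (mplus a) (rperm a p) = a p.
Proof.
pose w := (rperm a)^-1%g.
have e : mplus a = mseq (mnact w a).
  rewrite -(mplus_mnact w); apply: sorted_sort.
    by move=> x y z /= h1 h2; exact: leq_trans h2 h1.
  rewrite /mseq; apply/(sortedP 0%N) => i; rewrite size_map size_enum_ord => hi.
  have hi' : (i < N)%N by apply: ltn_trans hi.
  rewrite !(nth_map (Ordinal hi) 0%N) ?size_enum_ord // /=.
  rewrite (_ : nth _ _ i.+1 = Ordinal hi); last exact: (nth_ord_enum _ (Ordinal hi)).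
  rewrite (_ : nth _ _ i = Ordinal hi'); last exact: (nth_ord_enum _ (Ordinal hi')).
  by rewrite !mnactE; apply: rperm_lt; rewrite !permKV /=.
rewrite e /mseq (nth_map p 0%N) ?size_enum_ord // nth_ord_enum mnactE.
by rewrite /w permK.
Qed.

Variables (K : fieldType) (kc : K) (c : 'I_N -> int) (a : 'X_{1..N}).
Let r := rperm a.
Local Notation g l x := (gfac kc l x).
Hypothesis g_neq0 : forall l i j, g l.+1 (c i - c j) != 0.

Definition geps (e : K) : K :=
  \prod_(i < N) \prod_(j < N | (i < j)%N && (a i < a j)%N)
    (1 + e * kc / ((a j)%:R - (a i)%:R + kc * (c (r j) - c (r i))%:~R)).

Lemma gepsE : geps 1 * geps (-1) =
  \prod_(p < N) \prod_(q < N | (q < p)%N && (a q < a p)%N) g (a p - a q)%N (c (r p) - c (r q)).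
Proof.
rewrite /geps -big_split /= [RHS](exchange_big_dep xpredT) //=.
apply: eq_bigr => i _; rewrite -big_split /=; apply: eq_bigr => j /andP[_ h].
by rewrite /gfac natrB; [ring | exact: ltnW].
Qed.

(** After reindexing by ranks the product for the sorted exponent has all a_p - a_q factors for each
    pair. The product of the two [geps] collects the last factor of those pairs whose larger value
    stands to the right, and division removes it. *)
Lemma gnormE (n0 : K) :
  (geps 1 * geps (-1))^-1 * (n0 *
   \prod_(i < N) \prod_(j < N | (i < j)%N)
     \prod_(l < (nth 0%N (mplus a) i - nth 0%N (mplus a) j)%N)
       (1 - (kc / (l.+1%:R + kc * (c i - c j)%:~R)) ^+ 2)) =
  n0 * \prod_(p < N) \prod_(q < N) gprod kc (a p - a q - (q < p))%N (c (r p) - c (r q)).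
Proof.
have gn l i j : (0 < l)%N -> g l (c i - c j) != 0 by case: l.
have e0 : geps 1 * geps (-1) != 0.
  rewrite gepsE; apply/prodf_neq0 => p _; apply/prodf_neq0 => q /andP[_ h].
  by apply: gn; rewrite subn_gt0.
apply: (mulfI e0); rewrite mulrA divff // mul1r mulrCA; congr (_ * _).
rewrite gepsE -big_split /= (reindex_inj (@perm_inj _ r)) /=; apply: eq_bigr => p _.
rewrite (reindex_inj (@perm_inj _ r)) /= [X in _ = X * _]big_mkcond -big_split /=.
rewrite big_mkcond /=; apply: eq_bigr => q _; rewrite !nth_mplus.
have -> : \prod_(l < (a p - a q)%N) (1 - (kc / (l.+1%:R + kc * (c (r p) - c (r q))%:~R)) ^+ 2) =
  gprod kc (a p - a q)%N (c (r p) - c (r q)) by [].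
have [h|h] := leqP (a p) (a q).
  have -> : (a p - a q = 0)%N by lia.
  by rewrite andbF sub0n /gprod !big_ord0 mulr1; case: ifP.
have -> : (r p < r q)%N.
  case: (ltngtP (r p) (r q)) => // hr; first by have := rperm_lt hr; lia.
  by move/val_inj/perm_inj: hr h => ->; rewrite ltnn.
rewrite andbT; case: ifP => hqp; last by rewrite subn0 mul1r.
have -> : (a p - a q = (a p - a q - 1).+1)%N by lia.
by rewrite /gprod big_ord_recr /= subSS subn0 mulrC.
Qed.

End SortedExponent.

(** * The embedding of the reals in the complex numbers *)

Lemma toCB : {morph toC : x y / x - y}.
Proof. by move=> x y; apply/eqP; rewrite eq_complex /= subr0 !eqxx. Qed.
Lemma toCD : {morph toC : x y / x + y}.
Proof. by move=> x y; apply/eqP; rewrite eq_complex /= addr0 !eqxx. Qed.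
Lemma toCM : {morph toC : x y / x * y}.
Proof. by move=> x y; apply/eqP; rewrite eq_complex /= !mul0r mulr0 subr0 addr0 !eqxx. Qed.
Lemma toC0 : toC 0 = 0. Proof. by []. Qed.
Lemma toC1 : toC 1 = 1. Proof. by []. Qed.
Lemma toCX n : {morph toC : x / x ^+ n}.
Proof. by move=> x; elim: n => [|n IH]; rewrite ?expr0 // !exprS toCM IH. Qed.
Lemma toC_nat n : toC n%:R = n%:R.
Proof. by elim: n => [|n IH] //; rewrite -!natr1 toCD IH. Qed.
Lemma toC_int (x : int) : toC x%:~R = x%:~R.
Proof.
case: x => n; first by rewrite -!pmulrn toC_nat.
have tN y : toC (- y) = - toC y by apply/eqP; rewrite eq_complex /= oppr0 !eqxx.
by rewrite NegzE !rmorphN /= tN -!pmulrn toC_nat.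
Qed.
Lemma toC_inj : injective toC. Proof. by move=> x y []. Qed.
Lemma toC_eq0 x : (toC x == 0) = (x == 0).
Proof. by apply/eqP/eqP => [[]|->]. Qed.
Lemma toCV x : toC x^-1 = (toC x)^-1.
Proof.
have [->|x0] := eqVneq x 0; first by rewrite invr0 toC0 invr0.
apply: (mulfI (x := toC x)); first by rewrite toC_eq0.
by rewrite -toCM !divff // toC_eq0.
Qed.
Lemma toC_gt0 x : 0 < x -> 0 < toC x.
Proof. by move=> h; rewrite ltcE /= eqxx h. Qed.
Lemma conj_toC x : (toC x)^* = toC x.
Proof. by apply/eqP; rewrite eq_complex /= oppr0 !eqxx. Qed.


(** * The abstract theory applied to the torus form *)

Section TorusForm.
Variables (N : nat) (tau : seq nat) (kappa : R).
Hypothesis hN : (0 < N)%N.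
Hypothesis htau : is_partition N tau.
Hypothesis hkap : - ((h_tau tau)%:R)^-1 < kappa < ((h_tau tau)%:R)^-1.

Local Notation d := (dimV N tau).
Local Notation I := (rsyt N tau).
Local Notation V := (PV N tau).
Local Notation rho := (@tauM N tau).
Local Notation kc := (kC kappa).
Let ct (T : I) (i : 'I_N) : int := fcont (fil T) i.
Let n0 (T : I) : Cx := toC (norm0 T).
Let cj : {rmorphism Cx -> Cx} := Num.conj.
(** The default [T] is taken when the swap is not a tableau; its coefficient [phic] is then 0. *)
Let tsw (j : 'I_N) (T : I) : I := insubd T (fswap j (fil T)).

Lemma fcont_bound (T T' : I) i j :
  fcont (fil T) i - fcont (fil T') j <= (h_tau tau)%:Z - 1.
Proof.
have /andP[h1 h2] := tab_diag T i; have /andP[h3 h4] := tab_diag T' j.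
have g1 := part_geq htau (leq0n (fil T i).1).
rewrite /fcont /tcol /trow /h_tau -nth0; lia.
Qed.

Lemma h_gt0 : (0 < h_tau tau)%N.
Proof.
case/and3P: htau => _ h1 /eqP h2; rewrite /h_tau.
case: (tau) h1 h2 => [|x s] /=; first by move=> _ e; move: hN; rewrite -e.
by case/andP; lia.
Qed.

(** Contents lie between 1 - l(tau) and tau_1 - 1, so a difference x satisfies |x| <= h - 1 and
    |kappa x| + |kappa| <= |kappa| h < 1. Both the separation of spectra and the positivity of the
    norms come from this estimate. *)
Lemma kap_content (T T' : I) i j :
  `|kappa * (fcont (fil T) i - fcont (fil T') j)%:~R| + `|kappa| < 1.
Proof.
set x := _ - _.
have hx : `|x| <= (h_tau tau)%:Z - 1.
  by rewrite ler_norml; have := fcont_bound T T' i j; have := fcont_bound T' T j i; rewrite /x; lia.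
have h0 : 0 < (h_tau tau)%:R :> R by rewrite ltr0n h_gt0.
have hk : `|kappa| * (h_tau tau)%:R < 1.
  by rewrite -ltr_pdivlMr // mul1r ltr_norml.
apply: le_lt_trans hk; rewrite normrM -{2}[`|kappa|]mulr1 -mulrDr ler_wpM2l //.
have : `|x|%:~R <= ((h_tau tau)%:Z - 1)%:~R :> R by rewrite ler_int.
by clearbody x; rewrite intr_norm rmorphB /= => h; rewrite -lerBrDr.
Qed.

Lemma spectral_nondeg (m : int) (T : I) i (T' : I) j :
  m%:~R + kc * (ct T i - ct T' j)%:~R = 0 -> m = 0.
Proof.
rewrite -!toC_int /kC -toCM -toCD -toC0 => /toC_inj h.
have h2 := kap_content T T' i j.
have : `|m%:~R : R| < 1.
  have -> : m%:~R = - (kappa * (ct T i - ct T' j)%:~R) :> R by apply/eqP; rewrite -addr_eq0 h.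
  by rewrite normrN; apply: le_lt_trans h2; rewrite lerDl.
rewrite -intr_norm ltrz1; lia.
Qed.

Lemma ev_indep (c : I -> Cx) : \sum_T c T *: ev T = 0 -> forall T, c T = 0.
Proof.
move=> h T; have /colP/(_ (enum_rank T)) := h.
rewrite summxE (bigD1 T) //= !mxE /tabi enum_rankK eqxx mulr1 big1 ?addr0 //.
by move=> S hS; rewrite !mxE /tabi enum_rankK eq_sym (negPf hS) mulr0.
Qed.

Lemma ev_gen (v : 'cV[Cx]_d) : exists c : I -> Cx, v = \sum_T c T *: ev T.
Proof. by exists (fun T => v (enum_rank T) 0); exact: vec_ev. Qed.

Lemma cj_toC x : cj (toC x) = toC x. Proof. exact: conj_toC. Qed.

Lemma tsw_fil (T : I) (j : 'I_N) : (j.+1 < N)%N -> phic (dcont (fil T) j) != 0 ->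
  fil (tsw j T) = fswap j (fil T).
Proof. by move=> hj; rewrite -(fswap_ok htau) // => h; rewrite /tsw /fil val_insubd h. Qed.

Lemma tsw_id (T : I) (j : 'I_N) : (j.+1 < N)%N -> phic (dcont (fil T) j) = 0 -> tsw j T = T.
Proof.
move=> hj h; rewrite /tsw /insubd insubN //=.
by rewrite (fswap_ok htau) // h eqxx.
Qed.

Lemma tau_ev (T : I) (j : 'I_N) : (j.+1 < N)%N ->
  rho (adjt j) *m ev T = ((ct T j - ct T (succo j))%:~R)^-1 *: ev T +
     phic (ct T j - ct T (succo j)) *: ev (tsw j T).
Proof.
move=> hj; rewrite (tauM_ev htau _ hj); congr (_ + _).
have [h|h] := eqVneq (phic (dcont (fil T) j)) 0.
  by rewrite [in RHS]h h !scale0r.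
by rewrite -(tsw_fil hj h) fev_val.
Qed.

Lemma tsw_content (T : I) (j : 'I_N) : (j.+1 < N)%N ->
  phic (ct T j - ct T (succo j)) = 0 \/ forall i, ct (tsw j T) i = ct T (adjt j i).
Proof.
move=> hj; have [h|h] := eqVneq (phic (dcont (fil T) j)) 0; [by left | right => i].
by rewrite /ct (tsw_fil hj h) fcont_swap.
Qed.

Lemma phic_opp_neq0 (T : I) (j : 'I_N) : (j.+1 < N)%N ->
  phic (dcont (fil T) j) != 0 -> phic (- dcont (fil T) j) != 0.
Proof.
move=> hj h; have e := tsw_fil hj h.
have := fswap_ok htau (tsw j T) hj; rewrite e fswapK dcont_swap => <-.
exact: (valP T).
Qed.

Lemma tsw_invol (T : I) (j : 'I_N) : (j.+1 < N)%N -> tsw j (tsw j T) = T.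
Proof.
move=> hj; have [h|h] := eqVneq (phic (dcont (fil T) j)) 0.
  by rewrite !tsw_id // tsw_id.
have e := tsw_fil hj h; apply: fil_inj; rewrite tsw_fil ?e ?fswapK //.
by rewrite dcont_swap; exact: phic_opp_neq0.
Qed.

Lemma dct_neq0 (T : I) (j : 'I_N) : (j.+1 < N)%N -> (ct T j - ct T (succo j))%:~R != 0 :> Cx.
Proof. by move=> hj; apply: intC_neq0; exact: (dcont_neq0 htau T hj). Qed.

Lemma n0_sym (T : I) (j : 'I_N) : (j.+1 < N)%N ->
  phic (ct T j - ct T (succo j)) * n0 (tsw j T) =
  phic (ct (tsw j T) j - ct (tsw j T) (succo j)) * n0 T.
Proof.
move=> hj.
have [h|h] := eqVneq (phic (dcont (fil T) j)) 0.
  by rewrite tsw_id //.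
have e := tsw_fil hj h.
have -> : ct (tsw j T) j - ct (tsw j T) (succo j) = - dcont (fil T) j.
  by rewrite -(dcont_swap j (fil T)) -e.
rewrite -/(dcont (fil T) j).
have phE x : 2 <= x -> phic (- x) = toC (1 - x%:~R ^- 2).
  move=> hx; rewrite /phic ifF; last by lia.
  by rewrite rmorphN /= sqrrN toCB toC1 toCV toCX toC_int.
have hn := @norm0_swap N tau htau (tsw j T) T j hj.
rewrite e dcont_swap fswapK in hn.
case: (dcontP htau T hj) (@norm0_swap N tau htau T (tsw j T) j hj e) (hn erefl) h
  => [_|_ _|x hx _ _|x hx _ _] hn1 hn2 h.
- by rewrite phic1 eqxx in h.
- by rewrite phicN1 eqxx in h.
- by rewrite phE // {1}/phic hx mul1r -toCM /n0 hn1.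
rewrite -{1}[x]opprK phE // {1}/phic hx mul1r -toCM /n0 hn2 //.
Qed.

Lemma n0_neq0 (T : I) : n0 T != 0.
Proof. by rewrite toC_eq0 gt_eqF // norm0_gt0. Qed.

Lemma cj_phic x : cj (phic x) = phic x.
Proof.
rewrite /phic; case: ifP => _; first exact: rmorph1.
by rewrite rmorphB rmorph1 fmorphV rmorphXn rmorph_int.
Qed.

Local Notation Zt := (jack rho kc (@ev N tau) ct).
Local Notation FTt := (FT rho kc (@ev N tau) ct cj n0).
Local Notation nzt := (nz kc ct n0).
Local Notation r1 := (tauM1 htau).
Local Notation rM := (@tauMM N tau htau).
Let jmE (T : I) (i : 'I_N) :
  (\sum_(j < N | (i < j)%N) rho (tperm i j)) *m ev T = (ct T i)%:~R *: ev T.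
Proof. exact: (jm_ev htau). Qed.

(** The denominator is at least 1 - |kappa x|, which exceeds |kappa|; the squared quotient is
    therefore below 1. *)
Lemma gfac_gt0 l (T : I) i j : 0 < gfac kc l.+1 (ct T i - ct T j).
Proof.
have h := kap_content T T i j; rewrite -/(ct T i) -/(ct T j) in h.
rewrite /gfac /kC; move: h; set x := (ct T i - ct T j); clearbody x => h.
rewrite -toC_nat -toC_int -toCM -toCD -toCV -toCM -toCX -toC1 -toCB; apply: toC_gt0.
set z := l.+1%:R + _.
have h1 : `|kappa| < z.
  apply: (@lt_le_trans _ _ (1 - `|kappa * x%:~R|)); first by rewrite ltrBrDl.
  apply: lerD; first by rewrite ler1n.
  by rewrite lerNl -normrN; exact: ler_norm.
have z0 : 0 < z by apply: le_lt_trans h1; exact: normr_ge0.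
rewrite subr_gt0 expr_div_n ltr_pdivrMr ?exprn_gt0 // mul1r -[kappa ^+ 2]real_normK ?num_real //.
by rewrite ltr_pXn2r ?nnegrE ?normr_ge0 ?(ltW z0).
Qed.

Lemma gfac_neq0 l (T : I) i j : gfac kc l.+1 (ct T i - ct T j) != 0.
Proof. by rewrite gt_eqF // gfac_gt0. Qed.

Lemma znormE a T : znorm kappa a T = nzt a T.
Proof.
rewrite /nz -(@gnormE N Cx kc (ct T) a (fun l i j => gfac_neq0 l T i j) (n0 T)).
by [].
Qed.

Lemma nz_gt0 a T : 0 < nzt a T.
Proof.
rewrite /nz mulr_gt0 //; first by apply: toC_gt0; exact: norm0_gt0.
apply: prodr_gt0 => p _; apply: prodr_gt0 => q _; apply: prodr_gt0 => l _.
exact: gfac_gt0.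
Qed.

Lemma coefvE b (p : V) : coefv b p = cf b p.
Proof. by rewrite cfE. Qed.

Lemma cherUE i (p : V) : cherU kappa i p = cherednik rho kc i p.
Proof. by rewrite /cherednik -lock. Qed.

Lemma cmul_scale (x : Cx) (p : V) : x%:MP *: p = cmul x p.
Proof. by rewrite cmulE smulE. Qed.

(** Since [below] implies [jack_lt] or equality, [jack] is a witness for [is_zeta]. The chosen
    [zeta] then has the same spectrum and the same coefficient at x^a, and [Z_uniq] applies. *)
Lemma zetaE a T : zeta kappa a T = Zt a T.
Proof.
have [z1 z2 z3] := ZP hN r1 rM jmE spectral_nondeg a T.
have hz : is_zeta kappa a T (Zt a T).
  split=> [|b|i].
  - by rewrite coefvE.
  - by rewrite coefvE => /z2/below_jack_lt[->|]; [left | right].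
  - by rewrite cherUE z3 cmul_scale.
have [h1 _ h3] := epsilon_spec (inhabits 0) (is_zeta kappa a T) (ex_intro _ _ hz).
apply: (Z_uniq hN r1 rM jmE ev_indep ev_gen spectral_nondeg).
  by rewrite -coefvE.
by move=> i; rewrite -cherUE h3 cmul_scale.
Qed.

Lemma cf_pdeg (p : V) D a : (pdeg p <= D)%N -> cf a p != 0 -> (mdeg a < D)%N.
Proof. by move=> h /cf_msize ha; exact: leq_trans ha h. Qed.

(** The [epsilon] has a witness by the basis property, and independence identifies any choice with
    [coz]. *)
Lemma zcoordE D (p : V) (a : 'X_{1..N < D}) T : (pdeg p <= D)%N ->
  zcoord kappa p a T = coz rho kc (@ev N tau) ct p a T.
Proof.
move=> hD.
have [_ hc] := coz_rep hN r1 rM jmE ev_indep ev_gen spectral_nondeg (fun a => @cf_pdeg p D a hD).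
set P := (fun c : 'X_{1..N < D} -> I -> Cx => p = \sum_(a : 'X_{1..N < D}) \sum_(T : I)
   (c a T)%:MP *: zeta kappa a T).
have sE (c : 'X_{1..N < D} -> I -> Cx) : \sum_(a : 'X_{1..N < D}) \sum_(T : I) (c a T)%:MP *: zeta kappa a T =
   \sum_(a : 'X_{1..N < D}) \sum_T cmul (c a T) (Zt a T).
  by apply: eq_bigr => b _; apply: eq_bigr => S _; rewrite cmul_scale zetaE.
have hP : P (fun a T => coz rho kc (@ev N tau) ct p a T) by rewrite /P sE.
have := epsilon_spec (inhabits (fun _ _ => 0)) P (ex_intro _ _ hP).
rewrite -/(zcoord kappa p); set c := zcoord kappa p; rewrite {1}/P sE => e.
apply/eqP; rewrite -subr_eq0; apply/eqP.
apply: (@Z_free Cx N d hN rho kc r1 rM I (@ev N tau) ct jmE ev_indep spectral_nondeg D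
  (fun b S => c b S - coz rho kc (@ev N tau) ct p b S)).
transitivity (\sum_(a : 'X_{1..N < D}) \sum_T cmul (c a T) (Zt a T) +
    cmul (-1) (\sum_(a : 'X_{1..N < D}) \sum_T cmul (coz rho kc (@ev N tau) ct p a T) (Zt a T))).
  2: by rewrite -e -hc -[X in X + _]cmul1 -cmulDl subrr cmul0l.
rewrite cmul_sum -big_split; apply: eq_bigr => b _.
rewrite cmul_sum -big_split; apply: eq_bigr => S _ /=.
by rewrite cmulA -cmulDl mulN1r.
Qed.

Lemma formTE (p q : V) : formT kappa p q = FTt p q.
Proof.
rewrite /formT.
have hD a : cf a p != 0 -> (mdeg a < maxn (pdeg p) (pdeg q))%N.
  by apply: cf_pdeg; exact: leq_maxl.
rewrite (FT_coz hN r1 rM jmE ev_indep ev_gen spectral_nondeg cj n0 q hD).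
apply: eq_bigr => a _; apply: eq_bigr => T _.
by rewrite !zcoordE ?leq_maxl ?leq_maxr // znormE.
Qed.

Lemma monvE m (T : I) : monv m T = mono m (ev T).
Proof. by rewrite /monv /mono smulE. Qed.

Lemma formT_Cr (p : V) x q : formT kappa p (cmul x q) = x * formT kappa p q.
Proof. rewrite !formTE; exact: (FT_Cr hN r1 rM jmE ev_indep ev_gen spectral_nondeg). Qed.

Lemma formT_Cl (p : V) x q : formT kappa (cmul x p) q = x^* * formT kappa p q.
Proof. rewrite !formTE; exact: (FT_Cl hN r1 rM jmE ev_indep ev_gen spectral_nondeg). Qed.

Lemma formT_sum (J J' : Type) (r : seq J) (r' : seq J') (P : pred J) (P' : pred J') (F : J -> V) (G : J' -> V) :
  formT kappa (\sum_(i <- r | P i) F i) (\sum_(j <- r' | P' j) G j) =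
  \sum_(i <- r | P i) \sum_(j <- r' | P' j) formT kappa (F i) (G j).
Proof.
rewrite formTE (FT_suml hN r1 rM jmE ev_indep ev_gen spectral_nondeg).
apply: eq_bigr => i _; rewrite (FT_sumr hN r1 rM jmE ev_indep ev_gen spectral_nondeg).
by apply: eq_bigr => j _; rewrite formTE.
Qed.

Lemma formT_act w (p q : V) : formT kappa (vact rho w p) (vact rho w q) = formT kappa p q.
Proof.
rewrite !formTE; exact: (FT_act hN r1 rM jmE ev_indep ev_gen spectral_nondeg (cj_toC kappa)
  tau_ev dct_neq0 tsw_content tsw_invol n0_sym n0_neq0 cj_phic).
Qed.

Lemma formT_shift a b c (u v : 'cV[Cx]_d) :
  formT kappa (mono (a + c)%MM u) (mono (b + c)%MM v) = formT kappa (mono a u) (mono b v).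
Proof.
rewrite !formTE; exact: (FT_mono_shift hN r1 rM jmE ev_indep ev_gen spectral_nondeg (cj_toC kappa)
  tau_ev dct_neq0 tsw_content tsw_invol n0_sym n0_neq0 cj_phic).
Qed.

Lemma formT_deg a b (u v : 'cV[Cx]_d) : mdeg a != mdeg b ->
  formT kappa (mono a u) (mono b v) = 0.
Proof.
by move=> h; rewrite formTE; apply: (FT_mono_deg hN r1 rM jmE ev_indep ev_gen spectral_nondeg).
Qed.

Lemma mono0 (v : 'cV[Cx]_d) : mono 0%MM v = cst N v.
Proof. by apply: cf_eq => m; rewrite cf_mono cf_cst. Qed.

Lemma formT_cst (T S : I) :
  formT kappa (mono 0%MM (ev T)) (mono 0%MM (ev S)) = (T == S)%:R * toC (norm0 T).
Proof.
rewrite formTE !mono0; exact: (FT_cst hN r1 rM jmE ev_indep ev_gen spectral_nondeg).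
Qed.

Lemma formT_herm (p q : V) : formT kappa q p = (formT kappa p q)^*.
Proof.
rewrite !formTE; apply: (FT_herm hN r1 rM jmE ev_indep ev_gen spectral_nondeg (cj := cj)).
  by move=> x; exact: conjCK.
by move=> a T; apply: geC0_conj; apply: ltW; exact: nz_gt0.
Qed.

Lemma formT_ge0 (p : V) : 0 <= formT kappa p p.
Proof.
have hD a : cf a p != 0 -> (mdeg a < pdeg p)%N by apply: cf_pdeg.
rewrite formTE (FT_coz hN r1 rM jmE ev_indep ev_gen spectral_nondeg cj n0 p hD).
apply: sumr_ge0 => a _; apply: sumr_ge0 => T _; apply: mulr_ge0; last exact: ltW (nz_gt0 _ _).
by rewrite mulrC; exact: mul_conjC_ge0.
Qed.

End TorusForm.


(** * The kernels as Gram matrices *)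

Section DifferenceCount.
Variables (N : nat) (N0 : (0 < N)%N).
Implicit Types (g : 'I_N -> int).

Lemma card_mdeg n e : (e <= n)%N ->
  #|[pred c : 'X_{1..N < n.+1} | mdeg c == e]| = 'C(e + N.-1, e).
Proof.
move=> en; have := size_basis N.-1 e; rewrite prednK // => <-.
rewrite cardE -(size_map (@bmnm N n.+1)); apply: perm_size; apply: uniq_perm.
- by rewrite map_inj_uniq ?enum_uniq //; exact: val_inj.
- exact: uniq_basis.
move=> m; rewrite -basis_cover; apply/mapP/eqP => [[c]|hm].
  by rewrite mem_enum inE => /eqP hc ->.
have hb : (mdeg m < n.+1)%N by rewrite hm ltnS.
by exists (BMultinom hb) => //; rewrite mem_enum inE /= hm.
Qed.

Lemma posmE g i : posm g i = absz (Num.max (g i) 0). Proof. by rewrite mnmE. Qed.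
Lemma negmE g i : negm g i = absz (Num.max (- g i) 0). Proof. by rewrite mnmE. Qed.

Lemma posm_negm g i : (posm g i)%:Z - (negm g i)%:Z = g i.
Proof. by rewrite posmE negmE; lia. Qed.

Lemma posm_add_negm g i : (posm g i + negm g i)%N = absz (g i).
Proof. by rewrite posmE negmE; lia. Qed.

Lemma mdeg_posm m g : inZNm m g -> mdeg (posm g) = m /\ mdeg (negm g) = m.
Proof.
case/andP=> /eqP h1 /eqP h2.
have e1 : (mdeg (posm g) + mdeg (negm g) = 2 * m)%N.
  by rewrite !mdegE -big_split -h2; apply: eq_bigr => i _; exact: posm_add_negm.
have e2 : (mdeg (posm g))%:Z - (mdeg (negm g))%:Z = 0.
  rewrite -h1 !mdegE !(big_morph Posz PoszD (erefl _)) -sumrB.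
  by apply: eq_bigr => i _; exact: posm_negm.
lia.
Qed.

Lemma diff_split (a b : 'X_{1..N}) g : (forall i, (a i)%:Z - (b i)%:Z = g i) ->
  exists c, (a = posm g + c)%MM /\ (b = negm g + c)%MM.
Proof.
move=> h; exists [multinom minn (a i) (b i) | i < N].
by split; apply/mnmP=> i; rewrite mnmDE ?posmE ?negmE -h mnmE; lia.
Qed.

(** The pairs with difference [g] are (posm g + c, negm g + c), where [c] runs over the exponents of
    degree n - m. *)
Lemma card_diff n m g : (m <= n)%N -> inZNm m g ->
  #|[pred p : 'X_{1..N < n.+1} * 'X_{1..N < n.+1} |
     [&& mdeg p.1 == n, mdeg p.2 == n & [forall i, (p.1 i)%:Z - (p.2 i)%:Z == g i]]]| =
  'C(n - m + N.-1, n - m).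
Proof.
move=> mn hg; have [dp dn] := mdeg_posm hg.
rewrite -(@card_mdeg n) ?leq_subr //.
pose z : 'X_{1..N < n.+1} := bm0.
pose bm (x : 'X_{1..N}) : 'X_{1..N < n.+1} := insubd z x.
pose A := [set c : 'X_{1..N < n.+1} | mdeg c == (n - m)%N].
pose f (c : 'X_{1..N < n.+1}) := (bm (posm g + c)%MM, bm (negm g + c)%MM).
have fE c : c \in A -> val (bm (posm g + c)%MM) = (posm g + c)%MM /\
                       val (bm (negm g + c)%MM) = (negm g + c)%MM.
  rewrite inE => /eqP hc; rewrite /bm !val_insubd !mdegD hc dp dn subnKC //.
  by rewrite ltnSn.
transitivity #|f @: A|.
  apply: eq_card => -[a b]; rewrite inE /=; apply/idP/imsetP.
    case/and3P=> /eqP ha /eqP hb /forallP hd.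
    have hd' i : (a i)%:Z - (b i)%:Z = g i by apply/eqP.
    have [c [ea eb]] := diff_split hd'.
    have hc : mdeg c = (n - m)%N by move: ha; rewrite ea mdegD dp; lia.
    have hcn : (mdeg c < n.+1)%N by rewrite hc ltnS leq_subr.
    have hA : BMultinom hcn \in A by rewrite inE /= hc.
    exists (BMultinom hcn) => //; have [f1 f2] := fE _ hA.
    by congr (_, _); apply: val_inj; rewrite ?f1 ?f2.
  case=> c hc [-> ->]; have [f1 f2] := fE _ hc.
  have [f1' f2'] : (bm (posm g + c)%MM = (posm g + c)%MM :> 'X_{1..N}) *
                   (bm (negm g + c)%MM = (negm g + c)%MM :> 'X_{1..N}) by split.
  rewrite f1' f2' !mdegD dp dn; move: hc; rewrite inE => /eqP ->.
  rewrite subnKC // eqxx /=; apply/forallP => i; rewrite !mnmDE.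
  by rewrite -[g i](posm_negm g); apply/eqP; lia.
rewrite card_in_imset; first by apply: eq_card => c; rewrite !inE.
move=> c c' hc hc' [e _]; have [f1 _] := fE _ hc; have [f1' _] := fE _ hc'.
apply: val_inj; have : (posm g + c = posm g + c')%MM by rewrite -f1 -f1' /= e.
by move/mnmP=> h; apply/mnmP=> i; have := h i; rewrite !mnmDE => /addnI.
Qed.

Lemma inZNm_le m g i : inZNm m g -> (absz (g i) <= 2 * m)%N.
Proof. by case/andP=> _ /eqP <-; rewrite (bigD1 i) //= leq_addr. Qed.

Lemma inZNm_ext m g g' : g =1 g' -> inZNm m g = inZNm m g'.
Proof.
move=> h; rewrite /inZNm (eq_bigr _ (fun i _ => h i)).
by rewrite (eq_bigr (fun i => absz (g' i))) // => i _; rewrite h.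
Qed.

Lemma inZNm_posm g : \sum_i g i = 0 -> inZNm (mdeg (posm g)) g.
Proof.
move=> h; rewrite /inZNm h eqxx /=; apply/eqP.
have e1 : (\sum_(i < N) `|g i|%N = mdeg (posm g) + mdeg (negm g))%N.
  by rewrite !mdegE -big_split /=; apply: eq_bigr => i _; rewrite posm_add_negm.
have e2 : (mdeg (posm g))%:Z - (mdeg (negm g))%:Z = 0.
  rewrite -h !mdegE !(big_morph Posz PoszD (erefl _)) -sumrB.
  by apply: eq_bigr => i _; exact: posm_negm.
by rewrite e1; lia.
Qed.

(** Isolates the single term of frequency [g]: the degree is determined by [g], and the code is
    unique because |g_i| <= 2m makes the shifted value admissible. *)
Lemma shiftg_pick (V : nmodType) n m0 g (F : nat -> ('I_N -> int) -> V) :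
  inZNm m0 g -> (m0 <= n)%N ->
  \sum_(m < n.+1) \sum_(k : {ffun 'I_N -> 'I_(4 * m).+1} | inZNm m (shiftg k))
     (if [forall i, g i == shiftg k i] then F m (shiftg k) else 0) = F m0 g.
Proof.
move=> hin hm0; have hm0' : (m0 < n.+1)%N by [].
have hki i : (absz (g i + (2 * m0)%:Z)%R < (4 * m0).+1)%N by have := inZNm_le i hin; lia.
pose k0 : {ffun 'I_N -> 'I_(4 * m0).+1} := [ffun i => Ordinal (hki i)].
have hk0 : shiftg k0 = g.
  apply: functional_extensionality => i.
  by rewrite /shiftg ffunE /=; have := inZNm_le i hin; lia.
rewrite (bigD1 (Ordinal hm0')) //= [X in _ + X]big1 ?addr0; last first.
  move=> m nm; rewrite big1 // => k hk; case: ifP => // /forallP he.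
  case/eqP: nm; apply: val_inj => /=.
  have : inZNm m g by rewrite (@inZNm_ext m _ (shiftg k)) // => i; apply/eqP.
  by case/mdeg_posm => <- _; case/mdeg_posm: hin.
rewrite (bigD1 k0) /=; last by rewrite hk0.
rewrite ifT; last by apply/forallP=> i; rewrite hk0.
rewrite hk0 big1 ?addr0 // => k /andP[_ nk]; case: ifP => // /forallP he.
case/eqP: nk; apply/ffunP=> i; apply: val_inj.
by have := he i; rewrite -hk0 /shiftg => /eqP /=; lia.
Qed.

Lemma gram_regroup (V : nmodType) n (F : ('I_N -> int) -> V) :
  \sum_(p : 'X_{1..N < n.+1} * 'X_{1..N < n.+1} | (mdeg p.1 == n) && (mdeg p.2 == n))
     F (fun i => (p.1 i)%:Z - (p.2 i)%:Z) =
  \sum_(m < n.+1) (\sum_(k : {ffun 'I_N -> 'I_(4 * m).+1} | inZNm m (shiftg k))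
     F (shiftg k)) *+ 'C(n - m + N.-1, n - m).
Proof.
pose X := 'X_{1..N < n.+1}.
pose df (p : X * X) : 'I_N -> int := fun i => (p.1 i)%:Z - (p.2 i)%:Z.
pose Q (p : X * X) := (mdeg p.1 == n) && (mdeg p.2 == n).
pose eqk m (k : {ffun 'I_N -> 'I_(4 * m).+1}) (p : X * X) := [forall i, df p i == shiftg k i].
have step1 p : Q p -> F (df p) =
   \sum_(m < n.+1) \sum_(k : {ffun 'I_N -> 'I_(4 * m).+1} | inZNm m (shiftg k))
     (if eqk m k p then F (shiftg k) else 0).
  case/andP=> /eqP h1 /eqP h2.
  have [c [e1 _]] := @diff_split p.1 p.2 (df p) (fun i => erefl _).
  have hs : \sum_i df p i = 0.
    by rewrite /df sumrB -!(big_morph Posz PoszD (erefl _)) -!mdegE h1 h2 subrr.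
  rewrite (shiftg_pick (fun => F) (inZNm_posm hs)) //.
  by have := congr1 (@mdeg N) e1; rewrite mdegD h1; lia.
rewrite (eq_bigr _ step1) exchange_big /=; apply: eq_bigr => m _.
rewrite exchange_big /= -sumrMnl; apply: eq_bigr => k hk.
rewrite -big_mkcondr sumr_const; congr (_ *+ _).
have mn : (m <= n)%N by rewrite -ltnS ltn_ord.
rewrite -(card_diff mn hk).
by apply: eq_card => p; rewrite -!topredE /= -andbA.
Qed.

End DifferenceCount.

(** Both sides are multiplied by (n - m) / (n - m + N - 1) when [m] grows by one. *)
Lemma poch_ratio (N n m : nat) : (0 < N)%N -> (m <= n)%N ->
  poch (- n%:R) m / poch (1 - N%:R - n%:R) m =
  'C(n - m + N.-1, n - m)%:R / 'C(n + N.-1, n)%:R.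
Proof.
case: N => // M _; rewrite succnK.
have key k : (k < n)%N ->
   (n - k)%:R * 'C(n - k + M, n - k)%:R = (n - k + M)%:R * 'C(n - k.+1 + M, n - k.+1)%:R :> Cx.
  move=> hk; rewrite -!natrM; congr (_%:R).
  have -> : (n - k = (n - k.+1).+1)%N by lia.
  by rewrite -mul_bin_diag addSn.
have C0 k : 'C(k + M, k)%:R != 0 :> Cx by rewrite pnatr_eq0 -lt0n bin_gt0 leq_addr.
elim: m => [|m IH] hm; first by rewrite /poch !big_ord0 subn0 !divff ?oner_neq0.
have hm' : (m <= n)%N by lia.
rewrite /poch !big_ord_recr /= -/(poch _ m) -/(poch _ m) -mulf_div IH //.
have h := key m hm.
have e1 : - n%:R + m%:R = - (n - m)%:R :> Cx by rewrite natrB //; ring.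
have e2 : 1 - M.+1%:R - n%:R + m%:R = - (n - m + M)%:R :> Cx.
  by rewrite natrD natrB // -natr1; ring.
rewrite e1 e2 invrN mulrNN.
have d0 : (n - m + M)%:R != 0 :> Cx by rewrite pnatr_eq0; lia.
rewrite mulrAC; congr (_ / _); rewrite mulrA [X in X / _]mulrC h mulrC mulKf //.
Qed.


Lemma conjmx_fixed (K : fieldType) m (A M : 'M[K]_m) :
  A \in unitmx -> M = invmx A *m M *m A -> M *m A = A *m M.
Proof. by move=> uA h; rewrite [in RHS]h !mulmxA mulmxV // mul1mx. Qed.

(** * Positivity and equivariance of the kernels *)

Section GramKernel.
Variables (N : nat) (tau : seq nat) (kappa : R).
Hypothesis hN : (0 < N)%N.
Hypothesis htau : is_partition N tau.
Hypothesis hkap : - ((h_tau tau)%:R)^-1 < kappa < ((h_tau tau)%:R)^-1.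

Local Notation d := (dimV N tau).
Local Notation V := (PV N tau).
Local Notation rho := (@tauM N tau).
Local Notation cV := 'cV[Cx]_d.
Local Notation form := (@formT N tau kappa).

Definition sC (i : 'I_d) : Cx := toC (Num.sqrt (norm0 (tabi i))).

Lemma sC_gt0 i : 0 < sC i.
Proof. by apply: toC_gt0; rewrite sqrtr_gt0 norm0_gt0. Qed.
Lemma sC_neq0 i : sC i != 0. Proof. by rewrite gt_eqF // sC_gt0. Qed.
Lemma sC_conj i : (sC i)^* = sC i. Proof. exact: conj_toC. Qed.
Lemma sC_sq i : sC i * sC i = toC (norm0 (tabi i)).
Proof. by rewrite /sC -toCM -expr2 sqr_sqrtr // ltW // norm0_gt0. Qed.
Lemma sC_mul i j : toC (Num.sqrt (norm0 (tabi i) * norm0 (tabi j))) = sC i * sC j.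
Proof. by rewrite sqrtrM ?toCM // ltW // norm0_gt0. Qed.

(* From orthonormal coordinates to coordinates in the basis of tableaux. *)
Definition unscale (v : cV) : cV := \col_i (v i 0 / sC i).

Definition qf (u : cV) (M : 'M[Cx]_d) (v : cV) : Cx := (ctr u *m M *m v) 0 0.

Lemma qfE u M v : qf u M v = \sum_i \sum_j (u i 0)^* * M i j * v j 0.
Proof.
rewrite /qf mxE exchange_big /=; apply: eq_bigr => j _; rewrite !mxE mulr_suml.
by apply: eq_bigr => i _; rewrite !mxE.
Qed.

Lemma qfD u v : {morph qf u ^~ v : M M' / M + M'}.
Proof. by move=> M M'; rewrite /qf mulmxDr mulmxDl mxE. Qed.
Lemma qf0 u v : qf u 0 v = 0. Proof. by rewrite /qf mulmx0 mul0mx mxE. Qed.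
Lemma qf_sum u v (J : Type) (r : seq J) (P : pred J) (F : J -> 'M[Cx]_d) :
  qf u (\sum_(i <- r | P i) F i) v = \sum_(i <- r | P i) qf u (F i) v.
Proof. by apply: (big_morph (qf u ^~ v)); [exact: qfD | exact: qf0]. Qed.
Lemma qfZ u v x M : qf u (x *: M) v = x * qf u M v.
Proof. by rewrite /qf -scalemxAr -scalemxAl mxE. Qed.

Lemma qf_delta M i j : qf (delta_mx i 0) M (delta_mx j 0) = M i j.
Proof.
rewrite qfE (bigD1 i) //= (bigD1 j) //= !mxE !eqxx /= rmorph1 mul1r mulr1.
rewrite [X in _ + X + _]big1 ?addr0 => [|k /negPf nk]; last by rewrite !mxE nk mulr0.
rewrite big1 ?addr0 // => k /negPf nk; rewrite big1 // => l _.
by rewrite !mxE nk rmorph0 !mul0r.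
Qed.

Lemma qf_inj M M' : (forall u v, qf u M v = qf u M' v) -> M = M'.
Proof. by move=> h; apply/matrixP=> i j; rewrite -!qf_delta h. Qed.

Lemma mono_unscale a v : mono a (unscale v) =
  \sum_(i < d) cmul (v i 0 / sC i) (monv a (tabi i)) :> V.
Proof.
apply: cf_eq => m; rewrite cf_sum cf_mono.
rewrite (eq_bigr (fun i => (m == a)%:R *: ((v i 0 / sC i) *: ev (tabi i)))); last first.
  by move=> i _; rewrite monvE cfC cf_mono !scalerA mulrC.
rewrite -scaler_sumr; congr (_ *: _); apply/colP=> j.
rewrite summxE (bigD1 j) //= !mxE eqxx mulr1 big1 ?addr0 // => i ni.
rewrite !mxE (inj_eq enum_val_inj) eq_sym (negPf ni) mulr0 //.
Qed.

Lemma Amat_form g u v : qf u (Amat tau kappa g) v =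
  form (mono (posm g) (unscale u)) (mono (negm g) (unscale v)).
Proof.
rewrite !mono_unscale (formT_sum hN htau hkap) qfE; apply: eq_bigr => i _.
apply: eq_bigr => j _; rewrite (formT_Cl hN htau hkap) (formT_Cr hN htau hkap) mxE.
rewrite sC_mul rmorphM fmorphV /= sC_conj invfM.
by move: (form _ _) => z; field; rewrite !sC_neq0.
Qed.

Lemma Amat_diff (a b : 'X_{1..N}) u v :
  qf u (Amat tau kappa (fun i => (a i)%:Z - (b i)%:Z)) v = form (mono a (unscale u)) (mono b (unscale v)).
Proof.
have [c [e1 e2]] := @diff_split N hN a b _ (fun i => erefl _).
rewrite Amat_form -(formT_shift hN htau hkap _ _ c); congr (form (mono _ _) (mono _ _)).
  exact: esym e1.
exact: esym e2.
Qed.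

Definition xpow (x : 'I_N -> Cx) (a : 'X_{1..N}) : Cx := \prod_i x i ^+ a i.

Lemma torus_conj (x : 'I_N -> Cx) : onTorus x -> forall i, x i != 0 /\ (x i)^* = (x i)^-1.
Proof.
move=> hx i; have h : x i * (x i)^* = 1.
  have := hx i; rewrite /cabs; case: (x i) => re im /= /(congr1 (fun t => t ^+ 2)).
  rewrite sqr_sqrtr ?addr_ge0 ?sqr_ge0 // expr1n => h.
  apply/eqP; rewrite eq_complex /= -h; apply/andP; split; apply/eqP; ring.
have x0 : x i != 0 by apply/eqP=> e; move/eqP: h; rewrite e mul0r eq_sym oner_eq0.
by split=> //; apply: (mulfI x0); rewrite h divff.
Qed.

Lemma xpow_conj (x : 'I_N -> Cx) a : onTorus x -> ((xpow x a)^-1)^* = xpow x a.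
Proof.
move=> hx; rewrite fmorphV rmorph_prod -prodfV; apply: eq_bigr => i _ /=.
by rewrite rmorphXn /= (torus_conj hx i).2 exprVn invrK.
Qed.

Lemma xmon_diff x (a b : 'X_{1..N}) : onTorus x ->
  xmon x (fun i => (a i)%:Z - (b i)%:Z) = xpow x a / xpow x b.
Proof.
move=> hx; rewrite /xmon /xpow -prodfV -big_split; apply: eq_bigr => i _ /=.
by rewrite expfzDr ?(torus_conj hx i).1 // -invr_expz.
Qed.

Definition kpol n x (v : cV) : V :=
  \sum_(a : 'X_{1..N < n.+1} | mdeg a == n) cmul (xpow x a)^-1 (mono a (unscale v)).

(** The factor C(n+N-1, n) clears the denominator in [poch_ratio]; what remains in degree m is the
    multiplicity found by [gram_regroup] when the pairs of exponents are sorted by their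
    difference. *)
Lemma Kn_form n (x : 'I_N -> Cx) u v : onTorus x ->
  'C(n + N.-1, n)%:R * qf u (Kn tau kappa n x) v = form (kpol n x u) (kpol n x v).
Proof.
move=> hx.
have C0 : 'C(n + N.-1, n)%:R != 0 :> Cx by rewrite pnatr_eq0 -lt0n bin_gt0 leq_addr.
pose F g := xmon x g * qf u (Amat tau kappa g) v.
transitivity (\sum_(m < n.+1) (\sum_(k : {ffun 'I_N -> 'I_(4 * m).+1} | inZNm m (shiftg k))
     F (shiftg k)) *+ 'C(n - m + N.-1, n - m)).
  rewrite /Kn qf_sum mulr_sumr; apply: eq_bigr => m _.
  have mn : (m <= n)%N by have := ltn_ord m.
  rewrite qfZ (poch_ratio hN mn) /Hm qf_sum.
  rewrite (eq_bigr (fun k => F (shiftg k))); last by move=> k _; rewrite qfZ.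
  by rewrite -[RHS]mulr_natl mulrA [X in X * _]mulrC divfK.
rewrite -(gram_regroup hN) /kpol (formT_sum hN htau hkap) pair_big /=; apply: eq_bigr => -[a b] _ /=.
rewrite (formT_Cl hN htau hkap) (formT_Cr hN htau hkap) xpow_conj // /F xmon_diff // Amat_diff.
by rewrite mulrA.
Qed.

Lemma binC_gt0 n : 0 < 'C(n + N.-1, n)%:R :> Cx.
Proof. by rewrite ltr0n bin_gt0 leq_addr. Qed.

Lemma binC_neq0 n : 'C(n + N.-1, n)%:R != 0 :> Cx.
Proof. by rewrite gt_eqF // binC_gt0. Qed.

Lemma Kn_herm n (x : 'I_N -> Cx) u v : onTorus x -> qf v (Kn tau kappa n x) u = (qf u (Kn tau kappa n x) v)^*.
Proof.
move=> hx; apply: (mulfI (binC_neq0 n)).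
by rewrite Kn_form // (formT_herm hN htau hkap) -Kn_form // rmorphM /= rmorph_nat.
Qed.

Lemma qf_ctr u M v : qf u (ctr M) v = (qf v M u)^*.
Proof.
rewrite !qfE rmorph_sum exchange_big /=; apply: eq_bigr => i _.
rewrite rmorph_sum; apply: eq_bigr => j _; rewrite !mxE !rmorphM /= conjCK; ring.
Qed.

Lemma Kn_psd n (x : 'I_N -> Cx) : onTorus x -> psd (Kn tau kappa n x).
Proof.
move=> hx; split; first by apply: qf_inj => u v; rewrite qf_ctr Kn_herm // conjCK.
move=> v; rewrite -/(qf v _ v) -(pmulr_rge0 _ (binC_gt0 n)) Kn_form //.
exact: (formT_ge0 hN htau hkap).
Qed.

Lemma tauO_unscale (w : {perm 'I_N}) v : unscale (tauO tau w *m v) = rho w *m unscale v.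
Proof.
apply/colP=> i; rewrite !mxE mulr_suml; apply: eq_bigr => j _.
rewrite !mxE -/(sC i) -/(sC j); move: (rho w i j) (v j 0) => y z.
by field; rewrite !sC_neq0.
Qed.

(** w permutes the exponents of the monomials in the polynomial variable; reindexing the sum
    transfers the permutation to the point [x]. *)
Lemma act_kpol (w : {perm 'I_N}) n (x : 'I_N -> Cx) v : onTorus x ->
  vact rho w (kpol n (fun i => x (w i)) v) = kpol n x (tauO tau w *m v).
Proof.
move=> hx; rewrite /kpol.
have aS := big_morph (vact rho w) (vactD rho w) (_ : vact rho w 0 = 0).
rewrite aS; last first.
  have := vactC rho w 0 (0 : V); rewrite -!cmulE !cmul0l //.
pose bm (u : {perm 'I_N}) (a : 'X_{1..N < n.+1}) : 'X_{1..N < n.+1} :=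
  @BMultinom N n.+1 (mnact u a) (eq_ind_r (fun k => (k < n.+1)%N) (bmdeg a) (mdeg_mnact u a)).
have bmI u : injective (bm u).
  move=> a b /(congr1 val) /= e; apply: val_inj => /=.
  by rewrite -[val a]mnact1 -(mulVg u) -mnact_mnact e mnact_mnact mulVg mnact1.
rewrite (reindex_inj (bmI w)) /=; apply: eq_big => [a|a _]; first by rewrite mdeg_mnact.
rewrite cmulE vactC -cmulE act_mono mnact_mnact mulVg mnact1 tauO_unscale.
congr (cmul _^-1 _); rewrite /xpow [RHS](reindex_inj (@perm_inj _ w)) /=.
by apply: eq_bigr => i _; rewrite mnactE.
Qed.

Lemma Kn_equivariant (w : {perm 'I_N}) n (x : 'I_N -> Cx) : onTorus x ->
  Kn tau kappa n (fun i => x (w i)) = ctr (tauO tau w) *m Kn tau kappa n x *m tauO tau w.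
Proof.
move=> hx; have hxw : onTorus (fun i => x (w i)) by move=> i; exact: hx.
apply: qf_inj => u v; apply: (mulfI (binC_neq0 n)).
rewrite Kn_form // -(formT_act hN htau hkap w) !act_kpol // -Kn_form //; congr (_ * _).
by rewrite /qf /ctr map_mxM trmx_mul !mulmxA.
Qed.

(** On constants the form is the standard inner product in orthonormal coordinates, so unitarity is
    the invariance of the form under permutations restricted to constants. *)
Lemma tauO_unitary (w : {perm 'I_N}) : ctr (tauO tau w) *m tauO tau w = 1%:M.
Proof.
have E u v : form (mono 0%MM (unscale u)) (mono 0%MM (unscale v)) = qf u 1%:M v.
  rewrite !mono_unscale (formT_sum hN htau hkap) qfE; apply: eq_bigr => i _.
  apply: eq_bigr => j _; rewrite (formT_Cl hN htau hkap) (formT_Cr hN htau hkap) !monvE.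
  rewrite (formT_cst hN htau hkap) (inj_eq enum_val_inj) mxE rmorphM fmorphV /= sC_conj.
  case: eqP => [<-|_]; last by rewrite !(mul0r, mulr0).
  by rewrite mul1r -sC_sq mulr1; move: (u i 0)^* (v i 0) => y z; field; rewrite sC_neq0.
apply: qf_inj => u v; rewrite -E -(formT_act hN htau hkap w) !act_mono.
have -> : mnact w^-1 0%MM = 0%MM :> 'X_{1..N} by apply/mnmP=> i; rewrite mnactE !mnm0E.
by rewrite -!tauO_unscale E /qf /ctr map_mxM trmx_mul !mulmxA mulmx1.
Qed.

Lemma tauO_inv (w : {perm 'I_N}) : invmx (tauO tau w) = ctr (tauO tau w) /\ tauO tau w \in unitmx.
Proof.
have h := tauO_unitary w; have [_ hu] := mulmx1_unit h.
by split=> //; rewrite -[LHS]mul1mx -h mulmxK.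
Qed.

Lemma Kn_conj (w : {perm 'I_N}) n (x : 'I_N -> Cx) : onTorus x ->
  Kn tau kappa n (fun i => x (w i)) = invmx (tauO tau w) *m Kn tau kappa n x *m tauO tau w.
Proof. by move=> hx; have [-> _] := tauO_inv w; rewrite Kn_equivariant. Qed.

Lemma xmon_scale (x : 'I_N -> Cx) (c : Cx) g : c != 0 -> (forall i, x i != 0) ->
  \sum_(i < N) g i = 0 -> xmon (fun i => c * x i) g = xmon x g.
Proof.
move=> c0 x0 hg; rewrite /xmon.
under eq_bigr => i _ do rewrite (@exprzMl _ c (x i) (g i)) ?unitfE //.
rewrite big_split /= -[RHS]mul1r; congr (_ * _).
have -> : \prod_(i < N) c ^ g i = c ^ (\sum_(i < N) g i).
  by apply/esym/(big_morph (fun z => c ^ z)) => // y z; exact: expfzDr.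
by rewrite hg expr0z.
Qed.

Lemma Hm_scale m (x : 'I_N -> Cx) (c : Cx) : c != 0 -> (forall i, x i != 0) ->
  Hm tau kappa m (fun i => c * x i) = Hm tau kappa m x.
Proof.
move=> c0 x0; rewrite /Hm; apply: eq_bigr => k /andP[/eqP hk _].
by rewrite (xmon_scale c0 x0 hk).
Qed.

Lemma Kn_scale n (x : 'I_N -> Cx) (c : Cx) : c != 0 -> (forall i, x i != 0) ->
  Kn tau kappa n (fun i => c * x i) = Kn tau kappa n x.
Proof. by move=> c0 x0; rewrite /Kn; apply: eq_bigr => m _; rewrite Hm_scale. Qed.

Lemma expiD s t : expi (s + t)%R = expi s * expi t.
Proof.
rewrite /expi cos_plus sin_plus; apply/eqP; rewrite eq_complex /=; apply/andP; split => //.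
by rewrite addrC.
Qed.

Lemma expi0 : expi 0 = 1. Proof. by rewrite /expi cos_0 sin_0. Qed.

Lemma expi_nat n t : expi t ^+ n = expi (n%:R * t)%R.
Proof.
elim: n => [|n IH]; first by rewrite expr0 mul0r expi0.
by rewrite exprS IH -expiD -natr1 mulrDl mul1r addrC.
Qed.

Lemma cabs_expi t : cabs (expi t) = 1.
Proof.
rewrite /cabs /=; have := sin2_cos2 t; rewrite /Rsqr => h.
by rewrite (_ : _ + _ = 1) ?sqrtr1 // -[RHS]h !expr2 addrC.
Qed.

Lemma omega_N : omega N ^+ N = 1.
Proof.
rewrite /omega expi_nat.
have N0 : N%:R != 0 :> R by rewrite pnatr_eq0 -lt0n.
have -> : N%:R * (2 * PI / N%:R)%R = 2 * PI by field.
by rewrite /expi cos_2PI sin_2PI.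
Qed.

Lemma w0E (i : 'I_N) : val (w0 N i) = (i.+1 %% N)%N.
Proof.
rewrite /w0; case: pickP => [s /forallP/(_ i)/eqP //|/(_ (perm (@ordS_inj N)))].
by move/negP; case; apply/forallP=> k; rewrite permE.
Qed.

Lemma Kn_x0 n : Kn tau kappa n (@x0 N) *m tauO tau (w0 N) = tauO tau (w0 N) *m Kn tau kappa n (@x0 N).
Proof.
have hx : onTorus (@x0 N) by move=> i; rewrite /x0 /omega expi_nat cabs_expi.
have x0n (i : 'I_N) : x0 i != 0 by case: (torus_conj hx i).
have o0 : omega N != 0.
  by apply/eqP=> h; have := omega_N; rewrite h expr0n; case: (N) hN => // m _ /eqP; rewrite eq_sym oner_eq0.
have e : Kn tau kappa n (fun i => x0 (w0 N i)) = Kn tau kappa n (@x0 N).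
  rewrite -(Kn_scale n o0 x0n); congr (Kn _ _ _); apply: functional_extensionality => i; rewrite /x0 w0E -exprS.
  by rewrite [in RHS](divn_eq i.+1 N) exprD mulnC exprM omega_N expr1n mul1r.
have [_ hu] := tauO_inv (w0 N).
by apply: (conjmx_fixed hu); rewrite -[LHS]e Kn_conj.
Qed.

End GramKernel.


(** * Integration on the torus *)

Section IteratedIntegral.
Implicit Types (G : (nat -> R) -> R) (a b : nat -> R).

(** One modulus serves for all angles, so that fixing a coordinate preserves it and each inner
    integral is again continuous in the fixed angle. *)
Definition unif_cont G := forall e : R, 0 < e -> exists2 d : R, 0 < d &
  forall a b, (forall j, `|a j - b j| < d) -> `|G a - G b| < e.

Definition subst_at k (t : R) a : nat -> R := fun j => if j == k then t else a j.

Lemma iter_intS k G : iter_int k.+1 G =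
  RInt (fun t => iter_int k (fun a => G (subst_at k t a))) 0 (2 * PI) / (2 * PI).
Proof. by []. Qed.

Lemma unif_cont_cst c : unif_cont (fun => c).
Proof. by move=> e e0; exists 1 => // a b _; rewrite subrr normr0. Qed.

Lemma unif_cont_lin c G G' : unif_cont G -> unif_cont G' ->
  unif_cont (fun a => c * G a + G' a).
Proof.
move=> hG hG' e e0; have c1 : 0 < `|c| + 1 by rewrite ltr_wpDl.
have [d1 d10 h1] := hG (e / 2 / (`|c| + 1)) ltac:(by rewrite !divr_gt0).
have [d2 d20 h2] := hG' (e / 2) ltac:(by rewrite divr_gt0).
exists (Num.min d1 d2) => [|a b hab]; first by rewrite lt_min d10.
have {}h1 : `|G a - G b| < e / 2 / (`|c| + 1).
  by apply: h1 => j; have := hab j; rewrite lt_min => /andP[].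
have {}h2 : `|G' a - G' b| < e / 2.
  by apply: h2 => j; have := hab j; rewrite lt_min => /andP[].
have -> : c * G a + G' a - (c * G b + G' b) = c * (G a - G b) + (G' a - G' b) by ring.
apply: (le_lt_trans (ler_normD _ _)); rewrite normrM.
have h3 : `|c| * `|G a - G b| <= e / 2.
  move: h1; rewrite ltr_pdivlMr // => /ltW; apply: le_trans.
  by rewrite mulrC ler_wpM2l // lerDl.
by move: h2 h3; lra.
Qed.

Lemma unif_cont_subst k t G : unif_cont G -> unif_cont (fun a => G (subst_at k t a)).
Proof.
move=> hG e /hG[d d0 h]; exists d => // a b hab; apply: h => j.
by rewrite /subst_at; case: eqP => _ //; rewrite subrr normr0.
Qed.

Lemma PI2_gt0 : 0 < 2 * PI :> R.
Proof. by rewrite mulr_gt0 //; apply/RltP; exact: PI_RGT_0. Qed.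

Lemma ex_RInt_unif (F : R -> R) :
  (forall e : R, 0 < e -> exists2 d : R, 0 < d & forall s t, `|s - t| < d -> `|F s - F t| < e) ->
  ex_RInt F 0 (2 * PI).
Proof.
move=> hF; apply: ex_RInt_continuous => z _; apply/continuity_pt_filterlim => e /RltP e0.
have [d d0 h] := hF e e0; exists d; split; first exact/RltP.
move=> x [_ /RltP hx]; apply/RltP; rewrite /= /R_dist RabsE; apply: h.
by move: hx; rewrite /= /R_dist RabsE.
Qed.

(** Constants, linearity and monotonicity are proved together: at level k they yield the continuity
    of the inner integral, hence the existence of the outer one at level k+1. *)
Lemma iter_int_props k :
  [/\ forall c, iter_int k (fun => c) = c,
      forall c G G', unif_cont G -> unif_cont G' ->
        iter_int k (fun a => c * G a + G' a) = c * iter_int k G + iter_int k G' &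
      forall G G', unif_cont G -> unif_cont G' -> (forall a, G a <= G' a) ->
        iter_int k G <= iter_int k G'].
Proof.
elim: k => [|k [IHc IHl IHm]].
  by split=> // G G' _ _ h; apply: h.
have PI0 : 2 * PI != 0 :> R by rewrite gt_eqF // PI2_gt0.
have exI G : unif_cont G ->
    ex_RInt (fun t => iter_int k (fun a => G (subst_at k t a))) 0 (2 * PI).
  move=> hG; apply: ex_RInt_unif => e e0.
  have [d d0 h] := hG (e / 2) ltac:(by rewrite divr_gt0); exists d => // s t hst.
  have near u v : `|u - v| < d -> iter_int k (fun a => G (subst_at k u a)) <=
      e / 2 + iter_int k (fun a => G (subst_at k v a)).
    move=> huv; rewrite -{1}[e / 2]mul1r -[e / 2]IHc -IHl; last 2 first.
    - exact: unif_cont_cst.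
    - exact: unif_cont_subst.
    apply: IHm; [exact: unif_cont_subst | | ].
      by apply: unif_cont_lin; [exact: unif_cont_cst | exact: unif_cont_subst].
    move=> a; have : `|G (subst_at k u a) - G (subst_at k v a)| < e / 2.
      by apply: h => j; rewrite /subst_at; case: eqP => _ //; rewrite subrr normr0.
    by rewrite ltr_norml mul1r; lra.
  have h1 := near _ _ hst; rewrite distrC in hst; have h2 := near _ _ hst.
  by rewrite ltr_norml; apply/andP; split; move: h1 h2 e0; lra.
split=> [c|c G G' hG hG'|G G' hG hG' hle].
- rewrite iter_intS; under RInt_ext => t _ do rewrite IHc.
  by rewrite RInt_const /scal /= /mult /= RminusE RmultE subr0 mulrC mulKf.
- rewrite !iter_intS.
  have e t := IHl c _ _ (unif_cont_subst k t hG) (unif_cont_subst k t hG').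
  under RInt_ext => t _ do rewrite e.
  have := RInt_plus _ _ _ _ (ex_RInt_scal _ _ _ c (exI _ hG)) (exI _ hG').
  rewrite RInt_scal; last exact: exI.
  rewrite /plus /scal /= /mult /= => ->.
  by rewrite mulrA -mulrDl.
rewrite !iter_intS ler_wpM2r ?invr_ge0 ?(ltW PI2_gt0) //; apply/RleP.
apply: RInt_le; [by apply/RleP/ltW/PI2_gt0 | exact: exI | exact: exI | move=> t _; apply/RleP].
by apply: IHm => //; exact: unif_cont_subst.
Qed.

Lemma iter_int_cst k c : iter_int k (fun => c) = c.
Proof. by have [] := iter_int_props k. Qed.

Lemma iter_int_lin k c G G' : unif_cont G -> unif_cont G' ->
  iter_int k (fun a => c * G a + G' a) = c * iter_int k G + iter_int k G'.
Proof. by have [_ h _] := iter_int_props k; exact: h. Qed.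

Lemma iter_int_ge0 k G : unif_cont G -> (forall a, 0 <= G a) -> 0 <= iter_int k G.
Proof.
move=> hG h; have [c _ m] := iter_int_props k.
by rewrite -[leLHS](c 0); apply: m => //; exact: unif_cont_cst.
Qed.

Lemma RInt_cos (m : int) (p : R) :
  RInt (fun t => cos (m%:~R * t + p)%R) 0 (2 * PI) = if m == 0 then (2 * PI * cos p)%R else 0.
Proof.
case: eqP => [->|/eqP m0].
  under RInt_ext => t _ do rewrite mul0r add0r.
  by rewrite RInt_const /scal /= /mult /= RminusE RmultE subr0.
have mR : m%:~R != 0 :> R by rewrite intr_eq0.
apply: is_RInt_unique.
have nat_period (n : nat) q : sin (n%:R * (2 * PI) + q)%R = sin q.
  have two : IZR 2 = 2 by [].
  by rewrite -(sin_period q n) INRE two !RmultE RplusE; congr sin; ring.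
have period : sin (m%:~R * (2 * PI) + p)%R = sin p.
  case: m {m0 mR} => n; first exact: nat_period.
  rewrite NegzE mulrNz -[LHS](nat_period n.+1); congr sin; ring.
have -> : 0 = minus (sin (m%:~R * (2 * PI) + p)%R / m%:~R) (sin (m%:~R * 0 + p)%R / m%:~R) :> R.
  by rewrite mulr0 add0r period; apply/esym/subrr.
have D c t : c <> 0%R -> is_derive (fun t => Rdiv (sin (Rplus (Rmult c t) p)) c) t
    (cos (Rplus (Rmult c t) p)).
  by move=> hc; auto_derive => //; rewrite Rmult_1_r Rmult_comm -Rmult_assoc Rinv_l // Rmult_1_l.
have C c t : continuous (fun t => cos (Rplus (Rmult c t) p)) t.
  by apply: ex_derive_continuous; auto_derive.
apply: (@is_RInt_derive _ (fun t => sin (m%:~R * t + p)%R / m%:~R)) => t _; last exact: C.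
by apply: D; apply/eqP.
Qed.

(** The phase [p] carries the induction: for the inner integral the outer angle is part of the
    phase. With phase -pi/2 the lemma also covers sines. *)
Lemma iter_int_cos k (m : nat -> int) (p : R) :
  iter_int k (fun a => cos (\sum_(j < k) (m j)%:~R * a j + p)%R) =
  if [forall j : 'I_k, m j == 0] then cos p else 0.
Proof.
elim: k p => [|k IH] p.
  by rewrite /= big_ord0 add0r; case: forallP => // -[] [].
have PI0 : 2 * PI != 0 :> R by rewrite gt_eqF // PI2_gt0.
rewrite iter_intS.
have e t : iter_int k (fun a => cos (\sum_(j < k.+1) (m j)%:~R * subst_at k t a j + p)%R) =
    if [forall j : 'I_k, m j == 0] then cos ((m k)%:~R * t + p)%R else 0.
  rewrite -IH; congr iter_int; apply: functional_extensionality => a; congr cos.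
  rewrite big_ord_recr /= {2}/subst_at eqxx -addrA; congr (_ + _).
  by apply: eq_bigr => j _; rewrite /subst_at ltn_eqF.
under RInt_ext => t _ do rewrite e.
have -> : [forall j : 'I_k.+1, m j == 0] = [forall j : 'I_k, m j == 0] && (m k == 0).
  apply/forallP/andP => [h|[/forallP h hk] j].
    split; last exact: h ord_max.
    by apply/forallP=> j; exact: h (widen_ord (leqnSn k) j).
  have [jk|jk] := ltnP j k; first exact: h (Ordinal jk).
  by have -> : val j = k by apply/anti_leq; rewrite jk -ltnS ltn_ord.
case: [forall j : 'I_k, _] => /=; last by rewrite RInt_const /scal /= /mult /= RmultE mulr0 mul0r.
by rewrite RInt_cos; case: ifP => _; rewrite ?mul0r // mulrAC mulfV // mul1r.
Qed.

End IteratedIntegral.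

(** * The modulus and the parametrisation of the circle *)

Lemma cabsE z : cabs z = ComplexField.Normc.normc z. Proof. by case: z. Qed.
Lemma toC_cabs z : toC (cabs z) = `|z|. Proof. by rewrite cabsE. Qed.
Lemma cabsM y z : cabs (y * z) = cabs y * cabs z.
Proof. by rewrite !cabsE ComplexField.Normc.normcM. Qed.
Lemma cabsD y z : cabs (y + z) <= cabs y + cabs z.
Proof. by rewrite !cabsE le_normcD. Qed.
Lemma cabsN z : cabs (- z) = cabs z.
Proof. by rewrite !cabsE normcN. Qed.
Lemma cabsB y z : cabs (y - z) = cabs (z - y).
Proof. by rewrite -cabsN opprB. Qed.
Lemma cabs_ge0 z : 0 <= cabs z. Proof. exact: sqrtr_ge0. Qed.
Lemma cabs0 : cabs 0 = 0. Proof. by rewrite cabsE ComplexField.Normc.normc0. Qed.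
Lemma cabs1 : cabs 1 = 1. Proof. by rewrite cabsE ComplexField.Normc.normc1. Qed.
Lemma cabs_conj (z : Cx) : cabs z^* = cabs z.
Proof. by case: z => a b; rewrite /cabs /= sqrrN. Qed.
Lemma cabs_toC (r : R) : 0 <= r -> cabs (toC r) = r.
Proof. by move=> h; rewrite /cabs /= expr0n addr0 sqrtr_sqr ger0_norm. Qed.
Lemma cabs_dist x y z : cabs (x - z) <= cabs (x - y) + cabs (y - z).
Proof. by rewrite -[x - z](subrKA y) cabsD. Qed.
Lemma cabs_sum (J : Type) (r : seq J) (P : pred J) (F : J -> Cx) :
  cabs (\sum_(i <- r | P i) F i) <= \sum_(i <- r | P i) cabs (F i).
Proof.
elim/big_rec2: _ => [|i y z _ h]; first by rewrite cabs0.
by apply: le_trans (cabsD _ _) _; rewrite lerD2l.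
Qed.

Lemma cabs_le (z : Cx) (e : R) : 0 <= e -> cRe z ^+ 2 + cIm z ^+ 2 <= e ^+ 2 -> cabs z <= e.
Proof. by move=> e0 h; rewrite -[leRHS](ger0_norm e0) -sqrtr_sqr ler_sqrt // sqr_ge0. Qed.
Lemma cRe_le (z : Cx) : `|cRe z| <= cabs z.
Proof. by rewrite -sqrtr_sqr ler_sqrt ?lerDl ?addr_ge0 ?sqr_ge0. Qed.
Lemma cIm_le (z : Cx) : `|cIm z| <= cabs z.
Proof. by rewrite -sqrtr_sqr ler_sqrt ?lerDr ?addr_ge0 ?sqr_ge0. Qed.
Lemma cabs_ReIm (z : Cx) : cabs z <= `|cRe z| + `|cIm z|.
Proof.
apply: cabs_le; first by rewrite addr_ge0 ?normr_ge0.
rewrite -[cRe z ^+ 2]real_normK ?num_real // -[cIm z ^+ 2]real_normK ?num_real //.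
have := normr_ge0 (cRe z); have := normr_ge0 (cIm z).
by move: `|cRe z| `|cIm z| => u v; nra.
Qed.

(** The chord has length 2 |sin((s - t)/2)|, and |sin u| <= |u|. *)
Lemma expi_lip (s t : R) : cabs (expi s - expi t) <= `|s - t|.
Proof.
have sin_le (u : R) : 0 <= u -> `|sin u| <= u.
  rewrite le_eqVlt => /orP[/eqP<-|u0]; first by rewrite sin_0 normr0.
  have h1 : sin u < u by apply/RltP/sin_lt_x/RltP.
  rewrite ler_norml (ltW h1) andbT.
  have [hu|hu] := leP u PI.
    have : 0 <= sin u by apply/RleP/sin_ge_0; apply/RleP => //; exact: ltW.
    by lra.
  have : - 1 <= sin u by have [/RleP] := SIN_bound u.
  have : 1 < PI / 2 :> R by apply/RltP; exact: PI2_1.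
  by move: hu; lra.
pose u := (s - t) / 2; pose v := (s + t) / 2.
have sE : s = (v + u)%R by rewrite /u /v; lra.
have tE : t = (v - u)%R by rewrite /u /v; lra.
have sin_abs : sin u ^+ 2 <= u ^+ 2.
  rewrite -[sin u ^+ 2]real_normK ?num_real // -[u ^+ 2]real_normK ?num_real //.
  rewrite ler_sqr ?nnegrE // (_ : `|sin u| = `|sin `|u| |); last first.
    by case: (ger0P u) => // _; rewrite sin_neg normrN.
  exact: sin_le.
have hst : s - t = u * 2 by rewrite /u; lra.
apply: cabs_le => //; rewrite real_normK ?num_real // hst exprMn.
have -> : cRe (expi s - expi t) = - 2 * sin v * sin u.
  by rewrite /= sE tE cos_plus cos_minus !RmultE !RplusE !RminusE; ring.
have -> : cIm (expi s - expi t) = 2 * cos v * sin u.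
  by rewrite /= sE tE sin_plus sin_minus !RmultE !RplusE !RminusE; ring.
have h : cos v ^+ 2 + sin v ^+ 2 = 1.
  by have := sin2_cos2 v; rewrite /Rsqr !RmultE RplusE !expr2 addrC.
have -> : (- 2 * sin v * sin u) ^+ 2 + (2 * cos v * sin u) ^+ 2 =
  4 * sin u ^+ 2 * (cos v ^+ 2 + sin v ^+ 2) by ring.
by rewrite h; move: sin_abs; lra.
Qed.

Lemma expi_onto z : cabs z = 1 -> exists2 t : R, 0 <= t <= 2 * PI & z = expi t.
Proof.
move=> hz; have h2 : cRe z ^+ 2 + cIm z ^+ 2 = 1.
  have := congr1 (fun t => t ^+ 2) hz.
  by rewrite sqr_sqrtr ?addr_ge0 ?sqr_ge0 // expr1n.
have hb : -1 <= cRe z <= 1 by rewrite -ler_norml -hz cRe_le.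
have hb' : (Rle (-1) (cRe z) /\ Rle (cRe z) 1)%R.
  by case/andP: hb => /RleP h /RleP h'; split.
have [h0 h1] := acos_bound (cRe z).
have a0 : 0 <= acos (cRe z) by exact/RleP.
have a1 : acos (cRe z) <= PI by exact/RleP.
have sE : sin (acos (cRe z)) = `|cIm z|.
  rewrite sin_acos // RsqrtE -sqrtr_sqr; congr Num.sqrt.
  rewrite /Rsqr RminusE RmultE (_ : IZR 1 = 1) //.
  by move: h2; rewrite -expr2; lra.
have cE := cos_acos _ hb'.
have PI0 : 0 <= PI :> R by apply/RleP/Rlt_le/PI_RGT_0.
have [i0|i0] := leP 0 (cIm z).
  exists (acos (cRe z)); first by rewrite a0 /=; move: a1 PI0; lra.
  by apply/eqP; rewrite eq_complex /= cE sE ger0_norm // !eqxx.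
exists (2 * PI - acos (cRe z)); first by apply/andP; split; move: a0 a1 PI0; lra.
have -> : expi (2 * PI - acos (cRe z))%R = expi (- acos (cRe z))%R.
  by rewrite expiD /expi cos_2PI sin_2PI mul1r.
apply/eqP; rewrite eq_complex /expi cos_neg sin_neg cE sE ltr0_norm //= RoppE opprK.
by rewrite !eqxx.
Qed.

(** * Continuity and integration on the torus *)

Section TorusIntegral.
Variable N : nat.
Local Notation pt := ('I_N -> Cx).
Implicit Types (x y : pt) (f g h : pt -> Cx) (e : R).

Definition ctorus h := forall x, onTorus x -> forall e, 0 < e ->
  exists2 del : R, 0 < del &
    forall y, onTorus y -> (forall i, cabs (y i - x i) < del) -> cabs (h y - h x) < e.

Lemma ctorus_cst c : ctorus (fun => c).
Proof. by move=> x _ e e0; exists 1 => // y _ _; rewrite subrr cabs0. Qed.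

Lemma ctorus_coord i : ctorus (fun x => x i).
Proof. by move=> x _ e e0; exists e. Qed.

Lemma ctorus2 f g h : ctorus f -> ctorus g ->
  (forall x, onTorus x -> forall e, 0 < e -> exists2 d : R, 0 < d &
     forall y, onTorus y -> cabs (f y - f x) < d -> cabs (g y - g x) < d -> cabs (h y - h x) < e) ->
  ctorus h.
Proof.
move=> hf hg H x hx e /(H x hx)[d d0 {}H].
have [d1 d10 h1] := hf x hx d d0; have [d2 d20 h2] := hg x hx d d0.
exists (Num.min d1 d2) => [|y hy hd]; first by rewrite lt_min d10.
by apply: H => //; [apply: h1 | apply: h2] => // i; have := hd i; rewrite lt_min => /andP[].
Qed.

Lemma ctorus_add f g : ctorus f -> ctorus g -> ctorus (fun x => f x + g x).
Proof.
move=> hf hg; apply: ctorus2 hf hg _ => x _ e e0.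
exists (e / 2) => [|y _ h1 h2]; first by rewrite divr_gt0.
have -> : f y + g y - (f x + g x) = (f y - f x) + (g y - g x) by rewrite opprD addrACA.
by have := cabsD (f y - f x) (g y - g x); lra.
Qed.

Lemma ctorus_mul f g : ctorus f -> ctorus g -> ctorus (fun x => f x * g x).
Proof.
move=> hf hg; apply: ctorus2 hf hg _ => x _ e e0.
have f0 := cabs_ge0 (f x); have g0 := cabs_ge0 (g x).
have c0 : 0 < cabs (f x) + cabs (g x) + 1 by lra.
exists (Num.min 1 (e / (cabs (f x) + cabs (g x) + 1))) => [|y _].
  by rewrite lt_min ltr01 divr_gt0.
rewrite !lt_min !ltr_pdivlMr // => /andP[a1 a2] /andP[b1 b2].
have -> : f y * g y - f x * g x =
  (f y - f x) * (g y - g x) + (f x * (g y - g x) + g x * (f y - f x)).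
  by move: (f x) (f y) (g x) (g y) => *; ring.
apply: le_lt_trans (cabsD _ _) _.
apply: le_lt_trans (lerD (lexx _) (cabsD _ _)) _; rewrite !cabsM.
have := cabs_ge0 (f y - f x); have := cabs_ge0 (g y - g x).
move: (cabs (f y - f x)) (cabs (g y - g x)) (cabs (f x)) (cabs (g x)) a1 a2 b1 b2 f0 g0 {c0}.
move=> u v p q a1 a2 b1 b2 p0 q0 u0 v0.
have : u * v <= Num.max u v.
  by rewrite le_max; case: (leP u v) => huv; apply/orP; [left|right]; nra.
case: (leP u v) => huv hm; nra.
Qed.

Lemma ctorus_conj f : ctorus f -> ctorus (fun x => (f x)^*).
Proof.
move=> hf x hx e /(hf x hx)[d d0 h]; exists d => // y hy hd.
by rewrite -rmorphB cabs_conj; exact: h.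
Qed.

Lemma ctorus_sum (J : Type) (r : seq J) (P : pred J) (F : J -> pt -> Cx) :
  (forall i, ctorus (F i)) -> ctorus (fun x => \sum_(i <- r | P i) F i x).
Proof.
move=> hF; elim: r => [|j r IH].
  by move=> x _ e e0; exists 1 => // y _ _; rewrite !big_nil subrr cabs0.
move=> x hx e e0.
have : ctorus (fun x => if P j then F j x + \sum_(i <- r | P i) F i x else \sum_(i <- r | P i) F i x).
  by case: (P j) => //; exact: ctorus_add.
by move=> /(_ x hx e e0)[d d0 h]; exists d => // y hy hd; rewrite !big_cons; exact: h.
Qed.

Lemma ctorus_prod (J : Type) (r : seq J) (P : pred J) (F : J -> pt -> Cx) :
  (forall i, ctorus (F i)) -> ctorus (fun x => \prod_(i <- r | P i) F i x).
Proof.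
move=> hF; elim: r => [|j r IH].
  by move=> x _ e e0; exists 1 => // y _ _; rewrite !big_nil subrr cabs0.
move=> x hx e e0.
have : ctorus (fun x => if P j then F j x * \prod_(i <- r | P i) F i x else \prod_(i <- r | P i) F i x).
  by case: (P j) => //; exact: ctorus_mul.
by move=> /(_ x hx e e0)[d d0 h]; exists d => // y hy hd; rewrite !big_cons; exact: h.
Qed.

Lemma ctorus_ext f g : (forall x, onTorus x -> f x = g x) -> ctorus f -> ctorus g.
Proof.
move=> fg hf x hx e /(hf x hx)[d d0 h]; exists d => // y hy hd.
by rewrite -!fg //; exact: h.
Qed.

(** Conversion to the nested pairs in which the compactness of boxes is stated. *)
Fixpoint tuple_of n (a : nat -> R) : Compactness.Tn n R :=
  if n is n'.+1 then (a 0%N, tuple_of n' (fun i => a i.+1)) else tt.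
Fixpoint tuple_at n : Compactness.Tn n R -> nat -> R :=
  if n is n'.+1 then fun t i => if i is i'.+1 then tuple_at t.2 i' else t.1 else fun _ _ => 0.

Lemma tuple_of_bounded n (a b c : nat -> R) : (forall i, a i <= c i <= b i) ->
  Compactness.bounded_n n (tuple_of n a) (tuple_of n b) (tuple_of n c).
Proof.
elim: n a b c => //= n IH a b c h; split; last by apply: IH => i; exact: h.
by have /andP[/RleP h1 /RleP h2] := h 0%N.
Qed.

Lemma tuple_at_close n (r : R) (c : nat -> R) t :
  Compactness.close_n n r (tuple_of n c) t -> forall i, (i < n)%N -> `|c i - tuple_at t i| < r.
Proof.
elim: n c t => //= n IH c [t1 t2] [h1 h2] [|i] hi; last exact: (IH _ _ h2).
by apply/RltP; rewrite -RabsE.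
Qed.

Lemma onTorus_expi (a : 'I_N -> R) : onTorus (fun i => expi (a i)).
Proof. by move=> i; exact: cabs_expi. Qed.

Lemma torus_angle x : onTorus x -> exists2 a : nat -> R, (forall i, 0 <= a i <= 2 * PI) &
  forall i, x i = expi (a i).
Proof.
move=> hx; pose ang (i : 'I_N) := epsilon (inhabits (0 : R)) (fun t => 0 <= t <= 2 * PI /\ x i = expi t).
have angP i : 0 <= ang i <= 2 * PI /\ x i = expi (ang i).
  have [t h1 h2] := expi_onto (hx i).
  exact: (epsilon_spec (inhabits (0 : R)) (fun t => 0 <= t <= 2 * PI /\ x i = expi t) (ex_intro _ t (conj h1 h2))).
exists (fun k => if insub k is Some i then ang i else 0) => [k|i].
  by case: insubP => [i _ _|_]; [exact: (angP i).1 | rewrite lexx ltW // PI2_gt0].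
by rewrite valK (angP i).2.
Qed.

(** Heine's theorem, from the compactness of the box [0, 2 pi]^N of angles applied to the gauge
    [dl]. *)
Lemma ctorus_unif h e : ctorus h -> 0 < e -> exists2 d : R, 0 < d &
  forall x y, onTorus x -> onTorus y -> (forall i, cabs (y i - x i) < d) -> cabs (h y - h x) < e.
Proof.
move=> hh e0; have e20 : 0 < e / 2 by rewrite divr_gt0.
pose pnt (t : Compactness.Tn N R) : pt := fun i => expi (tuple_at t i).
(* The radius is doubled so that a point within [dl t] of the centre may be displaced by less than
   [dl t] and stay in the neighbourhood. *)
pose good t (d : posreal) := forall y, onTorus y ->
  (forall i, cabs (y i - pnt t i) < 2 * (d : R)) -> cabs (h y - h (pnt t)) < e / 2.
pose dl t := epsilon (inhabits posreal_one) (good t).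
have dlP t : good t (dl t).
  apply: epsilon_spec; have [d d0 H] := hh _ (onTorus_expi (fun i => tuple_at t i)) _ e20.
  have d20 : 0 < d / 2 by rewrite divr_gt0.
  exists (mkposreal _ (elimT RltP d20)) => y hy hd; apply: H => // i.
  by have := hd i; rewrite /= mulrC divfK ?pnatr_eq0.
have [d hd] := Compactness.compactness_value N (tuple_of N (fun => 0)) (tuple_of N (fun => 2 * PI)) dl.
exists (d : R) => [|x y hx hy hxy]; first exact/RltP/cond_pos.
have [a ha xa] := torus_angle hx.
have /NNPP[t [_ [ht /RleP hdt]]] := hd _ (tuple_of_bounded N ha).
have close i : cabs (x i - pnt t i) < dl t.
  by rewrite xa; apply: le_lt_trans (expi_lip _ _) _; exact: tuple_at_close.
have hx' : cabs (h x - h (pnt t)) < e / 2.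
  apply: dlP => // i; apply: lt_le_trans (close i) _.
  by rewrite ler_peMl // ?ler1n //; apply: le_trans (ltW (close i)); exact: cabs_ge0.
have hy' : cabs (h y - h (pnt t)) < e / 2.
  apply: dlP => // i; apply: le_lt_trans (cabs_dist _ (x i) _) _.
  by have := close i; have := hxy i; move: hdt; lra.
by have := cabs_dist (h y) (h (pnt t)) (h x); rewrite (cabsB (h (pnt t)) (h x)); lra.
Qed.

(** Let all angles grow from 0 to their values in [K] equal steps. Each step displaces the
    coordinates by less than the modulus for error 1, so the value changes by less than 1, and [K]
    does not depend on the point. *)
Lemma ctorus_bounded h : ctorus h -> exists M : R, forall x, onTorus x -> cabs (h x) <= M.
Proof.
move=> hh; have [d d0 H] := ctorus_unif hh ltr01.
pose K := (Num.Def.archi_bound (2 * PI / d)).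
have K0 : 0 < K%:R :> R.
  by apply: lt_trans (Num.Theory.archi_boundP _); rewrite ?divr_gt0 ?PI2_gt0 // ltW // divr_gt0 // PI2_gt0.
have hK : 2 * PI < d * K%:R.
  by rewrite -ltr_pdivrMl // mulrC Num.Theory.archi_boundP // ltW // divr_gt0 // PI2_gt0.
exists (cabs (h (fun => 1)) + K%:R) => x hx.
have [a ha xa] := torus_angle hx.
pose p s : pt := fun i => expi (a i * (s%:R / K%:R))%R.
have step s : cabs (h (p s)) <= cabs (h (fun => 1)) + s%:R.
  elim: s => [|s IH].
    rewrite mulr0n addr0; have -> // : p 0%N = fun => 1.
    by apply: functional_extensionality => i; rewrite /p mul0r mulr0 expi0.
  have : cabs (h (p s.+1) - h (p s)) < 1.
    apply: H => [||i]; [exact: onTorus_expi | exact: onTorus_expi |].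
    apply: le_lt_trans (expi_lip _ _) _.
    have -> : a i * (s.+1%:R / K%:R) - a i * (s%:R / K%:R) = a i / K%:R.
      by rewrite -natr1; field; rewrite gt_eqF.
    have /andP[a0 a1] := ha i.
    rewrite ger0_norm ?divr_ge0 ?ler0n // ltr_pdivrMr //.
    exact: le_lt_trans a1 hK.
  have := cabsD (h (p s.+1) - h (p s)) (h (p s)); rewrite subrK -natr1; move: IH; lra.
have -> : x = p K.
  by apply: functional_extensionality => i; rewrite /p divff ?mulr1 ?xa // gt_eqF.
exact: step.
Qed.

Definition ept (a : nat -> R) : pt := fun i => expi (a (val i)).

Lemma unif_cont_ept h (p : Cx -> R) : (forall y z : Cx, p (y - z) = p y - p z) ->
  (forall z, `|p z| <= cabs z) -> ctorus h -> unif_cont (fun a => p (h (ept a))).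
Proof.
move=> pB p_le hh e e0; have [d d0 H] := ctorus_unif hh e0; exists d => // a b hab.
rewrite -pB; apply: le_lt_trans (p_le _) _; apply: H => [||i]; try exact: onTorus_expi.
exact: le_lt_trans (expi_lip _ _) (hab i).
Qed.

Lemma unif_cont_Re h : ctorus h -> unif_cont (fun a => cRe (h (ept a))).
Proof. by apply: unif_cont_ept; [case=> ? ? [] | exact: cRe_le]. Qed.

Lemma unif_cont_Im h : ctorus h -> unif_cont (fun a => cIm (h (ept a))).
Proof. by apply: unif_cont_ept; [case=> ? ? [] | exact: cIm_le]. Qed.

Lemma torus_int_lin c f g : ctorus f -> ctorus g ->
  torus_int (fun x => c * f x + g x) = c * torus_int f + torus_int g.
Proof.
move=> hf hg; have [fr fi] := (unif_cont_Re hf, unif_cont_Im hf).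
have [gr gi] := (unif_cont_Re hg, unif_cont_Im hg).
apply/eqP; rewrite eq_complex; case: c => cr ci; apply/andP; split; apply/eqP => /=.
  transitivity (iter_int N (fun a => cr * cRe (f (ept a)) +
      (- ci * cIm (f (ept a)) + cRe (g (ept a))))).
    congr iter_int; apply: functional_extensionality => a; rewrite -/(ept a).
    by case: (f _) (g _) => [? ?] [? ?] /=; ring.
  rewrite !iter_int_lin //; last exact: unif_cont_lin.
  by rewrite addrA mulNr.
transitivity (iter_int N (fun a => cr * cIm (f (ept a)) +
    (ci * cRe (f (ept a)) + cIm (g (ept a))))).
  congr iter_int; apply: functional_extensionality => a; rewrite -/(ept a).
  by case: (f _) (g _) => [? ?] [? ?] /=; ring.
rewrite !iter_int_lin //; last exact: unif_cont_lin.
by rewrite addrA.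
Qed.

Lemma torus_int_ext f g : (forall x, onTorus x -> f x = g x) -> torus_int f = torus_int g.
Proof.
move=> h; congr Complex; congr iter_int; apply: functional_extensionality => a.
  by rewrite h //; exact: onTorus_expi.
by rewrite h //; exact: onTorus_expi.
Qed.

Lemma torus_int_cst c : @torus_int N (fun => c) = c.
Proof. by rewrite /torus_int !iter_int_cst; case: c. Qed.

Lemma torus_int_add f g : ctorus f -> ctorus g ->
  torus_int (fun x => f x + g x) = torus_int f + torus_int g.
Proof.
move=> hf hg; rewrite -[torus_int f]mul1r -torus_int_lin //.
by apply: torus_int_ext => x _; rewrite mul1r.
Qed.

Lemma torus_int_scale c f : ctorus f -> torus_int (fun x => c * f x) = c * torus_int f.
Proof.
move=> hf; rewrite -[RHS]addr0 -(torus_int_cst 0) -torus_int_lin //; last exact: ctorus_cst.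
by apply: torus_int_ext => x _; rewrite addr0.
Qed.

Lemma torus_int_sum (J : Type) (r : seq J) (P : pred J) (F : J -> pt -> Cx) :
  (forall i, ctorus (F i)) ->
  torus_int (fun x => \sum_(i <- r | P i) F i x) = \sum_(i <- r | P i) torus_int (F i).
Proof.
move=> hF; elim: r => [|j r IH].
  by rewrite big_nil -[RHS]torus_int_cst; apply: torus_int_ext => x _; rewrite big_nil.
rewrite big_cons -IH; case: ifP => hj.
  rewrite -torus_int_add //; last exact: ctorus_sum.
  by apply: torus_int_ext => x _; rewrite big_cons hj.
by apply: torus_int_ext => x _; rewrite big_cons hj.
Qed.

Lemma torus_int_conj f : ctorus f -> torus_int (fun x => (f x)^*) = (torus_int f)^*.
Proof.
move=> hf; rewrite /torus_int; apply/eqP; rewrite eq_complex /=; apply/andP; split; apply/eqP.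
  by congr iter_int; apply: functional_extensionality => a; case: (f _).
transitivity (iter_int N (fun a => -1 * cIm (f (ept a)) + 0)).
  by congr iter_int; apply: functional_extensionality => a; case: (f _) => ? ? /=; ring.
rewrite iter_int_lin ?iter_int_cst ?addr0 ?mulN1r //; [exact: unif_cont_Im | exact: unif_cont_cst].
Qed.

Lemma torus_int_ge0 f : ctorus f -> (forall x, onTorus x -> 0 <= f x) -> 0 <= torus_int f.
Proof.
move=> hf h; have h' a : 0 <= cRe (f (ept a)) /\ cIm (f (ept a)) = 0.
  by have := h _ (onTorus_expi (fun i => a (val i))); rewrite lecE => /andP[/eqP].
rewrite lecE /=; apply/andP; split.
  apply/eqP; rewrite -[RHS](iter_int_cst N); congr iter_int.
  by apply: functional_extensionality => a; case: (h' a).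
apply: iter_int_ge0; first exact: unif_cont_Re.
by move=> a; case: (h' a).
Qed.

(** Rotate [f] by the unit [c] that makes its integral equal to its modulus, and integrate 2g - (cf
    + conj(cf)) >= 0. *)
Lemma torus_int_norm f g : ctorus f -> ctorus g ->
  (forall x, onTorus x -> `|f x| <= g x) -> `|torus_int f| <= torus_int g.
Proof.
move=> hf hg h.
have [z0|z0] := eqVneq (torus_int f) 0.
  by rewrite z0 normr0; apply: torus_int_ge0 => // x /h; apply: le_trans.
pose c := (torus_int f)^* / `|torus_int f|.
have hc : `|c| = 1.
  by rewrite normrM normfV normr_id norm_conjC divff // normr_eq0.
pose k x := c * f x; have hk : ctorus k by apply: ctorus_mul => //; exact: ctorus_cst.
have ck : torus_int k = `|torus_int f|.
  rewrite torus_int_scale // mulrAC [_^* * _]mulrC -normCK expr2 mulfK //.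
  by rewrite normr_eq0.
have hkk : ctorus (fun x => k x + (k x)^*) := ctorus_add hk (ctorus_conj hk).
have c1 : ctorus (fun x => 2 * g x) := ctorus_mul (ctorus_cst 2) hg.
have c2 : ctorus (fun x => -1 * (k x + (k x)^*)) := ctorus_mul (ctorus_cst (-1)) hkk.
have : 0 <= torus_int (fun x => 2 * g x + -1 * (k x + (k x)^*)).
  apply: (torus_int_ge0 (ctorus_add c1 c2)) => x hx.
  have hr : k x + (k x)^* \is Num.real by rewrite CrealE rmorphD /= conjCK addrC.
  rewrite mulN1r subr_ge0; apply: le_trans (real_ler_norm hr) _.
  apply: le_trans (ler_normD _ _) _; rewrite norm_conjC normrM hc mul1r.
  by rewrite -mulr2n -[leLHS]mulr_natl ler_pM2l ?ltr0n //; exact: h.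
rewrite (torus_int_add c1 c2) (torus_int_scale 2 hg) (torus_int_scale (-1) hkk).
rewrite (torus_int_add hk (ctorus_conj hk)) (torus_int_conj hk) ck conj_normC.
by rewrite mulN1r subr_ge0 -mulr2n -[leLHS]mulr_natl ler_pM2l ?ltr0n.
Qed.

Lemma torus_int_xmon (m : 'I_N -> int) :
  torus_int (fun x => xmon x m) = if [forall i, m i == 0] then 1 else 0.
Proof.
pose m' (j : nat) := if insub j is Some i then m i else 0.
have m'E (i : 'I_N) : m' i = m i by rewrite /m' valK.
have E a : xmon (ept a) m = expi (\sum_(j < N) (m' j)%:~R * a j)%R.
  rewrite /xmon; elim/big_rec2: _ => [|i y z _ ->]; first by rewrite expi0.
  rewrite expiD m'E; congr (_ * _); rewrite /ept; case: (m i) => n.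
    by rewrite -exprnP expi_nat.
  rewrite NegzE -exprnN expi_nat mulrNz mulNr.
  have h : expi (n.+1%:R * a i)%R * expi (- (n.+1%:R * a i))%R = 1.
    by rewrite -expiD subrr expi0.
  have x0 : expi (n.+1%:R * a i)%R != 0.
    by apply/eqP => e0; move: h; rewrite e0 mul0r => /esym/eqP; rewrite oner_eq0.
  by apply: (mulfI x0); rewrite h divff.
have -> : [forall i, m i == 0] = [forall j : 'I_N, m' j == 0].
  by apply: eq_forallb => i; rewrite m'E.
(* The real part is the cosine integral of phase 0; the imaginary part is that of phase -pi/2. *)
have hc := iter_int_cos N m' 0; have hs := iter_int_cos N m' (- (PI / 2)).
rewrite cos_0 in hc; rewrite cos_neg cos_PI2 if_same in hs.
have -> : torus_int (fun x => xmon x m) = Complex (if [forall j : 'I_N, m' j == 0] then 1 else 0) 0.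
  congr Complex; [rewrite -hc | rewrite -[RHS]hs]; congr iter_int;
    apply: functional_extensionality => a; rewrite -/(ept a) E /=; first by rewrite addr0.
  by rewrite -cos_shift -cos_neg; congr cos; rewrite RoppE RminusE opprB.
by case: ifP.
Qed.

End TorusIntegral.

(** * Density of Laurent polynomials *)

Section FejerKernel.
Variable M : nat.
Hypothesis M0 : (0 < M)%N.
Implicit Types (y z : Cx).

Let w : Cx := expi (2 * PI / M%:R)%R.

(** Fejer kernel divided by M^2, so that its values at [y] times the M-th roots of unity form a
    partition of unity. *)
Definition fejer y : R := cabs (\sum_(j < M) y ^+ j) ^+ 2 / M%:R ^+ 2.

Lemma M_gt0 : 0 < M%:R :> R. Proof. by rewrite ltr0n. Qed.

Lemma fejer_ge0 y : 0 <= fejer y.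
Proof. by rewrite divr_ge0 ?sqr_ge0. Qed.

Lemma toC_fejer y : toC (fejer y) =
  (\sum_(j < M) y ^+ j) * (\sum_(j < M) y^* ^+ j) / M%:R ^+ 2.
Proof.
rewrite /fejer toCM toCV !toCX toC_nat toC_cabs normCK rmorph_sum /=.
by congr (_ * _ / _); apply: eq_bigr => j _; rewrite rmorphXn.
Qed.

Lemma wM : w ^+ M = 1.
Proof.
rewrite /w expi_nat mulrC divfK ?gt_eqF ?M_gt0 //.
by rewrite /expi cos_2PI sin_2PI.
Qed.

Lemma w_conj : w * w^* = 1.
Proof.
by rewrite -normCK -toC_cabs cabs_expi toC1 expr1n.
Qed.

Lemma w_primitive d : (0 < d < M)%N -> w ^+ d != 1.
Proof.
move=> /andP[d0 dM]; rewrite /w expi_nat; apply/eqP => /(congr1 cRe) /= h.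
pose t := PI * (d%:R / M%:R).
have PI0 : 0 < PI :> R by apply/RltP; exact: PI_RGT_0.
have t0 : 0 < t by rewrite mulr_gt0 // divr_gt0 ?ltr0n.
have t1 : t < PI by rewrite gtr_pMr // ltr_pdivrMr ?M_gt0 // mul1r ltr_nat.
have s0 : 0 < sin t by apply/RltP; apply: sin_gt_0; apply/RltP.
have e : d%:R * (2 * PI / M%:R) = t + t.
  by rewrite /t; ring.
move: h; rewrite e cos_plus; have := sin2_cos2 t; rewrite /Rsqr => h1 h2.
have : sin t * sin t = 0 by move: h1 h2; rewrite !RmultE RplusE RminusE (_ : IZR 1 = 1) //; lra.
by move/eqP; rewrite mulf_eq0 orbb gt_eqF.
Qed.

Lemma sum_w_powers (i j : 'I_M) : \sum_(k < M) ((w^* ^+ k) ^+ i * (w ^+ k) ^+ j) = M%:R *+ (i == j).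
Proof.
have wc0 : w^* != 0.
  by apply/eqP => h; move/eqP: w_conj; rewrite h mulr0 eq_sym oner_eq0.
have w0 : w != 0 by apply/eqP => h; move/eqP: w_conj; rewrite h mul0r eq_sym oner_eq0.
have e k : (w^* ^+ k) ^+ i * (w ^+ k) ^+ j = (w^* ^+ i * w ^+ j) ^+ k.
  by rewrite exprMn -!exprM mulnC [(k * j)%N]mulnC.
under eq_bigr => k _ do rewrite e.
have wiE n : w^* ^+ n = (w ^+ n)^-1.
  by apply: (mulfI (expf_neq0 n w0)); rewrite -exprMn w_conj expr1n divff // expf_neq0.
case: eqP => [->|/eqP ij].
  rewrite wiE mulVf ?expf_neq0 //; under eq_bigr => k _ do rewrite expr1n.
  by rewrite sumr_const card_ord.
set u := w^* ^+ i * w ^+ j.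
have u1 : u - 1 != 0.
  rewrite subr_eq0 /u wiE; apply/eqP => h.
  have {}h : w ^+ j = w ^+ i by rewrite -[RHS]mulr1 -h mulrA divff ?mul1r // expf_neq0.
  have [ltij|ltji|eij] := ltngtP i j; last by move/val_inj/eqP: eij; rewrite (negPf ij).
    have := @w_primitive (j - i)%N; rewrite subn_gt0 ltij /= (leq_ltn_trans (leq_subr _ _)) //.
    move/(_ isT)/eqP; apply; apply: (mulfI (expf_neq0 i w0)).
    by rewrite -exprD subnKC ?mulr1 // ltnW.
  have := @w_primitive (i - j)%N; rewrite subn_gt0 ltji /= (leq_ltn_trans (leq_subr _ _)) //.
  move/(_ isT)/eqP; apply; apply: (mulfI (expf_neq0 j w0)).
  by rewrite -exprD subnKC ?mulr1 // ltnW.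
apply: (mulfI u1); rewrite -subrX1 mulr0n mulr0 /u exprMn -!exprM ![(_ * M)%N]mulnC !exprM.
by rewrite wM -rmorphXn wM rmorph1 !expr1n mulr1 subrr.
Qed.

(** After expanding the square, orthogonality of the characters of Z/M leaves M diagonal terms, each
    equal to M. *)
Lemma fejer_sum y : cabs y = 1 -> \sum_(k < M) fejer (y * w^* ^+ k) = 1.
Proof.
move=> hy; apply: toC_inj; rewrite (big_morph toC toCD toC0) toC1.
have MC : M%:R != 0 :> Cx by rewrite pnatr_eq0 -lt0n.
have yy : y * y^* = 1 by rewrite -normCK -toC_cabs hy toC1 expr1n.
under eq_bigr => k _ do rewrite toC_fejer.
rewrite -mulr_suml; apply: (mulIf (expf_neq0 2 MC)); rewrite divfK ?expf_neq0 // mul1r.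
transitivity (\sum_(i < M) \sum_(j < M) (y ^+ i * y^* ^+ j *
    \sum_(k < M) ((w^* ^+ k) ^+ i * (w ^+ k) ^+ j))).
  under eq_bigr => k _ do rewrite big_distrlr /=.
  rewrite exchange_big; apply: eq_bigr => i _; rewrite exchange_big; apply: eq_bigr => j _.
  rewrite mulr_sumr; apply: eq_bigr => k _.
  by rewrite rmorphM rmorphXn /= conjCK !exprMn mulrACA.
transitivity (\sum_(i < M) M%:R : Cx); last first.
  by rewrite sumr_const card_ord -[LHS]mulr_natl expr2.
apply: eq_bigr => i _; rewrite (bigD1 i) //= [X in _ + X]big1 ?addr0 => [|j ji].
  by rewrite sum_w_powers eqxx -exprMn yy expr1n mul1r.
by rewrite sum_w_powers eq_sym (negPf ji) mulr0n mulr0.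
Qed.

(** (1 - y) times the geometric sum is 1 - y^M, of modulus at most 2. *)
Lemma fejer_tail y : cabs y = 1 -> cabs (1 - y) ^+ 2 * fejer y <= 4 / M%:R ^+ 2.
Proof.
move=> hy; rewrite /fejer mulrA -exprMn -cabsM ler_wpM2r ?invr_ge0 ?sqr_ge0 //.
have -> : (1 - y) * \sum_(j < M) y ^+ j = - (y ^+ M - 1) by rewrite subrX1 -mulNr opprB.
have hM : cabs (y ^+ M) = 1.
  by elim: M => [|n IH]; rewrite ?expr0 ?cabs1 // exprS cabsM hy IH mulr1.
have : cabs (- (y ^+ M - 1)) <= 2.
  by rewrite cabsN; apply: le_trans (cabsD _ _) _; rewrite cabsN hM cabs1.
by have := cabs_ge0 (- (y ^+ M - 1)); move: (cabs _) => u; nra.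
Qed.
End FejerKernel.

Section Density.
Variable N : nat.
Local Notation pt := ('I_N -> Cx).
Implicit Types (x y : pt) (p q h : pt -> Cx) (m : 'I_N -> int).

(** Closed under agreement on the torus, so that conjugates of coordinates, which equal inverses
    only there, are included. *)
Inductive lpoly : (pt -> Cx) -> Prop :=
| lpoly_mon c m : lpoly (fun x => c * xmon x m)
| lpoly_add p q : lpoly p -> lpoly q -> lpoly (fun x => p x + q x)
| lpoly_ext p q : (forall x, onTorus x -> p x = q x) -> lpoly p -> lpoly q.

Lemma xmonD x m m' : onTorus x -> xmon x m * xmon x m' = xmon x (fun i => m i + m' i).
Proof.
move=> hx; rewrite /xmon -big_split; apply: eq_bigr => i _ /=.
by rewrite expfzDr // (torus_conj hx i).1.
Qed.

Lemma lpoly_mul p q : lpoly p -> lpoly q -> lpoly (fun x => p x * q x).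
Proof.
elim=> {p} [c m|p p' hp IHp hp' IHp'|p p' e hp IHp] hq; last first.
- by apply: lpoly_ext (IHp hq) => x hx; rewrite e.
- by apply: lpoly_ext (lpoly_add (IHp hq) (IHp' hq)) => x _; rewrite mulrDl.
elim: hq => {q} [c' m'|q q' _ IHq _ IHq'|q q' e _ IHq].
- apply: (lpoly_ext _ (lpoly_mon (c * c') (fun i => m i + m' i))) => x hx.
  by rewrite -xmonD // mulrACA.
- by apply: lpoly_ext (lpoly_add IHq IHq') => x _; rewrite mulrDr.
by apply: lpoly_ext IHq => x hx; rewrite e.
Qed.

Lemma lpoly_cst c : lpoly (fun => c).
Proof.
by apply: (lpoly_ext _ (lpoly_mon c (fun => 0))) => x _; rewrite /xmon big1 ?mulr1.
Qed.

Lemma lpoly_coord i : lpoly (fun x => x i).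
Proof.
apply: (lpoly_ext _ (lpoly_mon 1 (fun j => (j == i)%:Z))) => x _.
by rewrite mul1r /xmon (bigD1 i) //= eqxx big1 ?mulr1 // => j /negPf ->.
Qed.

Lemma lpoly_conj i : lpoly (fun x => (x i)^*).
Proof.
apply: (lpoly_ext _ (lpoly_mon 1 (fun j => - (j == i)%:Z))) => x hx.
rewrite mul1r /xmon (bigD1 i) //= eqxx big1 ?mulr1 => [|j /negPf -> //].
by rewrite (torus_conj hx i).2.
Qed.

Lemma lpoly_sum (J : Type) (r : seq J) (F : J -> pt -> Cx) :
  (forall i, lpoly (F i)) -> lpoly (fun x => \sum_(i <- r) F i x).
Proof.
move=> hF; elim: r => [|j r IH].
  by apply: lpoly_ext (lpoly_cst 0) => x _; rewrite big_nil.
by apply: lpoly_ext (lpoly_add (hF j) IH) => x _; rewrite big_cons.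
Qed.

Lemma lpoly_prod (J : Type) (r : seq J) (F : J -> pt -> Cx) :
  (forall i, lpoly (F i)) -> lpoly (fun x => \prod_(i <- r) F i x).
Proof.
move=> hF; elim: r => [|j r IH].
  by apply: lpoly_ext (lpoly_cst 1) => x _; rewrite big_nil.
by apply: lpoly_ext (lpoly_mul (hF j) IH) => x _; rewrite big_cons.
Qed.

Lemma lpoly_exp p n : lpoly p -> lpoly (fun x => p x ^+ n).
Proof.
move=> hp; apply: lpoly_ext (lpoly_prod (index_enum 'I_n) (fun => hp)) => x _.
by rewrite prodr_const card_ord.
Qed.

Lemma lpoly_fejer M i c : lpoly (fun x => toC (fejer M (x i * c))).
Proof.
apply: lpoly_ext => [x _|]; first by rewrite toC_fejer.
apply: lpoly_mul (lpoly_cst _); apply: lpoly_mul; apply: lpoly_sum => j; apply: lpoly_exp.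
  exact: lpoly_mul (lpoly_coord i) (lpoly_cst c).
apply: lpoly_ext (lpoly_mul (lpoly_conj i) (lpoly_cst c^*)) => x _.
by rewrite rmorphM.
Qed.

(* Sampling h on the grid of M-th roots of unity against a product of Fejer kernels. *)
Lemma lpoly_dense h (e : R) : ctorus h -> 0 < e ->
  exists2 p, lpoly p & forall x, onTorus x -> cabs (h x - p x) <= e.
Proof.
move=> hh e0; have e20 : 0 < e / 2 by rewrite divr_gt0.
have [del del0 hu] := ctorus_unif hh e20; have [B hB] := ctorus_bounded hh.
have B0 : 0 <= B.
  by apply: le_trans (hB _ (onTorus_expi (fun => 0))); exact: cabs_ge0.
(* A quadratic majorant for the oscillation: nearby points are handled by uniform continuity;
   otherwise some coordinate differs by at least [del], and C del^2 = 2B bounds any difference of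
   values. *)
pose C := 2 * B / del ^+ 2; have C0 : 0 <= C by rewrite divr_ge0 ?sqr_ge0 // mulr_ge0.
have hC x y : onTorus x -> onTorus y ->
    cabs (h x - h y) <= e / 2 + C * \sum_i cabs (x i - y i) ^+ 2.
  move=> hx hy; case: (boolP [forall i, cabs (x i - y i) < del]) => [/forallP hs|].
    apply: le_trans (ltW (hu y x hy hx hs)) _; rewrite lerDl mulr_ge0 //.
    by apply: sumr_ge0 => i _; exact: sqr_ge0.
  rewrite negb_forall => /existsP; case=> i; rewrite -leNgt => hi; have h1 : cabs (h x - h y) <= 2 * B.
    by apply: le_trans (cabsD _ _) _; rewrite cabsN; have := hB x hx; have := hB y hy; lra.
  have h2 : del ^+ 2 <= \sum_i cabs (x i - y i) ^+ 2.
    rewrite (bigD1 i) //=; apply: (@le_trans _ _ (cabs (x i - y i) ^+ 2)).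
      by rewrite ler_sqr ?nnegrE ?(ltW del0) ?cabs_ge0.
    by rewrite lerDl; apply: sumr_ge0 => j _; exact: sqr_ge0.
  have h3 : 2 * B <= C * \sum_i cabs (x i - y i) ^+ 2.
    have -> : 2 * B = C * del ^+ 2 by rewrite /C divfK // expf_neq0 // gt_eqF.
    by rewrite ler_wpM2l.
  by move: h1 h3 e20; lra.
(* Each coordinate contributes a mean square distance of at most 4/M, so the total C N 4/M is to be
   at most e/2. *)
pose M := (Num.Def.archi_bound (8 * C * N%:R / e)).+1.
have M0 : (0 < M)%N by [].
have hM : C * (N%:R * (4 / M%:R)) <= e / 2.
  have MR : 0 < M%:R :> R by rewrite ltr0n.
  have k0 : 0 <= 8 * C * N%:R / e by rewrite divr_ge0 ?(ltW e0) // mulr_ge0 // mulr_ge0.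
  have h1 : 8 * C * N%:R / e <= M%:R.
    by apply: le_trans (ltW (archi_boundP k0)) _; rewrite ler_nat.
  rewrite ler_pdivrMr // in h1.
  have -> : C * (N%:R * (4 / M%:R)) = (8 * C * N%:R) / M%:R / 2 by field; rewrite gt_eqF.
  by rewrite ler_pM2r ?invr_gt0 // ler_pdivrMr // [e * _]mulrC.
pose w : Cx := expi (2 * PI / M%:R)%R.
pose z (k : {ffun 'I_N -> 'I_M}) : pt := fun i => w ^+ k i.
have zT k : onTorus (z k) by move=> i; rewrite /z /w expi_nat cabs_expi.
pose F x i (k : 'I_M) : R := fejer M (x i * w^* ^+ k).
have Fsum x i : onTorus x -> \sum_k F x i k = 1 by move=> hx; exact: fejer_sum.
exists (fun x => \sum_(k <- index_enum {ffun 'I_N -> 'I_M}) h (z k) *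
    \prod_(i <- index_enum 'I_N) toC (F x i (k i))).
  apply: lpoly_sum => k; apply: lpoly_mul (lpoly_cst _) _; apply: lpoly_prod => i.
  exact: lpoly_fejer.
move=> x hx; have tot : \sum_(k : {ffun 'I_N -> 'I_M}) \prod_i F x i (k i) = 1.
  by rewrite -bigA_distr_bigA big1 // => i _; exact: Fsum.
have P0 k : 0 <= \prod_i F x i (k i) by apply: prodr_ge0 => i _; exact: fejer_ge0.
have -> : h x - \sum_(k : {ffun 'I_N -> 'I_M}) h (z k) * \prod_i toC (F x i (k i)) =
    \sum_(k : {ffun 'I_N -> 'I_M}) (h x - h (z k)) * toC (\prod_i F x i (k i)).
  have hxE : h x = \sum_(k : {ffun 'I_N -> 'I_M}) h x * toC (\prod_i F x i (k i)).
    by rewrite -mulr_sumr -(big_morph toC toCD toC0) tot toC1 mulr1.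
  rewrite {1}hxE -sumrB; apply: eq_bigr => k _.
  by rewrite (big_morph toC toCM toC1) mulrBl.
apply: le_trans (cabs_sum _ _ _) _.
apply: (@le_trans _ _ (\sum_(k : {ffun 'I_N -> 'I_M})
    (e / 2 * \prod_i F x i (k i) + C * \sum_j cabs (x j - z k j) ^+ 2 * \prod_i F x i (k i)))).
  apply: ler_sum => k _; rewrite cabsM cabs_toC // -mulr_suml mulrA -mulrDl ler_wpM2r //.
  exact: hC.
rewrite big_split /= -mulr_sumr tot mulr1 -mulr_sumr exchange_big /=.
suff h4 j : \sum_(k : {ffun 'I_N -> 'I_M}) cabs (x j - z k j) ^+ 2 * \prod_i F x i (k i) <= 4 / M%:R.
  have : \sum_j \sum_(k : {ffun 'I_N -> 'I_M}) cabs (x j - z k j) ^+ 2 * \prod_i F x i (k i) <=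
      N%:R * (4 / M%:R).
    apply: le_trans (ler_sum _ (fun j _ => h4 j)) _.
    by rewrite sumr_const card_ord [leRHS]mulr_natl.
  by move/(ler_wpM2l C0); move: hM; lra.
(* Placing the squared distance in the j-th factor makes the sum over the grid a product over
   coordinates, in which all factors but the j-th are 1. *)
pose G i (k : 'I_M) := (if i == j then cabs (x j - w ^+ k) ^+ 2 else 1) * F x i k.
have -> : \sum_(k : {ffun 'I_N -> 'I_M}) cabs (x j - z k j) ^+ 2 * \prod_i F x i (k i) =
    \sum_(k : {ffun 'I_N -> 'I_M}) \prod_i G i (k i).
  apply: eq_bigr => k _; rewrite /G [RHS]big_split /=; congr (_ * _).
  by rewrite (bigD1 j) //= eqxx big1 ?mulr1 // => i /negPf ->.
rewrite -bigA_distr_bigA (bigD1 j) //= [X in _ * X]big1 ?mulr1; last first.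
  move=> i /negPf ij; rewrite -(Fsum x i hx); apply: eq_bigr => k _.
  by rewrite /G ij mul1r.
have -> : 4 / M%:R = \sum_(k < M) 4 / M%:R ^+ 2 :> R.
  by rewrite sumr_const card_ord -[RHS]mulr_natl; field; rewrite pnatr_eq0.
apply: ler_sum => k _; rewrite /G eqxx /F.
have wk : w ^+ k * w^* ^+ k = 1 by rewrite -exprMn (w_conj M) expr1n.
have ck : cabs (w ^+ k) = 1 by rewrite /w expi_nat cabs_expi.
have -> : x j - w ^+ k = - (w ^+ k * (1 - x j * w^* ^+ k)).
  by rewrite mulrBr mulr1 mulrCA wk mulr1 opprB.
rewrite cabsN cabsM ck mul1r; apply: fejer_tail => //.
by rewrite cabsM hx mul1r -rmorphXn cabs_conj.
Qed.
End Density.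

(** * Weak limits *)

Lemma cvgC_cst l : cvgC (fun => l) l.
Proof. by split; exact: is_lim_seq_const. Qed.

Lemma cvgC_ext u v l : u =1 v -> cvgC u l -> cvgC v l.
Proof. by move=> /functional_extensionality ->. Qed.

Lemma cvgC_unique u l l' : cvgC u l -> cvgC u l' -> l = l'.
Proof.
move=> [/is_lim_seq_unique h1 /is_lim_seq_unique h2] [/is_lim_seq_unique h3 /is_lim_seq_unique h4].
move: h3 h4; rewrite h1 h2; case: l {h1 h2} l' => a b [c d] /= [->] [->] //.
Qed.

Lemma cvgC_add u v l l' : cvgC u l -> cvgC v l' -> cvgC (fun n => u n + v n) (l + l').
Proof.
move=> [h1 h2] [h3 h4]; split.
  have -> : cRe (l + l') = Rplus (cRe l) (cRe l') by case: (l) (l') => ? ? [].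
  apply: is_lim_seq_ext (is_lim_seq_plus' _ _ _ _ h1 h3) => n.
  by case: (u n) (v n) => ? ? [].
have -> : cIm (l + l') = Rplus (cIm l) (cIm l') by case: (l) (l') => ? ? [].
apply: is_lim_seq_ext (is_lim_seq_plus' _ _ _ _ h2 h4) => n.
by case: (u n) (v n) => ? ? [].
Qed.

Lemma cvgC_mul u v l l' : cvgC u l -> cvgC v l' -> cvgC (fun n => u n * v n) (l * l').
Proof.
move=> [h1 h2] [h3 h4]; split.
  have -> : cRe (l * l') = Rminus (Rmult (cRe l) (cRe l')) (Rmult (cIm l) (cIm l')).
    by case: (l) (l') => ? ? [].
  apply: is_lim_seq_ext (is_lim_seq_minus' _ _ _ _ (is_lim_seq_mult' _ _ _ _ h1 h3)
    (is_lim_seq_mult' _ _ _ _ h2 h4)) => n.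
  by case: (u n) (v n) => ? ? [].
have -> : cIm (l * l') = Rplus (Rmult (cRe l) (cIm l')) (Rmult (cIm l) (cRe l')).
  by case: (l) (l') => ? ? [].
apply: is_lim_seq_ext (is_lim_seq_plus' _ _ _ _ (is_lim_seq_mult' _ _ _ _ h1 h4)
  (is_lim_seq_mult' _ _ _ _ h2 h3)) => n.
by case: (u n) (v n) => ? ? [].
Qed.

Lemma cvgC_scale c u l : cvgC u l -> cvgC (fun n => c * u n) (c * l).
Proof. exact: cvgC_mul (cvgC_cst c). Qed.

Lemma cvgC_conj u l : cvgC u l -> cvgC (fun n => (u n)^*) l^*.
Proof.
move=> [h1 h2]; split.
  have -> : cRe l^* = cRe l by case: (l).
  by apply: is_lim_seq_ext h1 => n; case: (u n).
have -> : cIm l^* = Ropp (cIm l) by case: (l).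
by apply: is_lim_seq_ext (proj1 (is_lim_seq_opp _ _) h2) => n; case: (u n).
Qed.

Lemma cvgC_sum (J : finType) (F : J -> nat -> Cx) (L : J -> Cx) :
  (forall j, cvgC (F j) (L j)) -> cvgC (fun n => \sum_j F j n) (\sum_j L j).
Proof.
move=> h; elim: (index_enum J) => [|j r IH].
  by rewrite big_nil; apply: cvgC_ext (cvgC_cst 0) => n; rewrite big_nil.
by rewrite big_cons; apply: cvgC_ext (cvgC_add (h j) IH) => n; rewrite big_cons.
Qed.

Lemma cvgC_shift n0 u v l : (forall n, (n0 <= n)%N -> u n = v n) -> cvgC v l -> cvgC u l.
Proof.
move=> h [h1 h2]; split.
  by apply: is_lim_seq_ext_loc h1; exists n0 => n /ssrnat.leP /h ->.
by apply: is_lim_seq_ext_loc h2; exists n0 => n /ssrnat.leP /h ->.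
Qed.

Lemma lim_seq_ge0 (u : nat -> R) (l : R) : (forall n, 0 <= u n) -> is_lim_seq u l -> 0 <= l.
Proof.
move=> h hu; apply/RleP.
exact: (is_lim_seq_le (fun=> IZR 0) u (Rbar.Finite 0) (Rbar.Finite l) (fun n => elimT RleP (h n))
  (is_lim_seq_const _) hu).
Qed.

Lemma cvgC_ge0 (u : nat -> Cx) l : (forall n, 0 <= u n) -> cvgC u l -> 0 <= l.
Proof.
move=> h [h1 h2]; have h' n : 0 <= cRe (u n) /\ cIm (u n) = 0.
  by have := h n; rewrite lecE => /andP[/eqP].
rewrite lecE; apply/andP; split; last by apply: lim_seq_ge0 h1 => n; case: (h' n).
have : is_lim_seq (fun n => cIm (u n)) (Rbar.Finite 0).
  by apply: is_lim_seq_ext (is_lim_seq_const 0) => n; case: (h' n).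
by move/is_lim_seq_unique; rewrite (is_lim_seq_unique _ _ h2) => -[e]; apply/eqP.
Qed.

(** Real and imaginary parts are bounded separately, whence the factor 2. *)
Lemma cvgC_bound u l (c : R) : (forall n, cabs (u n) <= c) -> cvgC u l -> cabs l <= 2 * c.
Proof.
move=> h [h1 h2].
have B v (t : R) : (forall n, `|v n| <= c) -> is_lim_seq v t -> `|t| <= c.
  move=> hv ht; have hv' n : - c <= v n <= c by rewrite -ler_norml.
  rewrite ler_norml -[t <= c]subr_ge0 -[_ <= t]subr_ge0; apply/andP; split.
    apply: (@lim_seq_ge0 (fun n => Rminus (v n) (- c))) => [n|].
      by have := hv' n; rewrite RminusE RoppE; lra.
    exact: is_lim_seq_minus' ht (is_lim_seq_const _).
  apply: (@lim_seq_ge0 (fun n => Rminus c (v n))) => [n|].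
    by have := hv' n; rewrite RminusE; lra.
  exact: is_lim_seq_minus' (is_lim_seq_const _) ht.
have b1 := B _ _ (fun n => le_trans (cRe_le _) (h n)) h1.
have b2 := B _ _ (fun n => le_trans (cIm_le _) (h n)) h2.
by have := cabs_ReIm l; lra.
Qed.

Lemma cvgC_near u l (e : R) : cvgC u l -> 0 < e ->
  exists n0, forall n, (n0 <= n)%N -> cabs (u n - l) < e.
Proof.
move=> [/is_lim_seq_spec h1 /is_lim_seq_spec h2] e0.
have e2 : 0 < e / 2 by rewrite divr_gt0.
have [n1 H1] := h1 (mkposreal _ (elimT RltP e2)); have [n2 H2] := h2 (mkposreal _ (elimT RltP e2)).
exists (maxn n1 n2) => n; rewrite geq_max => /andP[/ssrnat.leP/H1/RltP a /ssrnat.leP/H2/RltP b].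
have := cabs_ReIm (u n - l); move: a b; rewrite !RabsE /=.
by case: (u n) (l) => ? ? [? ?] /=; lra.
Qed.

Lemma cvgC_cauchy u :
  (forall e : R, 0 < e -> exists n0, forall n m, (n0 <= n)%N -> (n0 <= m)%N -> cabs (u n - u m) < e) ->
  exists l, cvgC u l.
Proof.
move=> h; have C (p : Cx -> R) : (forall y z : Cx, p (y - z) = p y - p z) ->
    (forall z, `|p z| <= cabs z) -> ex_finite_lim_seq (fun n => p (u n)).
  move=> pB ple; apply/ex_lim_seq_cauchy_corr => e.
  have [n0 H] := h (e : R) ltac:(by apply/RltP; exact: cond_pos).
  exists n0 => n m /ssrnat.leP hn /ssrnat.leP hm; apply/RltP; rewrite RabsE RminusE -pB.
  exact: le_lt_trans (ple _) (H _ _ hn hm).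
have [a ha] := C cRe ltac:(by case=> ? ? []) cRe_le.
have [b hb] := C cIm ltac:(by case=> ? ? []) cIm_le.
by exists (Complex a b).
Qed.

Lemma poch_ratio_lim (N m : nat) : (0 < N)%N ->
  cvgC (fun n => poch (- n%:R) m / poch (1 - N%:R - n%:R) m) 1.
Proof.
move=> hN; elim: m => [|m IH].
  by apply: cvgC_ext (cvgC_cst 1) => n; rewrite /poch !big_ord0 divr1.
rewrite -[X in cvgC _ X]mulr1.
suff F : cvgC (fun n => (m%:R - n%:R) / (1 - N%:R - n%:R + m%:R)) 1.
  apply: cvgC_ext (cvgC_mul IH F) => n.
  by rewrite /poch !big_ord_recr /= invfM [- _ + _]addrC mulrACA.
pose u (n : nat) : R := (m%:R - n%:R)%R / (1 - N%:R - n%:R + m%:R)%R.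
have uE n : toC (u n) = (m%:R - n%:R) / (1 - N%:R - n%:R + m%:R).
  by rewrite /u toCM toCV toCB toCD !toCB toC1 !toC_nat.
apply: (cvgC_ext uE); split; last exact: is_lim_seq_const.
apply/is_lim_seq_spec => e; have e0 : 0 < (e : R) by apply/RltP; exact: cond_pos.
(* The distance of [u n] to 1 is (N - 1) / (N + n - m - 1), which is below e as soon as e (n - m)
   exceeds N. *)
pose k := Num.Def.archi_bound (N%:R / (e : R)).
exists (m + k.+1)%N => n /ssrnat.leP hn; apply/RltP; rewrite RabsE RminusE /=.
have k0 : N%:R / (e : R) < k%:R by apply: archi_boundP; rewrite divr_ge0 // ltW.
rewrite ltr_pdivrMr // in k0.
have h1 : m%:R + k%:R + 1 <= n%:R :> R by rewrite -natrD natr1 ler_nat; lia.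
have h2 : 1 <= N%:R :> R by rewrite ler1n.
have k1 : 0 <= k%:R :> R := ler0n _ _.
have D : 0 < N%:R + n%:R - m%:R - 1 :> R by lra.
have -> : u n - 1 = (1 - N%:R) / (N%:R + n%:R - m%:R - 1).
  by rewrite /u; field; apply/andP; split; lra.
rewrite normrM normfV (gtr0_norm D) ltr_pdivrMr // ler0_norm; last by lra.
by move: (e : R) e0 k0 => E E0 k0; nra.
Qed.

(** * The limit form on continuous functions *)

Section WeakLimit.
Variables (N : nat) (tau : seq nat) (kappa : R).
Hypothesis hN : (0 < N)%N.
Hypothesis htau : is_partition N tau.
Hypothesis hkap : - ((h_tau tau)%:R)^-1 < kappa < ((h_tau tau)%:R)^-1.

Local Notation d := (dimV N tau).
Local Notation V := (PV N tau).
Local Notation pt := ('I_N -> Cx).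
Local Notation vf := (pt -> 'cV[Cx]_d).
Local Notation K := (Kn tau kappa).
Local Notation A := (Amat tau kappa).
Implicit Types (f g : vf) (k l : 'I_d) (h : pt -> Cx).

Lemma ctorus_exp h n : ctorus h -> ctorus (fun x => h x ^+ n).
Proof.
move=> hh; apply: ctorus_ext (ctorus_prod (index_enum 'I_n) xpredT (fun => hh)) => x _.
by rewrite prodr_const card_ord.
Qed.

Lemma ctorus_xmon (m : 'I_N -> int) : ctorus (fun x => xmon x m).
Proof.
apply: ctorus_prod => i; case: (m i) => n; first exact: ctorus_exp (ctorus_coord i).
apply: ctorus_ext (ctorus_exp n.+1 (ctorus_conj (ctorus_coord i))) => x hx.
by rewrite (torus_conj hx i).2 NegzE -exprnN exprVn.
Qed.

Lemma ctorus_lpoly h : lpoly h -> ctorus h.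
Proof.
elim=> {h} [c m|p q _ hp _ hq|p q e _ hp].
- exact: ctorus_mul (ctorus_cst c) (ctorus_xmon m).
- exact: ctorus_add.
exact: ctorus_ext e hp.
Qed.

Definition rt n m : Cx := poch (- n%:R) m / poch (1 - N%:R - n%:R) m.

Lemma Kn_entry n x k l : K n x k l = \sum_(m < n.+1)
  \sum_(c : {ffun 'I_N -> 'I_(4 * m).+1} | inZNm m (shiftg c))
     (rt n m * A (shiftg c) k l) * xmon x (shiftg c).
Proof.
rewrite /Kn summxE; apply: eq_bigr => m _; rewrite mxE /Hm summxE mulr_sumr.
by apply: eq_bigr => c _; rewrite mxE -/(rt n m) [RHS]mulrAC mulrA.
Qed.

Lemma ctorus_Kn n k l : ctorus (fun x => K n x k l).
Proof.
apply: ctorus_ext => [x _|]; first by rewrite Kn_entry.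
apply: ctorus_sum => m; apply: ctorus_sum => c.
exact: ctorus_mul (ctorus_cst _) (ctorus_xmon _).
Qed.

Definition Lint n k l h : Cx := torus_int (fun x => h x * K n x k l).

Lemma ctorus_mulK n k l h : ctorus h -> ctorus (fun x => h x * K n x k l).
Proof. by move=> hh; exact: ctorus_mul hh (ctorus_Kn n k l). Qed.

Lemma Lint_xmon n k l (m g : 'I_N -> int) : (forall i, g i = - m i) ->
  Lint n k l (fun x => xmon x m) = \sum_(j < n.+1)
  \sum_(c : {ffun 'I_N -> 'I_(4 * j).+1} | inZNm j (shiftg c))
     (if [forall i, g i == shiftg c i] then rt n j * A (shiftg c) k l else 0).
Proof.
move=> gm; rewrite /Lint.
pose F j (c : {ffun 'I_N -> 'I_(4 * j).+1}) (x : pt) :=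
  (rt n j * A (shiftg c) k l) * xmon x (fun i => m i + shiftg c i).
have cF j c : ctorus (@F j c) by exact: ctorus_mul (ctorus_cst _) (ctorus_xmon _).
have e x : onTorus x -> xmon x m * K n x k l = \sum_(j < n.+1)
    \sum_(c : {ffun 'I_N -> 'I_(4 * j).+1} | inZNm j (shiftg c)) F j c x.
  move=> hx; rewrite Kn_entry mulr_sumr; apply: eq_bigr => j _.
  by rewrite mulr_sumr; apply: eq_bigr => c _; rewrite mulrCA xmonD.
rewrite (torus_int_ext e) torus_int_sum; last by move=> j; exact: ctorus_sum.
apply: eq_bigr => j _; rewrite torus_int_sum //; apply: eq_bigr => c _.
rewrite /F torus_int_scale; last exact: ctorus_xmon.
rewrite torus_int_xmon.
have -> : [forall i, m i + shiftg c i == 0] = [forall i, g i == shiftg c i].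
  by apply: eq_forallb => i; rewrite gm addrC addr_eq0 eq_sym.
by case: ifP => _; rewrite ?mulr1 ?mulr0.
Qed.

Lemma Lint_xmon0 n k l (m : 'I_N -> int) : \sum_i m i != 0 -> Lint n k l (fun x => xmon x m) = 0.
Proof.
move=> hm; rewrite (@Lint_xmon n k l m (fun i => - m i)) //.
rewrite big1 // => j _; rewrite big1 // => c /andP[/eqP hc _]; case: ifP => // /forallP he.
case/eqP: hm; apply: oppr_inj; rewrite oppr0 -sumrN -[RHS]hc; apply: eq_bigr => i _.
exact/eqP.
Qed.

Lemma Lint_xmonE n k l (g : 'I_N -> int) : \sum_i g i = 0 -> (mdeg (posm g) <= n)%N ->
  Lint n k l (fun x => xmon x (fun i => - g i)) = rt n (mdeg (posm g)) * A g k l.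
Proof.
move=> hg hn; rewrite (@Lint_xmon n k l _ g); last by move=> i; rewrite opprK.
exact: (shiftg_pick hN (fun j c => rt n j * A c k l) (inZNm_posm hN hg) hn).
Qed.

(** Orthogonality of characters leaves the single coefficient of frequency [g]; once n reaches the
    degree of [posm g] the integral is exactly [rt] times an entry of A_g, and [rt] tends to 1. *)
Lemma Lint_xmon_lim k l (g : 'I_N -> int) :
  cvgC (fun n => Lint n k l (fun x => xmon x (fun i => - g i)))
       (if \sum_i g i == 0 then A g k l else 0).
Proof.
case: eqP => [h0|/eqP h0]; last first.
  apply: cvgC_ext (cvgC_cst 0) => n; rewrite Lint_xmon0 // sumrN oppr_eq0 //.
apply: (@cvgC_shift (mdeg (posm g))) => [n hn|]; first exact: Lint_xmonE.
rewrite -[X in cvgC _ X]mul1r; exact: (cvgC_mul (poch_ratio_lim (mdeg (posm g)) hN) (cvgC_cst (A g k l))).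
Qed.

Definition trA0 : Cx := \sum_k A (fun _ : 'I_N => 0) k k.

Lemma Kn_trace_int n : torus_int (fun x : pt => \sum_k K n x k k) = trA0.
Proof.
rewrite torus_int_sum; last by move=> k; exact: ctorus_Kn.
apply: eq_bigr => k _.
have h0 : \sum_(i < N) (0 : int) = 0 by rewrite big1.
have p0 : mdeg (posm (fun _ : 'I_N => 0 : int)) = 0%N.
  by rewrite mdegE big1 // => i _; rewrite posmE.
have := @Lint_xmonE n k k _ h0; rewrite p0 => /(_ isT); rewrite /rt /poch !big_ord0 divr1 mul1r => <-.
apply: torus_int_ext => x _; rewrite /xmon big1 ?mul1r // => i _.
Qed.

Lemma qf_linr u (M : 'M[Cx]_d) c v v' : qf u M (c *: v + v') = c * qf u M v + qf u M v'.
Proof.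
rewrite !qfE mulr_sumr -big_split; apply: eq_bigr => i _ /=.
rewrite mulr_sumr -big_split; apply: eq_bigr => j _ /=.
by rewrite !mxE mulrDr mulrCA.
Qed.

(** Positivity on c e_l + e_k, with [c] the unit that rotates the entry to -|M_kl|, gives 2 |M_kl|
    <= M_kk + M_ll, and each diagonal entry is at most the trace. *)
Lemma psd_entry (M : 'M[Cx]_d) k l : psd M -> `|M k l| <= \sum_j M j j.
Proof.
case=> hM pos.
have dg j : 0 <= M j j by rewrite -qf_delta; exact: pos.
have tr_ge j : M j j <= \sum_j M j j.
  by rewrite (bigD1 j) //= lerDl; apply: sumr_ge0 => i _; exact: dg.
have [z0|z0] := eqVneq (M k l) 0.
  by rewrite z0 normr0; apply: le_trans (tr_ge k).
have hc u v : qf v M u = (qf u M v)^* by rewrite -qf_ctr hM.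
pose c : Cx := - (M k l)^* / `|M k l|.
have n0 : `|M k l| != 0 by rewrite normr_eq0.
have cM : c * M k l = - `|M k l|.
  by rewrite /c mulrAC mulNr [_^* * _]mulrC -normCK expr2 mulNr mulfK.
have cc : c * c^* = 1.
  by rewrite -normCK /c normrM normrN normfV normr_id norm_conjC divff // expr1n.
pose u : 'cV[Cx]_d := c *: delta_mx l 0 + delta_mx k 0.
have E : qf u M u = M l l + M k k - 2 * `|M k l|.
  have hkl : (M l k)^* = M k l by rewrite -!qf_delta -hc.
  have rM j : (M j j)^* = M j j by rewrite conj_Creal // ger0_real.
  rewrite {2}/u qf_linr !(hc _ u) /u !qf_linr !qf_delta !rmorphD !(rmorphM _ c) /= hkl !rM.
  rewrite mulrDr mulrA cc mul1r cM -[(c)^* * _]conjCK rmorphM /= conjCK.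
  by rewrite conjCK cM conj_Creal ?rpredN ?normr_real //; ring.
have := pos u; rewrite -/(qf u M u) E subr_ge0 => h.
have : 2 * `|M k l| <= 2 * \sum_j M j j.
  by apply: le_trans h _; rewrite mulr_natl mulr2n lerD.
by rewrite ler_pM2l ?ltr0n.
Qed.

Lemma trA0_ge0 : 0 <= trA0.
Proof.
rewrite -(Kn_trace_int 0); apply: torus_int_ge0; first by apply: ctorus_sum => k; exact: ctorus_Kn.
move=> x hx; apply: sumr_ge0 => k _; rewrite -qf_delta.
by have [_] := Kn_psd hN htau hkap 0 hx; exact.
Qed.

Definition mass : R := cRe trA0.
Lemma toC_mass : toC mass = trA0.
Proof. by have := trA0_ge0; rewrite /mass; case: trA0 => a b; rewrite lecE /= => /andP[/eqP ->]. Qed.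
Lemma mass_ge0 : 0 <= mass.
Proof. by have := trA0_ge0; rewrite lecE => /andP[]. Qed.

Lemma toC_le (a b : R) : (toC a <= toC b) = (a <= b).
Proof. by rewrite lecE /= eqxx. Qed.

Lemma Lint_norm n k l h (c : R) : ctorus h -> (forall x, onTorus x -> cabs (h x) <= c) ->
  cabs (Lint n k l h) <= c * mass.
Proof.
move=> hh hc; rewrite -toC_le toC_cabs toCM toC_mass -(Kn_trace_int n).
have ct : ctorus (fun x : pt => \sum_k K n x k k) by apply: ctorus_sum => j; exact: ctorus_Kn.
rewrite -torus_int_scale //; apply: torus_int_norm; first exact: ctorus_mulK.
  exact: ctorus_mul (ctorus_cst _) ct.
move=> x hx; rewrite normrM; apply: ler_pM => //.
  by rewrite -toC_cabs toC_le; exact: hc.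
by apply: psd_entry; exact: (Kn_psd hN htau hkap).
Qed.

Lemma Lint_lin n k l c h h' : ctorus h -> ctorus h' ->
  Lint n k l (fun x => c * h x + h' x) = c * Lint n k l h + Lint n k l h'.
Proof.
move=> hh hh'; rewrite /Lint -torus_int_lin; [|exact: ctorus_mulK|exact: ctorus_mulK].
by apply: torus_int_ext => x _; rewrite mulrDl mulrA.
Qed.

Lemma Lint_lpoly_lim k l h : lpoly h -> exists z, cvgC (fun n => Lint n k l h) z.
Proof.
elim=> {h} [c m|p q hp [y hy] hq [z hz]|p q e hp [z hz]].
- have := cvgC_scale c (Lint_xmon_lim k l (fun i => - m i)).
  set z := c * _ => hz; exists z; apply: cvgC_ext hz => n.
  rewrite /Lint -torus_int_scale; last exact: ctorus_mulK (ctorus_xmon _).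
  apply: torus_int_ext => x _; rewrite mulrA; congr (_ * _ * _).
  by apply: eq_bigr => i _; rewrite opprK.
- exists (y + z); apply: cvgC_ext (cvgC_add hy hz) => n.
  rewrite -[Lint n k l p]mul1r -Lint_lin; try exact: ctorus_lpoly.
  by apply: torus_int_ext => x _; rewrite mul1r.
exists z; apply: cvgC_ext hz => n; apply: torus_int_ext => x hx.
by rewrite e.
Qed.

Lemma Lint_lim k l h : ctorus h -> exists z, cvgC (fun n => Lint n k l h) z.
Proof.
move=> hh; apply: cvgC_cauchy => e e0.
(* Approximating up to e / (6 (mass + 1)) changes the integrals by at most e/6; adding 1 to the mass
   avoids a zero denominator. *)
have m0 := mass_ge0; have m1 : 0 < 6 * (mass + 1) by lra.
have e1 : 0 < e / (6 * (mass + 1)) by rewrite divr_gt0.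
have [p hp hpe] := lpoly_dense hh e1; have [z hz] := Lint_lpoly_lim k l hp.
have e6 : 0 < e / 6 by rewrite divr_gt0.
have [n0 H] := cvgC_near hz e6.
have close n : (n0 <= n)%N -> cabs (Lint n k l h - z) < e / 2.
  move=> hn; apply: le_lt_trans (cabs_dist _ (Lint n k l p) _) _.
  have hcp := ctorus_lpoly hp.
  have : cabs (Lint n k l (fun x => -1 * p x + h x)) <= e / (6 * (mass + 1)) * mass.
    apply: Lint_norm => [|x hx]; first exact: ctorus_add (ctorus_mul (ctorus_cst _) hcp) hh.
    by rewrite mulN1r addrC; exact: hpe.
  rewrite Lint_lin // mulN1r addrC.
  have : e / (6 * (mass + 1)) * mass <= e / 6.
    rewrite mulrAC ler_pdivrMr // mulrC [e / 6 * _]mulrAC ler_pdivlMr //.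
    by nra.
  have := H n hn; lra.
exists n0 => n m hn hm; apply: le_lt_trans (cabs_dist _ z _) _.
by rewrite (cabsB z); have := close n hn; have := close m hm; lra.
Qed.

Lemma contT_ctorus f k : contT f -> ctorus (fun x => f x k 0).
Proof. by move=> hf x hx e /(hf x hx)[del d0 H]; exists del => // y hy hd; exact: H. Qed.

Lemma ctorus_contT f : (forall k, ctorus (fun x => f x k 0)) -> contT f.
Proof.
move=> hf x hx e e0.
suff [del d0 H] : exists2 del : R, 0 < del & forall k, k \in enum 'I_d -> forall y, onTorus y ->
    (forall i, cabs (y i - x i) < del) -> cabs (f y k 0 - f x k 0) < e.
  by exists del => // y hy hd k; apply: H; rewrite ?mem_enum.
elim: (enum 'I_d) => [|k r [del d0 IH]]; first by exists 1.
have [del' d0' H] := hf k x hx e e0; exists (Num.min del del'); first by rewrite lt_min d0.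
move=> k' kr y hy hd; have h1 i : cabs (y i - x i) < del /\ cabs (y i - x i) < del'.
  by have := hd i; rewrite lt_min => /andP[].
move: kr; rewrite inE => /orP[/eqP ->|kr].
  by apply: H => // i; case: (h1 i).
by apply: (IH _ kr) => // i; case: (h1 i).
Qed.

Lemma ctorus_fg f g k l : contT f -> contT g -> ctorus (fun x => (f x k 0)^* * g x l 0).
Proof. by move=> hf hg; exact: ctorus_mul (ctorus_conj (contT_ctorus k hf)) (contT_ctorus l hg). Qed.

Lemma Kint_Lint n f g : contT f -> contT g ->
  Kint kappa n f g = \sum_k \sum_l Lint n k l (fun x => (f x k 0)^* * g x l 0).
Proof.
move=> hf hg; have c k l := ctorus_mulK n k l (ctorus_fg k l hf hg).
have -> : Kint kappa n f g =
    torus_int (fun x => \sum_k \sum_l ((f x k 0)^* * g x l 0 * K n x k l)).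
  apply: torus_int_ext => x _; rewrite -/(qf _ _ _) qfE; apply: eq_bigr => k _.
  by apply: eq_bigr => l _; rewrite mulrAC.
rewrite torus_int_sum; last by move=> k; exact: ctorus_sum.
by apply: eq_bigr => k _; rewrite torus_int_sum.
Qed.

Lemma Kint_lim f g : contT f -> contT g -> exists z, cvgC (fun n => Kint kappa n f g) z.
Proof.
move=> hf hg; pose z k l := epsilon (inhabits 0)
  (fun z => cvgC (fun n => Lint n k l (fun x => (f x k 0)^* * g x l 0)) z).
have hz k l : cvgC (fun n => Lint n k l (fun x => (f x k 0)^* * g x l 0)) (z k l).
  by apply: epsilon_spec; apply: Lint_lim; exact: ctorus_fg.
exists (\sum_k \sum_l z k l).
apply: cvgC_ext (cvgC_sum (fun k => cvgC_sum (fun l => hz k l))) => n.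
by rewrite Kint_Lint.
Qed.

(** On continuous arguments the choice is meaningful by [Kint_lim]; uniqueness of limits
    ([limformE]) transfers each property from the approximants. *)
Definition limform f g : Cx := epsilon (inhabits 0) (fun z => cvgC (fun n => Kint kappa n f g) z).

Lemma limformP f g : contT f -> contT g -> cvgC (fun n => Kint kappa n f g) (limform f g).
Proof. by move=> hf hg; apply: epsilon_spec; exact: Kint_lim. Qed.

Lemma limformE f g z : cvgC (fun n => Kint kappa n f g) z -> limform f g = z.
Proof.
move=> h; apply: (@cvgC_unique (fun n => Kint kappa n f g)) => //.
by apply: epsilon_spec; exists z.
Qed.

Lemma ctorus_qf n f g : contT f -> contT g -> ctorus (fun x => qf (f x) (K n x) (g x)).
Proof.
move=> hf hg; apply: ctorus_ext => [x _|]; first by rewrite qfE.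
apply: ctorus_sum => k; apply: ctorus_sum => l; apply: ctorus_mul (contT_ctorus l hg).
exact: ctorus_mul (ctorus_conj (contT_ctorus k hf)) (ctorus_Kn n k l).
Qed.

Lemma limform_herm f g : contT f -> contT g -> limform g f = (limform f g)^*.
Proof.
move=> hf hg; apply: limformE; apply: cvgC_ext (cvgC_conj (limformP hf hg)) => n.
rewrite /Kint -torus_int_conj; last exact: ctorus_qf.
by apply: torus_int_ext => x hx; symmetry; exact: (Kn_herm hN htau hkap n (f x) (g x) hx).
Qed.

Lemma limform_lin f g1 g2 c : contT f -> contT g1 -> contT g2 ->
  limform f (fun x => c *: g1 x + g2 x) = c * limform f g1 + limform f g2.
Proof.
move=> hf h1 h2; apply: limformE.
apply: cvgC_ext (cvgC_add (cvgC_scale c (limformP hf h1)) (limformP hf h2)) => n.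
rewrite /Kint -torus_int_lin; [|exact: ctorus_qf|exact: ctorus_qf].
by apply: torus_int_ext => x _; rewrite -!/(qf _ _ _) qf_linr.
Qed.

Lemma limform_ge0 f : contT f -> 0 <= limform f f.
Proof.
move=> hf; apply: cvgC_ge0 (limformP hf hf) => n; apply: torus_int_ge0.
  exact: ctorus_qf.
by move=> x hx; have [_] := Kn_psd hN htau hkap n hx; exact.
Qed.

Lemma cabs_vnorm (v : 'cV[Cx]_d) k : cabs (v k 0) <= @vnorm N tau v.
Proof.
rewrite /vnorm -[cabs _]ger0_norm ?cabs_ge0 // -sqrtr_sqr ler_sqrt; last first.
  by apply: sumr_ge0 => i _; exact: sqr_ge0.
by rewrite (bigD1 k) //= lerDl; apply: sumr_ge0 => i _; exact: sqr_ge0.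
Qed.

(** Each of the d^2 entries contributes at most Mf Mg [mass], uniformly in n; the factor 2 is that
    of [cvgC_bound]. *)
Lemma limform_bound f g (Mf Mg : R) : contT f -> contT g ->
  (forall x, onTorus x -> @vnorm N tau (f x) <= Mf) ->
  (forall x, onTorus x -> @vnorm N tau (g x) <= Mg) ->
  cabs (limform f g) <= 2 * (d%:R * d%:R * mass) * Mf * Mg.
Proof.
move=> hf hg bf bg.
have -> : 2 * (d%:R * d%:R * mass) * Mf * Mg = 2 * (d%:R * (d%:R * (Mf * Mg * mass))) by ring.
apply: cvgC_bound (limformP hf hg) => n; rewrite Kint_Lint //.
apply: le_trans (cabs_sum _ _ _) _.
have E (a : R) : d%:R * a = \sum_(i < d) a by rewrite sumr_const card_ord mulr_natl.
rewrite E; apply: ler_sum => k _; apply: le_trans (cabs_sum _ _ _) _.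
rewrite E; apply: ler_sum => l _; apply: Lint_norm; first exact: ctorus_fg.
move=> x hx; rewrite cabsM cabs_conj ler_pM ?cabs_ge0 //.
  exact: le_trans (cabs_vnorm _ _) (bf x hx).
exact: le_trans (cabs_vnorm _ _) (bg x hx).
Qed.

Local Notation form := (@formT N tau kappa).

Lemma qf_sum2 (J : finType) (u v : J -> 'cV[Cx]_d) (M : 'M[Cx]_d) :
  qf (\sum_a u a) M (\sum_b v b) = \sum_a \sum_b qf (u a) M (v b).
Proof.
have -> : qf (\sum_a u a) M (\sum_b v b) = \sum_b qf (\sum_a u a) M (v b).
  by rewrite /qf mulmx_sumr summxE.
rewrite exchange_big; apply: eq_bigr => b _; rewrite /qf.
have -> : ctr (\sum_a u a) = \sum_a ctr (u a).
  apply/matrixP=> i j; rewrite summxE !mxE summxE rmorph_sum.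
  by apply: eq_bigr => a _; rewrite !mxE.
by rewrite !mulmx_suml summxE.
Qed.

Lemma ctorus_xpow (a : 'X_{1..N}) : ctorus (fun x => xpow x a).
Proof. by apply: ctorus_prod => i; exact: ctorus_exp (ctorus_coord i). Qed.

Lemma evalO_mono a u x : evalO (mono a (unscale u) : V) x = xpow x a *: u.
Proof.
apply/colP=> i; rewrite !mxE /mono smulE !mxE mevalM mevalX mevalC -/(sC i) mulrCA; congr (_ * _).
by rewrite mulrC divfK // sC_neq0.
Qed.

Lemma evalO_sum (J : finType) (F : J -> V) x : evalO (\sum_j F j) x = \sum_j evalO (F j) x.
Proof.
apply/colP=> i; rewrite mxE summxE summxE rmorph_sum mulr_sumr.
by apply: eq_bigr => j _; rewrite mxE.
Qed.

Definition scaled_coef (p : V) (a : 'X_{1..N}) : 'cV[Cx]_d := \col_i (sC i * cf a p i 0).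

Lemma mono_expand D (p : V) : (pdeg p <= D)%N ->
  p = \sum_(a : 'X_{1..N < D}) mono a (unscale (scaled_coef p a)).
Proof.
move=> hD; rewrite [LHS](cf_expand (fun a => cf_pdeg hD)); apply: eq_bigr => a _.
by congr (mono _ _); apply/colP=> i; rewrite !mxE mulrC mulKf // sC_neq0.
Qed.

Lemma contT_evalO (p : V) : contT (evalO p).
Proof.
apply: ctorus_contT => k.
apply: ctorus_ext => [x _|].
  by rewrite [in RHS](mono_expand (leqnn (pdeg p))) evalO_sum summxE.
apply: ctorus_sum => a; apply: ctorus_ext => [x _|]; first by rewrite evalO_mono mxE.
exact: ctorus_mul (ctorus_xpow a) (ctorus_cst _).
Qed.

(** On the torus conj(x^a) x^b is the character of frequency b - a. Its limit against the kernel is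
    A_{a-b} for equal degrees, which [Amat_diff] turns into the form; for different degrees both
    sides vanish. *)
Lemma Kint_mono_lim (a b : 'X_{1..N}) u v :
  cvgC (fun n => Kint kappa n (evalO (mono a (unscale u) : V)) (evalO (mono b (unscale v) : V)))
    (form (mono a (unscale u)) (mono b (unscale v))).
Proof.
pose g i := (a i)%:Z - (b i)%:Z.
have gE : (\sum_i g i == 0) = (mdeg a == mdeg b).
  by rewrite /g sumrB -!(big_morph Posz PoszD (erefl _)) -!mdegE subr_eq0.
have -> : form (mono a (unscale u)) (mono b (unscale v)) =
    \sum_k \sum_l ((u k 0)^* * v l 0) * (if \sum_i g i == 0 then A g k l else 0).
  rewrite gE; case: eqP => [h|/eqP h]; last first.
    rewrite (formT_deg hN htau hkap) // big1 // => k _; rewrite big1 // => l _.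
    by rewrite mulr0.
  rewrite -(Amat_diff hN htau hkap) qfE; apply: eq_bigr => k _; apply: eq_bigr => l _.
  by rewrite mulrAC.
have C k l := cvgC_scale ((u k 0)^* * v l 0) (Lint_xmon_lim k l g).
apply: cvgC_ext (cvgC_sum (fun k => cvgC_sum (fun l => C k l))) => n.
rewrite Kint_Lint; [|exact: contT_evalO|exact: contT_evalO].
apply: eq_bigr => k _; apply: eq_bigr => l _.
rewrite /Lint -torus_int_scale; last exact: ctorus_mulK (ctorus_xmon _).
apply: torus_int_ext => x hx; rewrite !evalO_mono !mxE mulrA; congr (_ * _).
have -> : xmon x (fun i => - g i) = xpow x b / xpow x a.
  rewrite -(xmon_diff b a hx); congr xmon.
  by apply: functional_extensionality => i; rewrite /g opprB.
have -> : (xpow x a)^-1 = (xpow x a)^*.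
  by rewrite -[in RHS](xpow_conj a hx) conjCK.
by rewrite rmorphM; ring.
Qed.

Lemma Kint_poly_lim (p q : V) : cvgC (fun n => Kint kappa n (evalO p) (evalO q)) (form p q).
Proof.
pose D := maxn (pdeg p) (pdeg q).
have [hp hq] : (pdeg p <= D)%N /\ (pdeg q <= D)%N by rewrite leq_maxl leq_maxr.
pose P (a : 'X_{1..N < D}) : V := mono a (unscale (scaled_coef p a)).
pose Q (a : 'X_{1..N < D}) : V := mono a (unscale (scaled_coef q a)).
have pE : p = \sum_a P a := mono_expand hp.
have qE : q = \sum_a Q a := mono_expand hq.
have -> : form p q = \sum_a \sum_b form (P a) (Q b) by rewrite {1}pE {1}qE (formT_sum hN htau hkap).
have L a b : cvgC (fun n => Kint kappa n (evalO (P a)) (evalO (Q b))) (form (P a) (Q b)).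
  exact: Kint_mono_lim.
apply: cvgC_ext (cvgC_sum (fun a => cvgC_sum (L a))) => n.
have cT (a b : 'X_{1..N < D}) := ctorus_qf n (contT_evalO (P a)) (contT_evalO (Q b)).
transitivity (torus_int (fun x => \sum_a \sum_b qf (evalO (P a) x) (K n x) (evalO (Q b) x))).
  rewrite torus_int_sum; last by move=> a; exact: ctorus_sum.
  by apply: eq_bigr => a _; rewrite torus_int_sum.
apply: torus_int_ext => x _; rewrite -qf_sum2.
by rewrite pE qE !evalO_sum.
Qed.

End WeakLimit.

Unset Implicit Arguments.

Theorem theorem4p9 (N : nat) (tau : seq nat) (kappa : R) :
  (2 <= N)%N -> is_partition N tau -> tau != [:: N] -> tau != nseq N 1%N ->
  - ((h_tau tau)%:R)^-1 < kappa < ((h_tau tau)%:R)^-1 ->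
  (forall n : nat, (1 <= n)%N ->
     [/\ (* (1) *)
         (forall x, onTorus x -> @psd N tau (@Kn N tau kappa n x)),
         (* (2) *)
         (forall (x : 'I_N -> Cx) (w : {perm 'I_N}), onTorus x ->
            @Kn N tau kappa n (fun i => x (w i))
            = invmx (@tauO N tau w) *m @Kn N tau kappa n x *m @tauO N tau w) &
         (* (3) *)
         @Kn N tau kappa n (@x0 N) *m @tauO N tau (w0 N)
         = @tauO N tau (w0 N) *m @Kn N tau kappa n (@x0 N)]) /\
  (* (4) polynomials *)
  (forall f g : PV N tau,
     cvgC (fun n => @Kint N tau kappa n (@evalO N tau f) (@evalO N tau g))
          (@formT N tau kappa f g)) /\
  (* (4) continuous functions *)
  (exists B : (('I_N -> Cx) -> 'cV[Cx]_(dimV N tau)) ->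
              (('I_N -> Cx) -> 'cV[Cx]_(dimV N tau)) -> Cx,
     [/\ (forall f g, @contT N tau f -> @contT N tau g ->
            cvgC (fun n => @Kint N tau kappa n f g) (B f g)),
         (forall f g, @contT N tau f -> @contT N tau g -> B g f = (B f g)^*),
         (forall f g1 g2 (c : Cx), @contT N tau f -> @contT N tau g1 -> @contT N tau g2 ->
            B f (fun x => c *: g1 x + g2 x) = c * B f g1 + B f g2),
         (forall f, @contT N tau f -> 0 <= B f f) &
         (exists Cst : R, forall f g (Mf Mg : R), @contT N tau f -> @contT N tau g ->
            (forall x, onTorus x -> @vnorm N tau (f x) <= Mf) ->
            (forall x, onTorus x -> @vnorm N tau (g x) <= Mg) ->
            cabs (B f g) <= Cst * Mf * Mg)]).
Proof.
move=> N2 htau _ _ hkap; have hN : (0 < N)%N by exact: ltnW.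
split=> [n _|].
  split=> [x hx|x w hx|]; first exact: (Kn_psd hN htau hkap).
    exact: (Kn_conj hN htau hkap).
  exact: (Kn_x0 hN htau hkap).
split=> [f g|]; first exact: (Kint_poly_lim hN htau hkap).
exists (limform kappa); split.
- exact: (limformP hN htau hkap).
- exact: (limform_herm hN htau hkap).
- by move=> f g1 g2 c; exact: (limform_lin hN htau hkap).
- exact: (limform_ge0 hN htau hkap).
exists (2 * ((dimV N tau)%:R * (dimV N tau)%:R * mass N tau kappa)) => f g Mf Mg.
exact: (limform_bound hN htau hkap).
Qed.
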